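(* The heat operator of the $\pi$-projected Laplacian $\mathcal{L}^{pr}$ on $\ell^2(\mathbb{Z})$ is given, for $t\ge0$, by $$h_t^{pr}=e^{-t\mathcal{L}^{pr}}=\int_{\mathbb{R}}e^{-t\lambda}\,\mathrm{d}\nu^{pr}(\lambda),$$ where $\nu^{pr}$ is the spectral measure of $\mathcal{L}^{pr}$ in $\ell^2(\mathbb{Z})$. Explicitly, $\nu^{pr}$ is the projection-valued measure on the Borel $\sigma$-algebra of $\mathbb{R}$ such that $\nu^{pr}(\lambda):=\nu^{pr}((-\infty,\lambda])$ is the self-adjoint projection in $\ell^2(\mathbb{Z})$ acting as $(\nu^{pr}(\lambda)g)(m)=\sum_{n\in\mathbb{Z}}\nu^{pr}(\lambda)(m,n)g(n)$, $g\in\ell^2(\mathbb{Z})$, with matrix coefficients $$\begin{aligned}\nu^{pr}(\lambda)(m,n) ={}& \chi_{(-\infty,\lambda]} \big(\tfrac 34 \big) f_1(n) f_1(m) + \chi_{(-\infty,\lambda]} \big(\tfrac 74 \big) f_{-1}(n) f_{-1}(m) \\ &+ \int_0^\pi \chi_{(-\infty,\lambda]\cap I_0} \Big( \frac{7}{8}-\frac{R_x}{2} \Big) \sum_{\epsilon\in\{\pm1\}} f_{x,1,\epsilon}(n) f_{x,1,\epsilon}(m) \frac{\mathrm{d}x}{H_{\epsilon}(x)} \\ &+ \int_0^\pi \chi_{(-\infty,\lambda]\cap I_1} \Big( \frac{7}{8}+\frac{R_x}{2} \Big) \sum_{\epsilon\in\{\pm1\}} f_{x,-1,\epsilon}(n)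 f_{x,-1,\epsilon}(m) \frac{\mathrm{d}x}{H_{-\epsilon}(x)}.\end{aligned}$$
   Context: $\mathcal{L}^{pr}$ is the bounded self-adjoint operator on $\ell^2(\mathbb{Z})$ given by: for $m\ge0$ even, $(\mathcal{L}^{pr}f)(m)=f(m)-\frac12f(m-1)-\frac1{2\sqrt2}f(m+1)$; for $m\ge0$ odd, $(\mathcal{L}^{pr}f)(m)=\frac34f(m)-\frac1{2\sqrt2}f(m-1)-\frac12f(m+1)$; for $m\ge0$ even, $(\mathcal{L}^{pr}f)(-m-1)=f(-m-1)-\frac12f(-m)-\frac1{2\sqrt2}f(-m-2)$; for $m\ge0$ odd, $(\mathcal{L}^{pr}f)(-m-1)=\frac34f(-m-1)-\frac1{2\sqrt2}f(-m)-\frac12f(-m-2)$. $\chi_B$ is the indicator function of $B\subset\mathbb{R}$; $R_x=\sqrt{\frac{25}{16}+\sqrt2\cos(x)}$; $H_\nu(x)=2\pi R_x\big(2R_x-\nu(2+\sqrt2\cos(x))\big)$ for $\nu=\pm1$; $I_0=[\lambda_0,\frac74-\lambda_1]$ and $I_1=[\lambda_1,\frac74-\lambda_0]$ with $\lambda_0=\frac78-\frac12\sqrt{\frac{25}{16}+\sqrt2}$, $\lambda_1=\frac78+\frac12\sqrt{\frac{25}{16}-\sqrt2}$. For $\epsilon,\mu\in\{\pm1\}$, $x\in[0,\pi]$, the functions $f_\epsilon,f_{x,\mu,\epsilon}\colon\mathbb{Z}\to\mathbb{R}$ are defined for $m\ge0$ by $$f_\epsilon(m)=\begin{cases}\frac{-1}{\sqrt6}(-\epsilon\sqrt2)^{-n}&\text{if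 } m=2n,\\ \frac{1}{2\sqrt3}(-\epsilon\sqrt2)^{-n}&\text{if } m=2n+1,\end{cases}$$ $$f_{x,\mu,\epsilon}(m)=\begin{cases}(1+\frac{\epsilon}{4}-\epsilon\mu R_x)\sin(nx)+\frac{1}{\sqrt2}\sin((n+1)x)&\text{if } m=2n,\\ (\mu R_x+\frac14-\epsilon)\sin((n+1)x)-\frac{\epsilon}{\sqrt2}\sin(nx)&\text{if } m=2n+1,\end{cases}$$ and for negative integers by $f_\epsilon(-m-1)=\epsilon f_\epsilon(m)$, $f_{x,\mu,\epsilon}(-m-1)=\epsilon f_{x,\mu,\epsilon}(m)$. *)

(* Defs.v *)
From HB Require Import structures.
From mathcomp Require Import all_boot all_order all_algebra.
From mathcomp Require Import all_classical all_reals all_analysis.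
From mathcomp Require Import complex ring lra.

Set Implicit Arguments.
Unset Strict Implicit.
Unset Printing Implicit Defensive.

Import Order.TTheory GRing.Theory Num.Theory.
Import numFieldNormedType.Exports.

Local Open Scope classical_set_scope.
Local Open Scope ring_scope.
Local Open Scope complex_scope.

Section Ell2.
Variable R : realType.

Definition sqmod (z : R[i]) : R := complex.Re z ^+ 2 + complex.Im z ^+ 2.

Definition ell2_pred : {pred (int -> R[i])} :=
  fun f => `[< summable [set: int] (fun m => (sqmod (f m))%:E) >].

Lemma sqmod_ge0 z : 0 <= sqmod z.
Proof. by rewrite addr_ge0 ?sqr_ge0. Qed.

Lemma sqmodM z w : sqmod (z * w) = sqmod z * sqmod w.
Proof. by case: z w => [a b] [c d]; rewrite /sqmod /=; ring. Qed.

Lemma le_sqmodD z w : sqmod (z + w) <= (sqmod z + sqmod w) *+ 2.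
Proof.
case: z w => [a b] [c d]; rewrite /sqmod /= -subr_ge0.
rewrite [X in 0 <= X](_ : _ = (a - c) ^+ 2 + (b - d) ^+ 2); last by ring.
by rewrite addr_ge0 ?sqr_ge0.
Qed.

Lemma ell2_predE f : f \in ell2_pred <->
  (\esum_(m in [set: int]) (sqmod (f m))%:E < +oo)%E.
Proof.
rewrite unfold_in asboolE /summable.
by under eq_esum do rewrite gee0_abs ?lee_fin ?sqmod_ge0//.
Qed.

Lemma ell2_pred_le f g :
  (forall m, sqmod (f m) <= sqmod (g m)) -> g \in ell2_pred -> f \in ell2_pred.
Proof.
move=> fg /ell2_predE gfin; apply/ell2_predE; apply: le_lt_trans gfin.
by apply: le_esum => m _; rewrite lee_fin.
Qed.

Lemma ell2_pred0 : (0 : int -> R[i]) \in ell2_pred.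
Proof.
apply/ell2_predE; rewrite esum1 ?ltry// => m _.
by rewrite /sqmod/= expr0n/= addr0.
Qed.

Lemma ell2_predD f g : f \in ell2_pred -> g \in ell2_pred ->
  f + g \in ell2_pred.
Proof.
move=> /ell2_predE fe /ell2_predE ge; apply/ell2_predE.
set F := fun m => (sqmod (f m))%:E; set G := fun m => (sqmod (g m))%:E.
have F0 m : [set: int] m -> (0 <= F m)%E by rewrite lee_fin sqmod_ge0.
have G0 m : [set: int] m -> (0 <= G m)%E by rewrite lee_fin sqmod_ge0.
apply: (@le_lt_trans _ _
  (\esum_(m in [set: int]) ((F m + G m) + (F m + G m)))%E).
  apply: le_esum => m _.
  by rewrite /F/G -!EFinD lee_fin -mulr2n le_sqmodD.
rewrite !esumD//; do ?by move=> m _; rewrite adde_ge0 ?F0 ?G0.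
by rewrite !lte_add_pinfty.
Qed.

Lemma ell2_predZ (a : R[i]) f : f \in ell2_pred -> a *: f \in ell2_pred.
Proof.
move=> fe; have [n an] : exists n, sqmod a <= n%:R.
  by exists (Num.bound (sqmod a)); rewrite ltW// archi_boundP// sqmod_ge0.
apply/ell2_predE; move/ell2_predE : fe => fe.
apply: (@le_lt_trans _ _
  (\sum_(i < n) \esum_(m in [set: int]) (sqmod (f m))%:E)%E).
  rewrite -esum_sum; last by move=> *; rewrite lee_fin sqmod_ge0.
  apply: le_esum => m _; rewrite sumEFin lee_fin sumr_const card_ord.
  rewrite (_ : (a *: f) m = a * f m)// sqmodM -mulr_natl.
  by rewrite ler_wpM2r ?sqmod_ge0.
by apply: lte_sum_pinfty => i _.
Qed.

Lemma ell2_submod : submod_closed ell2_pred.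
Proof.
split; first exact: ell2_pred0.
by move=> a f g fe ge; rewrite ell2_predD ?ell2_predZ.
Qed.

HB.instance Definition _ :=
  GRing.isSubmodClosed.Build R[i] (int -> R[i]) ell2_pred ell2_submod.

Record ell2 := Ell2 { ell2_fun :> int -> R[i]; _ : ell2_fun \in ell2_pred }.

HB.instance Definition _ := [isSub for ell2_fun].
HB.instance Definition _ := [Choice of ell2 by <:].
HB.instance Definition _ := [SubChoice_isSubLmodule of ell2 by <:].

(* Unconditional sum over Z; it is the sum of the family as soon as
   the family is absolutely summable. *)
Definition sumZ (u : int -> R) : R :=
  fine (esum [set: int] (EFin \o u)^\+ - esum [set: int] (EFin \o u)^\-).

Definition sumZC (u : int -> R[i]) : R[i] :=
  sumZ (fun m => complex.Re (u m)) +i* sumZ (fun m => complex.Im (u m)).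

Definition summableZC (u : int -> R[i]) : Prop :=
  summable [set: int] (fun m => (Num.sqrt (sqmod (u m)))%:E).

Definition inner (f g : ell2) : R[i] := sumZC (fun m => f m * (g m)^*).

Definition norm2 (f : ell2) : R := Num.sqrt (sumZ (fun m => sqmod (f m))).

(* Everywhere defined and symmetric; such an operator is bounded by the
   Hellinger-Toeplitz theorem. *)
Definition selfadjoint (T : ell2 -> ell2) : Prop :=
  forall f g, inner (T f) g = inner f (T g).

(* The values of E outside the Borel sets are irrelevant. *)
Definition projection_valued_measure
    (E : set (measurableTypeR R) -> {linear ell2 -> ell2}) : Prop :=
  [/\ forall B, measurable B ->
        selfadjoint (E B) /\ (forall g, E B (E B g) = E B g),
      forall g, E setT g = g,
      forall A B, measurable A -> measurable B ->
        forall g, E (A `&` B) g = E A (E B g)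
    & forall F : (set (measurableTypeR R))^nat,
        (forall k, measurable (F k)) -> trivIset setT F ->
        forall g, (fun n => norm2 (\sum_(k < n) E (F k) g
                                   - E (\bigcup_k F k) g)) @ \oo --> (0 : R)].

Definition pvm_eq
    (E E' : set (measurableTypeR R) -> {linear ell2 -> ell2}) : Prop :=
  forall B, measurable B -> forall g, E B g = E' B g.

(* T is the operator \int phi dE: <T g, g> is the integral of phi against the
   scalar measure B |-> <E(B) g, g>, for every g. By polarization (the scalars
   are complex) these quadratic forms determine T. *)
Definition is_spectral_integral
    (E : set (measurableTypeR R) -> {linear ell2 -> ell2})
    (phi : R -> R) (T : {linear ell2 -> ell2}) : Prop :=
  forall g : ell2, exists mu : {measure set (measurableTypeR R) -> \bar R},
    [/\ forall B, measurable B -> mu B = (complex.Re (inner (E B g) g))%:E,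
        mu.-integrable setT (EFin \o phi)
      & inner (T g) g = (\int[mu]_(l in setT) phi l)%:C].

Definition is_spectral_measure
    (E : set (measurableTypeR R) -> {linear ell2 -> ell2})
    (T : {linear ell2 -> ell2}) : Prop :=
  projection_valued_measure E /\ is_spectral_integral E (fun l => l) T.

(* T is exp(A): the exponential series of A converges to T in operator norm. *)
Definition is_exponential (A T : ell2 -> ell2) : Prop :=
  forall e : R, 0 < e -> \forall n \near \oo, forall g : ell2,
    norm2 (\sum_(k < n) ((k`!%:R)^-1 : R[i]) *: iter k A g - T g)
      <= e * norm2 g.

Definition has_kernel (T : ell2 -> ell2) (K : int -> int -> R) : Prop :=
  forall (g : ell2) (m : int),
    summableZC (fun n => (K m n)%:C * g n) /\
    T g m = sumZC (fun n => (K m n)%:C * g n).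

End Ell2.

Section Laplacian.
Variable R : realType.
Implicit Types f g : int -> R[i].

Definition Lpr_fun f (z : int) : R[i] :=
  match z with
  | Posz m =>
      if ~~ odd m then
        f m - (1 / 2)%:C * f (m%:Z - 1)
            - (1 / (2 * Num.sqrt 2))%:C * f (m%:Z + 1)
      else
        (3 / 4)%:C * f m - (1 / (2 * Num.sqrt 2))%:C * f (m%:Z - 1)
            - (1 / 2)%:C * f (m%:Z + 1)
  | Negz m => (* z = - m - 1 *)
      if ~~ odd m then
        f (- m%:Z - 1) - (1 / 2)%:C * f (- m%:Z)
            - (1 / (2 * Num.sqrt 2))%:C * f (- m%:Z - 2)
      else
        (3 / 4)%:C * f (- m%:Z - 1) - (1 / (2 * Num.sqrt 2))%:C * f (- m%:Z)
            - (1 / 2)%:C * f (- m%:Z - 2)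
  end.

Lemma ell2_pred_shift (a : int) f : f \in @ell2_pred R ->
  (fun m => f (m + a)) \in @ell2_pred R.
Proof.
move=> /ell2_predE fe; apply/ell2_predE; apply: le_lt_trans fe.
rewrite [leRHS](@reindex_esum _ _ _ [set: int] [set: int] (fun m => m + a))//.
split => //.
- by move=> x y _ _ /addIr.
- by move=> y _; exists (y - a); rewrite ?subrK.
Qed.

Lemma ell2_pred_mul (c : int -> R) f : (forall m, `|c m| <= 1) ->
  f \in @ell2_pred R -> (fun m => (c m)%:C * f m) \in @ell2_pred R.
Proof.
move=> c1; apply: ell2_pred_le => m.
rewrite sqmodM ler_piMl ?sqmod_ge0//.
by rewrite /sqmod/= expr0n/= addr0 -real_normK ?num_real// expr_le1.
Qed.

Lemma Lpr_fun_coef : exists a b c : int -> R,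
  [/\ forall m, `|a m| <= 1, forall m, `|b m| <= 1, forall m, `|c m| <= 1
    & forall f z, Lpr_fun f z =
        (a z)%:C * f z + (b z)%:C * f (z - 1) + (c z)%:C * f (z + 1)].
Proof.
pose s : R := 1 / (2 * Num.sqrt 2).
have s1 : `|- s| <= 1.
  have s21 : 1 <= Num.sqrt 2 :> R by rewrite -{1}sqrtr1 ler_sqrt// ler1n.
  rewrite normrN /s div1r normfV invf_le1; last first.
    by rewrite normr_gt0 gt_eqF// mulr_gt0// sqrtr_gt0.
  by rewrite ger0_norm; lra.
have h1 : `|- (1 / 2)| <= 1 :> R by rewrite normrN ger0_norm; lra.
have q1 : `|3 / 4| <= 1 :> R by rewrite ger0_norm; lra.
pose par (z : int) := match z with Posz m => odd m | Negz m => odd m end.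
pose neg (z : int) := match z with Posz m => false | Negz m => true end.
exists (fun z => if par z then 3 / 4 else 1).
exists (fun z => if par z (+) neg z then - s else - (1 / 2)).
exists (fun z => if par z (+) neg z then - (1 / 2) else - s).
split.
- by move=> z; case: ifP; rewrite // normr1.
- by move=> z; case: ifP.
- by move=> z; case: ifP.
move=> f [m|m] /=.
  by case: (odd m) => /=; rewrite !raddfN /= !mulNr ?rmorph1 ?mul1r// /s div1r.
have e1 : - m%:Z - 1 = Negz m by rewrite NegzE -addn1 PoszD opprD.
have e2 : - m%:Z = Negz m + 1 by rewrite -e1 subrK.
have e3 : - m%:Z - 2 = Negz m - 1 by rewrite -e1 -addrA -opprD.
rewrite e1 e3 e2.
by case: (odd m) => /=; rewrite !raddfN /= !mulNr ?rmorph1 ?mul1r//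
  ?/s ?div1r addrAC.
Qed.

Lemma Lpr_subproof (f : ell2 R) : Lpr_fun f \in @ell2_pred R.
Proof.
have [a [b [c [a1 b1 c1 LE]]]] := Lpr_fun_coef.
have fe : (f : int -> R[i]) \in @ell2_pred R by case: f.
rewrite (_ : Lpr_fun f = (fun z => (a z)%:C * f z) +
  (fun z => (b z)%:C * f (z - 1)) + (fun z => (c z)%:C * f (z + 1))); last first.
  by apply/funext => z; rewrite LE.
by rewrite !ell2_predD// ell2_pred_mul//; exact: ell2_pred_shift.
Qed.

Definition Lpr (f : ell2 R) : ell2 R := Ell2 (Lpr_subproof f).

Lemma Lpr_is_linear : linear Lpr.
Proof.
move=> k f g; apply: val_inj; apply/funext => z /=.
have [a [b [c [_ _ _ LE]]]] := Lpr_fun_coef.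
rewrite [LHS](_ : _ = Lpr_fun (fun y => k * f y + g y) z)//.
rewrite [RHS](_ : _ = k * Lpr_fun f z + Lpr_fun g z)// !LE.
by ring.
Qed.

HB.instance Definition _ :=
  GRing.isLinear.Build R[i] (ell2 R) (ell2 R) *:%R Lpr Lpr_is_linear.

End Laplacian.

Section Coefficients.
Variable R : realType.
Implicit Types x e nu mu l : R.

Definition Rx x : R := Num.sqrt (25 / 16 + Num.sqrt 2 * cos x).

Definition Hx nu x : R :=
  2 * pi * Rx x * (2 * Rx x - nu * (2 + Num.sqrt 2 * cos x)).

Definition lambda0 : R := 7 / 8 - 1 / 2 * Num.sqrt (25 / 16 + Num.sqrt 2).
Definition lambda1 : R := 7 / 8 + 1 / 2 * Num.sqrt (25 / 16 - Num.sqrt 2).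

Definition I0 : set R := `[lambda0, 7 / 4 - lambda1].
Definition I1 : set R := `[lambda1, 7 / 4 - lambda0].

(* Extension from m >= 0 to Z by u (- m - 1) = e * u m. *)
Definition extendZ e (u : nat -> R) (z : int) : R :=
  match z with Posz m => u m | Negz m => e * u m end.

Definition feig e : int -> R := extendZ e (fun m =>
  let n := m./2 in
  if ~~ odd m then - 1 / Num.sqrt 6 * (- e * Num.sqrt 2) ^- n
  else 1 / (2 * Num.sqrt 3) * (- e * Num.sqrt 2) ^- n).

Definition fgen x mu e : int -> R := extendZ e (fun m =>
  let n := m./2 in
  if ~~ odd m then
    (1 + e / 4 - e * mu * Rx x) * sin (n%:R * x)
      + 1 / Num.sqrt 2 * sin (n.+1%:R * x)
  else
    (mu * Rx x + 1 / 4 - e) * sin (n.+1%:R * x)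
      - e / Num.sqrt 2 * sin (n%:R * x)).

Definition nu_coef l (m n : int) : R :=
  \1_`]-oo, l] (3 / 4 : R) * (feig 1 n * feig 1 m)
  + \1_`]-oo, l] (7 / 4 : R) * (feig (-1) n * feig (-1) m)
  + \int[lebesgue_measure]_(x in `[0, pi])
      (\1_(`]-oo, l] `&` I0) (7 / 8 - Rx x / 2) *
       \sum_(e <- [:: 1; -1]) fgen x 1 e n * fgen x 1 e m / Hx e x)
  + \int[lebesgue_measure]_(x in `[0, pi])
      (\1_(`]-oo, l] `&` I1) (7 / 8 + Rx x / 2) *
       \sum_(e <- [:: 1; -1]) fgen x (-1) e n * fgen x (-1) e m / Hx (- e) x).

End Coefficients.

(* Main.v *)
(** The operator commutes with the reflection m <-> - m - 1, so it is a sum of two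
Jacobi operators on the half-line, whose (generalized) eigenfunctions are the
f_e and f_{x,mu,e}. Integrating p(lambda) against products of these eigenfunctions
gives a kernel M p for every bounded Borel p. All properties of a Borel functional
calculus are then visible on kernels, except two.

Completeness, M 1 = identity: M 1 commutes with the Jacobi operators, so it is
determined by its first row, and there the square roots R_x cancel between the two
bands, leaving integrals of cos(n x) / (9/4 - 2 cos^2 x); these are bounded
solutions of a linear recurrence, hence explicit geometric sequences.

Multiplicativity, M (p q) = M p * M q: since M (x p) = L * M p it holds for
polynomials p, and the indicator of a ray is a bounded pointwise limit of polynomials
(1 - (x/2)^n)^{N_n} on [0, 2], which contains the spectrum; a monotone class argument
gives all Borel indicators.

Uniqueness: the projections of any spectral measure E' of L commute with L, hence with
M p. On the intersection of the ranges of E(]-oo, l]) and E'(]l, +oo[) the quadratic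
form of L would be both <= l and > l, so this intersection is 0. *)

From HB Require Import structures.
Require Import Defs.
From mathcomp Require Import all_boot all_order all_algebra.
From mathcomp Require Import all_classical all_reals all_analysis.
From mathcomp Require Import measurable_realfun complex ring lra zify.

Set Implicit Arguments.
Unset Strict Implicit.
Unset Printing Implicit Defensive.

Import Order.TTheory GRing.Theory Num.Theory.
Import numFieldNormedType.Exports.
Local Open Scope classical_set_scope.
Local Open Scope ring_scope.
Local Open Scope complex_scope.

(** * Sums over the integers and the real inner product *)

(** Multiplicativity is not derived from orthogonality of the generalized eigenfunctions, which
    would be a distributional identity. Positivity and M 1 = identity replace it: if |p| <= C on
    [0, 2], then C - p and C + p are nonnegative there, so the quadratic form of M p, and with it
    the operator norm, is bounded by C. This bound is uniform along a bounded sequence of functions.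
    Hence the convergence of single matrix entries, which dominated convergence provides, becomes
    weak convergence of operators. Weak convergence is enough because all operators of the calculus
    are symmetric: in a product, the fixed factor moves to the other side of the inner product.
    Completeness is thus the only point where integrals of products of eigenfunctions are computed.
    Since all kernels are real, the work is done with the real part of the inner product. *)

Section Windows.
Variable R : realType.
Implicit Types (u v : int -> R) (z : int).

(** The integers from -N to N - 1, a set stable under z <-> - z - 1. [sumZ] is made of suprema over
    finite sets; these windows turn it into a limit of finite sums. *)
Definition win N : seq int := map Posz (iota 0 N) ++ map Negz (iota 0 N).

Lemma mem_win N z :
  (z \in win N) = match z with Posz k => (k < N)%N | Negz k => (k < N)%N end.
Proof.
rewrite mem_cat; case: z => k.
  rewrite mem_map ?mem_iota//= ?add0n; last by move=> a b [].
  rewrite orbC; case: (boolP (_ \in _)) => //= /mapP[x _]//.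
rewrite orbC mem_map ?mem_iota//= ?add0n; last by move=> a b [].
by rewrite orbC; case: (boolP (_ \in _)) => //= /mapP[x _]//.
Qed.

Lemma mem_win_abs z : z \in win `|z|%N.+1.
Proof. by rewrite mem_win; case: z => k /=; lia. Qed.

Lemma win_uniq N : uniq (win N).
Proof.
rewrite cat_uniq !map_inj_uniq ?iota_uniq/= ?andbT; last 2 first.
- by move=> a b [].
- by move=> a b [].
by apply/hasPn => z /mapP[k _ ->]; apply/negP => /mapP[].
Qed.

Lemma win_sub N M : (N <= M)%N -> {subset win N <= win M}.
Proof. by move=> NM [] k; rewrite !mem_win => /leq_trans; apply. Qed.

Lemma sum_winS N u :
  \sum_(z <- win N.+1) u z = \sum_(z <- win N) u z + (u (Posz N) + u (Negz N)).
Proof.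
rewrite /win -[N.+1]addn1 !iotaD !map_cat !big_cat !big_seq1 !add0n/=.
by rewrite addrACA.
Qed.

Lemma sum_win_supp N M u : (N <= M)%N -> (forall z, z \notin win N -> u z = 0) ->
  \sum_(z <- win M) u z = \sum_(z <- win N) u z.
Proof.
elim: M => [|M IH]; first by rewrite leqn0 => /eqP ->.
rewrite leq_eqVlt => /predU1P[->//|]; rewrite ltnS => NM u0.
by rewrite sum_winS IH// !u0 ?mem_win -?leqNgt// !addr0.
Qed.

Lemma nondecreasing_win u : (forall z, 0 <= u z) ->
  nondecreasing_seq (fun N => \sum_(z <- win N) u z).
Proof. by move=> u0; apply/nondecreasing_seqP => N; rewrite sum_winS lerDl addr_ge0. Qed.

Lemma finite_set_win (A : set int) : finite_set A ->
  exists N, forall z, A z -> z \in win N.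
Proof.
move=> /finite_seqP[s As]; exists (\max_(z <- s) `|z|%N).+1 => z.
rewrite As /= => zs; rewrite mem_win.
have: (`|z| <= \max_(z <- s) `|z|)%N by exact: leq_bigmax_seq.
by case: z {zs} => k /=; lia.
Qed.

(** Every finite set of integers lies in some window, so windows reach the same supremum as all
    finite sets. *)
Lemma esum_win u : (forall z, 0 <= u z) ->
  (fun N => (\sum_(z <- win N) u z)%:E) @ \oo -->
  \esum_(z in [set: int]) (u z)%:E.
Proof.
move=> u0; rewrite (_ : esum _ _ =
  ereal_sup (range (fun N => (\sum_(z <- win N) u z)%:E))).
  apply: ereal_nondecreasing_cvgn => N M NM.
  by rewrite lee_fin nondecreasing_win.
apply/eqP; rewrite eq_le; apply/andP; split.
  apply: ge_ereal_sup => _ [A [finA _] <-].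
  have [N AN] := finite_set_win finA.
  apply: (@le_trans _ _ (\sum_(z <- win N) u z)%:E); last first.
    by apply: ereal_sup_ubound; exists N.
  have -> : (\sum_(z <- win N) u z)%:E = (\sum_(z \in [set` win N]) (u z)%:E)%E.
    by rewrite -fsbig_seq ?win_uniq// sumEFin.
  apply: lee_fsum_nneg_subset => //; first exact: finite_seq.
    by move=> z /set_mem /AN zN; rewrite inE.
  by move=> z _; rewrite lee_fin.
apply: ge_ereal_sup => _ [N _ <-].
apply: ereal_sup_ubound; exists [set` win N]; first by split => //; exact: finite_seq.
by rewrite -fsbig_seq ?win_uniq// sumEFin.
Qed.

Lemma esum_fin_bound u C : (forall z, 0 <= u z) ->
  (forall N, \sum_(z <- win N) u z <= C) ->
  (\esum_(z in [set: int]) (u z)%:E <= C%:E)%E.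
Proof.
move=> u0 uC; have := esum_win u0 => /cvg_lim <-//.
apply: lime_le; first by apply/cvg_ex; eexists; exact: esum_win.
by apply: nearW => N; rewrite lee_fin.
Qed.

Lemma sum_win_le_esum u N : (forall z, 0 <= u z) ->
  ((\sum_(z <- win N) u z)%:E <= \esum_(z in [set: int]) (u z)%:E)%E.
Proof.
move=> u0; apply: ereal_sup_ubound; exists [set` win N]; first by split => //; exact: finite_seq.
by rewrite -fsbig_seq ?win_uniq// sumEFin.
Qed.

Definition absum u := summable [set: int] (EFin \o u).

Lemma absumP u :
  absum u <-> exists C, forall N, \sum_(z <- win N) `|u z| <= C.
Proof.
rewrite /absum /summable; split.
  move=> su; exists (fine (\esum_(z in [set: int]) `|(u z)%:E|%E)) => N.
  rewrite -lee_fin fineK; last first.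
    by rewrite ge0_fin_numE ?su// esum_ge0.
  exact: (sum_win_le_esum N (fun z => normr_ge0 _)).
move=> [C uC]; apply: (@le_lt_trans _ _ C%:E); last exact: ltry.
exact: (esum_fin_bound (fun z => normr_ge0 _) uC).
Qed.

Lemma absum_cvg_ge0 u : (forall z, 0 <= u z) -> absum u ->
  (fun N => \sum_(z <- win N) u z) @ \oo -->
  fine (\esum_(z in [set: int]) (u z)%:E).
Proof.
move=> u0 su.
suff /fine_cvgP[_] : (fun N => (\sum_(z <- win N) u z)%:E) @ \oo -->
  (fine (\esum_(z in [set: int]) (u z)%:E))%:E by [].
rewrite fineK; first exact: esum_win.
rewrite ge0_fin_numE ?esum_ge0//; last by move=> *; rewrite lee_fin.
move: su; rewrite /absum /summable.
by under eq_esum do rewrite /= ger0_norm//.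
Qed.

Lemma absum_le u v : (forall z, `|u z| <= `|v z|) -> absum v -> absum u.
Proof.
move=> uv /absumP[C vC]; apply/absumP; exists C => N.
by apply: le_trans (vC N); exact: ler_sum.
Qed.

(** Absolute summability makes the sums of the positive and negative parts finite, so [fine] in
    [sumZ] does not fall back on its default value. *)
Lemma cvg_sumZ u : absum u ->
  (fun N => \sum_(z <- win N) u z) @ \oo --> sumZ u.
Proof.
move=> su; rewrite /sumZ funerpos funerneg.
have sp : absum (u^\+)%R.
  apply: absum_le su => z; rewrite ger0_norm ?funrpos_ge0//.
  by rewrite /funrpos/= ge_max normr_ge0 ler_norm.
have sn : absum (u^\-)%R.
  apply: absum_le su => z; rewrite ger0_norm ?funrneg_ge0//.
  by rewrite /funrneg/= ge_max normr_ge0 -normrN ler_norm.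
have fin v : (forall z, 0 <= v z) -> absum v ->
    (\esum_(z in [set: int]) (v z)%:E)%E \is a fin_num.
  move=> v0 sv; rewrite ge0_fin_numE; last by apply: esum_ge0 => z _; rewrite lee_fin.
  move: sv.
  by rewrite /absum /summable; under eq_esum do rewrite /= ger0_norm//.
rewrite (_ : fine _ = fine (\esum_(z in [set: int]) (u^\+ z)%:E) -
  fine (\esum_(z in [set: int]) (u^\- z)%:E)); last by rewrite -fineB ?fin.
rewrite (_ : (fun N => _) = (fun N => \sum_(z <- win N) u^\+ z -
    \sum_(z <- win N) u^\- z)); last first.
  apply/funext => N; rewrite -sumrB; apply: eq_bigr => z _.
  by rewrite -[in LHS](funrposBneg u).
by apply: cvgB; exact: absum_cvg_ge0.
Qed.

Lemma sumZ_eq u s : absum u ->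
  (fun N => \sum_(z <- win N) u z) @ \oo --> s -> sumZ u = s.
Proof. by move=> su us; rewrite -(cvg_lim _ us)// (cvg_lim _ (cvg_sumZ su)). Qed.

Lemma absumD u v : absum u -> absum v -> absum (fun z => u z + v z).
Proof. by move=> su sv; exact: (summableD su sv). Qed.

Lemma absumZ a u : absum u -> absum (fun z => a * u z).
Proof.
move=> /absumP[C uC]; apply/absumP; exists (`|a| * C) => N.
under eq_bigr do rewrite normrM.
by rewrite -mulr_sumr ler_wpM2l.
Qed.

Lemma sumZD u v : absum u -> absum v ->
  sumZ (fun z => u z + v z) = sumZ u + sumZ v.
Proof.
move=> su sv; apply: sumZ_eq; first exact: absumD.
under eq_fun do rewrite big_split.
by apply: cvgD; exact: cvg_sumZ.
Qed.

Lemma sumZZ a u : absum u -> sumZ (fun z => a * u z) = a * sumZ u.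
Proof.
move=> su; apply: sumZ_eq; first exact: absumZ.
under eq_fun do rewrite -mulr_sumr.
by apply: cvgMl_tmp; exact: cvg_sumZ.
Qed.

Lemma sumZ_ge_win u N : (forall z, 0 <= u z) -> absum u ->
  \sum_(z <- win N) u z <= sumZ u.
Proof.
move=> u0 su.
have := nondecreasing_cvgn_le (nondecreasing_win u0) (cvgP _ (cvg_sumZ su)) N.
by rewrite (cvg_lim _ (cvg_sumZ su)).
Qed.

Lemma sumZ_ge0 u : (forall z, 0 <= u z) -> absum u -> 0 <= sumZ u.
Proof.
by move=> u0 su; apply: le_trans (sumZ_ge_win 0 u0 su); exact: sumr_ge0.
Qed.

Lemma sumZ_le_bound u C : absum u ->
  (forall N, \sum_(z <- win N) u z <= C) -> sumZ u <= C.
Proof.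
move=> su uC; apply: (cvgr_to_le (cvg_sumZ su)).
exact: nearW.
Qed.

Lemma absum_fin u N : (forall z, z \notin win N -> u z = 0) -> absum u.
Proof.
move=> u0; apply/absumP; exists (\sum_(z <- win N) `|u z|) => M.
have [NM|/ltnW MN] := leqP N M.
  by rewrite (sum_win_supp NM)// => z /u0 ->; rewrite normr0.
by apply: nondecreasing_win MN => z; exact: normr_ge0.
Qed.

Lemma sumZ_fin u N : (forall z, z \notin win N -> u z = 0) ->
  sumZ u = \sum_(z <- win N) u z.
Proof.
move=> u0; apply: sumZ_eq; first exact: absum_fin u0.
apply: cvg_near_cst; near=> M; apply: sum_win_supp => //.
by near: M; exact: nbhs_infty_ge.
Unshelve. all: by end_near. Qed.

End Windows.

Section RealInner.
Variable R : realType.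
Implicit Types (f g h : ell2 R) (z : int).

Definition pr2 (a b : R[i]) : R :=
  complex.Re a * complex.Re b + complex.Im a * complex.Im b.

Lemma pr2C a b : pr2 a b = pr2 b a.
Proof. by rewrite /pr2 mulrC [X in _ + X]mulrC. Qed.

Lemma pr2E a : pr2 a a = sqmod a.
Proof. by rewrite /pr2 /sqmod !expr2. Qed.

Lemma normr_pr2 a b : `|pr2 a b| <= sqmod a + sqmod b.
Proof.
case: a b => [a1 a2] [b1 b2]; rewrite /pr2 /sqmod /= ler_norml.
have := sqr_ge0 (a1 + b1); have := sqr_ge0 (a2 + b2).
have := sqr_ge0 (a1 - b1); have := sqr_ge0 (a2 - b2).
have := sqr_ge0 a1; have := sqr_ge0 b1; have := sqr_ge0 a2; have := sqr_ge0 b2.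
by move=> *; apply/andP; split; nra.
Qed.

Lemma ell2_absum (f : int -> R[i]) :
  f \in @ell2_pred R <-> absum (fun z => sqmod (f z)).
Proof. by rewrite unfold_in asboolE. Qed.

Lemma ell2P f : absum (fun z => sqmod (f z)).
Proof. by apply/ell2_absum; case: f. Qed.

(** The real part of [inner]. The imaginary part is [rin f ('i *: g)], so for linear operators real
    symmetry already gives complex symmetry ([selfadjointP]). *)
Definition rin f g := sumZ (fun z => pr2 (f z) (g z)).

Lemma absum_pr2 f g : absum (fun z => pr2 (f z) (g z)).
Proof.
apply: absum_le (absumD (ell2P f) (ell2P g)) => z.
by rewrite [leRHS]ger0_norm ?normr_pr2// addr_ge0 ?sqmod_ge0.
Qed.

Lemma ell2_scaleE a f z : (a *: f) z = a * f z. Proof. by []. Qed.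
Lemma ell2_ext f g : (forall z, f z = g z) -> f = g.
Proof. by move=> fg; apply: val_inj; apply/funext. Qed.

Lemma pr2Dl a b c : pr2 (a + b) c = pr2 a c + pr2 b c.
Proof. by case: a b c => [a1 a2] [b1 b2] [c1 c2]; rewrite /pr2/=; ring. Qed.

Lemma pr2Zl (k : R) a b : pr2 (k%:C * a) b = k * pr2 a b.
Proof. by case: a b => [a1 a2] [b1 b2]; rewrite /pr2/=; ring. Qed.

Lemma rinC f g : rin f g = rin g f.
Proof. by congr sumZ; apply/funext => z; exact: pr2C. Qed.

Lemma rinDl f g h : rin (f + g) h = rin f h + rin g h.
Proof.
rewrite /rin -sumZD; [|exact: absum_pr2..].
by congr sumZ; apply/funext => z; exact: pr2Dl.
Qed.

Lemma rinZl (k : R) f g : rin (k%:C *: f) g = k * rin f g.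
Proof.
rewrite /rin -sumZZ; last exact: absum_pr2.
by congr sumZ; apply/funext => z; exact: pr2Zl.
Qed.

Lemma rinDr f g h : rin h (f + g) = rin h f + rin h g.
Proof. by rewrite rinC rinDl !(rinC h). Qed.

Lemma rinZr (k : R) f g : rin f (k%:C *: g) = k * rin f g.
Proof. by rewrite rinC rinZl rinC. Qed.

Lemma rinNl f g : rin (- f) g = - rin f g.
Proof. by rewrite -scaleN1r -(rmorphN1 (real_complex R)) rinZl mulN1r. Qed.

Lemma rinNr f g : rin f (- g) = - rin f g.
Proof. by rewrite rinC rinNl rinC. Qed.

Lemma rinBl f g h : rin (f - g) h = rin f h - rin g h.
Proof. by rewrite rinDl rinNl. Qed.

Lemma rinBr f g h : rin h (f - g) = rin h f - rin h g.
Proof. by rewrite rinDr rinNr. Qed.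

Lemma rin0l f : rin 0 f = 0.
Proof. by have := rinBl f f f; rewrite !subrr. Qed.

Definition sqn f := rin f f.

Lemma sqnE f : sqn f = sumZ (fun z => sqmod (f z)).
Proof. by congr sumZ; apply/funext => z; exact: pr2E. Qed.

Lemma sqn_ge0 f : 0 <= sqn f.
Proof. by rewrite sqnE; apply: sumZ_ge0 (ell2P f) => z; exact: sqmod_ge0. Qed.

Lemma norm2E f : norm2 f = Num.sqrt (sqn f).
Proof. by rewrite sqnE. Qed.

Lemma sqnD f g : sqn (f + g) = sqn f + sqn g + 2 * rin f g.
Proof. by rewrite /sqn !(rinDl, rinDr) (rinC g f); ring. Qed.

Lemma sqnN f : sqn (- f) = sqn f.
Proof. by rewrite /sqn rinNl rinNr opprK. Qed.

Lemma sqnB f g : sqn (f - g) = sqn f + sqn g - 2 * rin f g.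
Proof. by rewrite sqnD sqnN rinNr mulrN. Qed.

Lemma sqnZ (k : R) f : sqn (k%:C *: f) = k ^+ 2 * sqn f.
Proof. by rewrite /sqn rinZl rinZr mulrA expr2. Qed.

Lemma sqmod_le_sqn f z : sqmod (f z) <= sqn f.
Proof.
rewrite sqnE.
apply: le_trans (sumZ_ge_win `|z|%N.+1 (fun z => sqmod_ge0 _) (ell2P f)).
rewrite (bigD1_seq z) ?win_uniq ?mem_win_abs//= lerDl sumr_ge0// => y _; exact: sqmod_ge0.
Qed.

Lemma sqmod_eq0 (a : R[i]) : sqmod a <= 0 -> a = 0.
Proof.
case: a => [x y]; rewrite /sqmod/= => h.
have /eqP : x ^+ 2 + y ^+ 2 = 0 by apply/eqP; rewrite eq_le h addr_ge0 ?sqr_ge0.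
by rewrite paddr_eq0 ?sqr_ge0// !sqrf_eq0 => /andP[/eqP -> /eqP ->].
Qed.

Lemma sqn_eq0 f : sqn f <= 0 -> f = 0.
Proof.
move=> f0; apply: ell2_ext => z; apply: sqmod_eq0.
exact: le_trans (sqmod_le_sqn f z) f0.
Qed.

Lemma rin_eq0 f : (forall g, rin f g = 0) -> f = 0.
Proof. by move=> f0; apply: sqn_eq0; rewrite /sqn f0. Qed.

Lemma rin_eq f g : (forall h, rin f h = rin g h) -> f = g.
Proof.
by move=> fg; apply/subr0_eq/rin_eq0 => h; rewrite rinBl fg subrr.
Qed.

Lemma cauchy_schwarz f g : rin f g ^+ 2 <= sqn f * sqn g.
Proof.
have := sqn_ge0 f; rewrite le_eqVlt => /predU1P[/esym f0|f0].
  have -> : f = 0 by apply: sqn_eq0; rewrite f0.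
  by rewrite rin0l expr0n/= /sqn rin0l mul0r.
(* The square norm of this vector is [sqn f] times the difference that has to be nonnegative. *)
have := sqn_ge0 ((rin f g)%:C *: f - (sqn f)%:C *: g).
rewrite sqnB !sqnZ rinZl rinZr => h.
rewrite -(ler_pM2l f0) -subr_ge0; apply: le_trans h _.
by rewrite le_eqVlt; apply/orP; left; apply/eqP; ring.
Qed.

Lemma normr_rin f g : `|rin f g| <= norm2 f * norm2 g.
Proof.
rewrite !norm2E -sqrtrM ?sqn_ge0// -sqrtr_sqr ler_wsqrtr//.
exact: cauchy_schwarz.
Qed.

Lemma norm2_ge0 f : 0 <= norm2 f. Proof. exact: sqrtr_ge0. Qed.

Lemma sqr_norm2 f : norm2 f ^+ 2 = sqn f.
Proof. by rewrite norm2E sqr_sqrtr// sqn_ge0. Qed.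

Lemma norm2_le f (C : R) : 0 <= C -> (norm2 f <= C) = (sqn f <= C ^+ 2).
Proof. by move=> C0; rewrite -sqr_norm2 ler_sqr ?nnegrE ?norm2_ge0. Qed.

Lemma Re_inner f g : complex.Re (inner f g) = rin f g.
Proof.
congr sumZ; apply/funext => z; rewrite /pr2.
by case: (f z) (g z) => [a b] [c d] /=; ring.
Qed.

Lemma Im_inner f g : complex.Im (inner f g) = rin f ('i *: g).
Proof.
congr sumZ; apply/funext => z; rewrite /pr2 ell2_scaleE.
by case: (f z) (g z) => [a b] [c d] /=; ring.
Qed.

Lemma selfadjointP (T : {linear ell2 R -> ell2 R}) :
  (forall f g, rin (T f) g = rin f (T g)) <-> selfadjoint T.
Proof.
split=> [h f g|h f g]; last by rewrite -!Re_inner h.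
by apply/eqP; rewrite eq_complex !Re_inner !Im_inner -linearZ !h !eqxx.
Qed.

End RealInner.

(** * Approximation by finitely supported sequences *)

Section Truncation.
Variable R : realType.
Implicit Types (f g h : ell2 R) (z : int).

Lemma trunc_subproof N f :
  (fun z => if z \in win N then f z else 0) \in @ell2_pred R.
Proof.
apply/ell2_absum; apply: (@absum_fin _ _ N) => z /negbTE ->.
by rewrite /sqmod/= expr0n/= addr0.
Qed.

Definition trunc N f : ell2 R := Ell2 (trunc_subproof N f).

Lemma truncE N f z : trunc N f z = if z \in win N then f z else 0.
Proof. by []. Qed.

Lemma pr20l (a : R[i]) : pr2 0 a = 0.
Proof. by rewrite /pr2/= !mul0r addr0. Qed.

Lemma rin_truncl N f g :
  rin (trunc N f) g = \sum_(z <- win N) pr2 (f z) (g z).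
Proof.
rewrite /rin (@sumZ_fin _ _ N) => [|z /negbTE zN]; last by rewrite truncE zN pr20l.
by apply: eq_big_seq => z zN; rewrite truncE zN.
Qed.

Lemma sqn_trunc N f : sqn (trunc N f) = \sum_(z <- win N) sqmod (f z).
Proof.
by rewrite /sqn rin_truncl; apply: eq_big_seq => z zN; rewrite truncE zN pr2E.
Qed.

Lemma sqn_sub_trunc N f :
  sqn (f - trunc N f) = sqn f - \sum_(z <- win N) sqmod (f z).
Proof.
rewrite sqnB sqn_trunc (rinC f) rin_truncl.
by under [in X in _ - 2 * X]eq_bigr do rewrite pr2E; ring.
Qed.

Lemma norm2_trunc N f : norm2 (trunc N f) <= norm2 f.
Proof.
rewrite !norm2E ler_wsqrtr// sqn_trunc sqnE.
exact: sumZ_ge_win (fun z => sqmod_ge0 _) (ell2P f).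
Qed.

Lemma norm2_sub_trunc f : (fun N => norm2 (f - trunc N f)) @ \oo --> (0 : R).
Proof.
under eq_fun do rewrite norm2E sqn_sub_trunc.
have h : (fun N => sqn f - \sum_(z <- win N) sqmod (f z)) @ \oo --> (0 : R).
  have := cvg_sumZ (ell2P f); rewrite -sqnE => h0.
  by have := cvgB (@cvg_cst _ (sqn f) _ \oo _) h0; rewrite subrr; apply.
by have := continuous_cvg _ (@sqrt_continuous R 0) h; rewrite sqrtr0; apply.
Qed.

(** The error depends on the operator only through its bound C; [cvg_rin_opE] uses this uniformity
    for a whole sequence of operators. *)
Definition trunc_err (C : R) f g N : R :=
  C * norm2 (f - trunc N f) * norm2 g + C * norm2 f * norm2 (g - trunc N g).

Lemma cvg_trunc_err C f g : trunc_err C f g @ \oo --> (0 : R).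
Proof.
have : trunc_err C f g @ \oo --> C * 0 * norm2 g + C * norm2 f * 0.
  apply: cvgD; first by apply: cvgMr_tmp; apply: cvgMl_tmp; exact: norm2_sub_trunc.
  by apply: cvgMl_tmp; exact: norm2_sub_trunc.
by rewrite !mulr0 mul0r addr0; apply.
Qed.

Lemma rin_trunc_err (T : {linear ell2 R -> ell2 R}) (C : R) f g N : 0 <= C ->
  (forall h, norm2 (T h) <= C * norm2 h) ->
  `|rin (T (trunc N f)) (trunc N g) - rin (T f) g| <= trunc_err C f g N.
Proof.
move=> C0 TC; rewrite [X in `|X|](_ : _ =
   - (rin (T (f - trunc N f)) g + rin (T (trunc N f)) (g - trunc N g))); last first.
  by rewrite linearB rinBl rinBr; ring.
rewrite normrN; apply: le_trans (ler_normD _ _) _; apply: lerD.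
  apply: le_trans (normr_rin _ _) _.
  by rewrite ler_wpM2r ?norm2_ge0.
apply: le_trans (normr_rin _ _) _; rewrite ler_wpM2r ?norm2_ge0//.
by apply: le_trans (TC _) _; rewrite ler_wpM2l// norm2_trunc.
Qed.

Lemma cvg_rin_trunc (T : {linear ell2 R -> ell2 R}) (C : R) f g : 0 <= C ->
  (forall h, norm2 (T h) <= C * norm2 h) ->
  (fun N => rin (T (trunc N f)) (trunc N g)) @ \oo --> rin (T f) g.
Proof.
move=> C0 TC.
apply: (@cvg_sub0 _ _ _ _ _ _ (cst (rin (T f) g))); last exact: cvg_cst.
apply/norm_cvg0P; apply: (squeeze_cvgr _ (cvg_cst 0) (@cvg_trunc_err C f g)).
by apply: nearW => N; rewrite normr_ge0/= rin_trunc_err.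
Qed.

End Truncation.

Lemma cvg_sumr (R : realType) (I : Type) (r : seq I) (f : I -> nat -> R)
    (l : I -> R) : (forall i, f i @ \oo --> l i) ->
  (fun N => \sum_(i <- r) f i N) @ \oo --> \sum_(i <- r) l i.
Proof. by move=> fl; apply: (cvg_big (@add_continuous R^o)) => i _; exact: fl. Qed.

(** * Operators given by real symmetric kernels *)

Section RealKernel.
Variable R : realType.
Implicit Types (g h : int -> R) (K : int -> int -> R).

Definition kform K N g :=
  \sum_(m <- win N) \sum_(n <- win N) K m n * (g m * g n).

(** A bound on finite quadratic forms is what positivity of the calculus yields directly; below it
    is turned into a bound on the operator. *)
Definition form_bound K (C : R) := forall N g,
  `|kform K N g| <= C * \sum_(z <- win N) g z ^+ 2.

Variables (K : int -> int -> R) (C : R).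
Hypotheses (C0 : 0 < C) (Ksym : forall m n, K m n = K n m).
Hypothesis KC : form_bound K C.

Lemma kform_polar N g h :
  kform K N (fun z => h z + g z) - kform K N (fun z => h z - g z) =
  4 * \sum_(m <- win N) h m * \sum_(n <- win N) K m n * g n.
Proof.
pose A u v := \sum_(m <- win N) \sum_(n <- win N) K m n * (u m * v n).
have Asym u v : A u v = A v u.
  rewrite /A exchange_big/=; apply: eq_bigr => m _; apply: eq_bigr => n _.
  by rewrite (Ksym n m); ring.
have -> : \sum_(m <- win N) h m * \sum_(n <- win N) K m n * g n = A h g.
  apply: eq_bigr => m _; rewrite mulr_sumr; apply: eq_bigr => n _.
  by ring.
transitivity (2 * (A h g + A g h)); last by rewrite (Asym g h); ring.
rewrite /kform /A -big_split/= mulr_sumr -sumrB; apply: eq_bigr => m _.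
by rewrite -big_split/= mulr_sumr -sumrB; apply: eq_bigr => n _; ring.
Qed.

(** A symmetric form bounded by C has norm at most C. Put h = K g and polarize between h and C g:
    with S and G the sums of squares of h and g, the difference of the two forms is 4 C S, and by
    the parallelogram law it is at most 2 C (S + C^2 G). Hence S <= C^2 G. *)
Lemma sqr_kernel_win N g :
  \sum_(m <- win N) (\sum_(n <- win N) K m n * g n) ^+ 2
    <= C ^+ 2 * \sum_(z <- win N) g z ^+ 2.
Proof.
pose h m := \sum_(n <- win N) K m n * g n.
have e := kform_polar N (fun z => C * g z) h.
have b1 := KC N (fun z => h z + C * g z).
have b2 := KC N (fun z => h z - C * g z).
have s1 : \sum_(z <- win N) (h z + C * g z) ^+ 2 + \sum_(z <- win N) (h z - C * g z) ^+ 2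
   = 2 * (\sum_(m <- win N) h m ^+ 2 + C ^+ 2 * \sum_(z <- win N) g z ^+ 2).
  rewrite mulr_sumr -!big_split/= mulr_sumr; apply: eq_bigr => z _; ring.
have s2 : \sum_(m <- win N) h m * \sum_(n <- win N) K m n * (C * g n) =
    C * \sum_(m <- win N) h m ^+ 2.
  rewrite mulr_sumr; apply: eq_bigr => m _; rewrite expr2 mulrCA -{1}/(h m).
  by congr (_ * _); rewrite mulr_sumr; apply: eq_bigr => n _; rewrite mulrCA.
rewrite s2 in e; move: b1 b2; rewrite !ler_norml => /andP[_ b1] /andP[b2 _].
rewrite -/h; set S := \sum_(m <- win N) h m ^+ 2 in e s1 *.
set G := \sum_(z <- win N) g z ^+ 2 in s1 *.
have : 4 * (C * S) <= C * (2 * (S + C ^+ 2 * G)) by rewrite -e -s1; lra.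
have -> : 4 * (C * S) = C * (4 * S) by ring.
rewrite ler_pM2l//; lra.
Qed.

(** The previous bound at the basis vector m gives the column of K at m, which by symmetry is the
    row. *)
Lemma kernel_row m : absum (fun n => K m n ^+ 2).
Proof.
apply/absumP; exists (C ^+ 2) => N.
under eq_bigr do rewrite ger0_norm ?sqr_ge0//.
pose M := maxn N `|m|%N.+1.
have mM : m \in win M by apply: win_sub (mem_win_abs m); rewrite leq_max leqnn orbT.
apply: (@le_trans _ _ (\sum_(n <- win M) K m n ^+ 2)).
  by apply: (nondecreasing_win (fun z => sqr_ge0 _)); rewrite leq_max leqnn.
have := sqr_kernel_win M (fun n => (n == m)%:R).
have sD (u : int -> R) : \sum_(n <- win M) u n * (n == m)%:R = u m.
  rewrite (bigD1_seq m) ?win_uniq//= eqxx mulr1 big1 ?addr0// => n /negbTE ->.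
  by rewrite mulr0.
under eq_bigr do rewrite sD Ksym.
under [X in _ <= _ * X]eq_bigr do rewrite expr2.
by rewrite sD eqxx mulr1.
Qed.

Lemma absum_kernel m g : absum (fun n => g n ^+ 2) -> absum (fun n => K m n * g n).
Proof.
move=> sg; apply: absum_le (absumD (kernel_row m) sg) => n.
rewrite [leRHS]ger0_norm ?addr_ge0 ?sqr_ge0// ler_norml.
have := sqr_ge0 (K m n + g n); have := sqr_ge0 (K m n - g n).
have := sqr_ge0 (K m n); have := sqr_ge0 (g n).
by move=> *; apply/andP; split; nra.
Qed.

Definition kapp g m := sumZ (fun n => K m n * g n).

(** For fixed M only finitely many inner sums go to the limit, and for N >= M the bound on the
    window N is uniform in N. *)
Lemma kapp_win M g : absum (fun n => g n ^+ 2) ->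
  \sum_(m <- win M) kapp g m ^+ 2 <= C ^+ 2 * sumZ (fun n => g n ^+ 2).
Proof.
move=> sg.
have h : (fun N => \sum_(m <- win M) (\sum_(n <- win N) K m n * g n) ^+ 2)
    @ \oo --> \sum_(m <- win M) kapp g m ^+ 2.
  apply: cvg_sumr => m; rewrite expr2.
  by under eq_fun do rewrite expr2; apply: cvgM; exact: cvg_sumZ (absum_kernel m sg).
apply: (cvgr_to_le h); near=> N.
apply: (@le_trans _ _ (\sum_(m <- win N) (\sum_(n <- win N) K m n * g n) ^+ 2)).
  apply: (nondecreasing_win (fun z => sqr_ge0 _)).
  by near: N; exact: nbhs_infty_ge.
apply: le_trans (sqr_kernel_win N g) _.
rewrite ler_wpM2l ?sqr_ge0//; apply: sumZ_ge_win => //.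
by move=> z; exact: sqr_ge0.
Unshelve. all: by end_near. Qed.

Lemma absum_kapp g : absum (fun n => g n ^+ 2) -> absum (fun m => kapp g m ^+ 2).
Proof.
move=> sg; apply/absumP; exists (C ^+ 2 * sumZ (fun n => g n ^+ 2)) => M.
under eq_bigr do rewrite ger0_norm ?sqr_ge0//.
exact: kapp_win.
Qed.

Lemma sumZ_kapp g : absum (fun n => g n ^+ 2) ->
  sumZ (fun m => kapp g m ^+ 2) <= C ^+ 2 * sumZ (fun n => g n ^+ 2).
Proof.
by move=> sg; apply: sumZ_le_bound (absum_kapp sg) _ => M; exact: kapp_win.
Qed.

End RealKernel.

Section KernelOperator.
Variable R : realType.
Implicit Types (f g h : ell2 R) (K : int -> int -> R).

Lemma absum_Re2 f : absum (fun z => complex.Re (f z) ^+ 2).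
Proof.
apply: absum_le (ell2P f) => z; rewrite !ger0_norm ?sqmod_ge0 ?sqr_ge0//.
by rewrite lerDl sqr_ge0.
Qed.

Lemma absum_Im2 f : absum (fun z => complex.Im (f z) ^+ 2).
Proof.
apply: absum_le (ell2P f) => z; rewrite !ger0_norm ?sqmod_ge0 ?sqr_ge0//.
by rewrite lerDr sqr_ge0.
Qed.

Lemma sqn_ReIm f : sqn f =
  sumZ (fun z => complex.Re (f z) ^+ 2) + sumZ (fun z => complex.Im (f z) ^+ 2).
Proof. by rewrite sqnE sumZD//; [exact: absum_Re2|exact: absum_Im2]. Qed.

Definition kop K (f : int -> R[i]) m : R[i] :=
  kapp K (fun n => complex.Re (f n)) m +i* kapp K (fun n => complex.Im (f n)) m.

Lemma sumZC_kop K (f : int -> R[i]) m : sumZC (fun n => (K m n)%:C * f n) = kop K f m.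
Proof.
rewrite /sumZC /kop; congr (_ +i* _); congr sumZ; apply/funext => n;
by case: (f n) => a b /=; ring.
Qed.

Lemma has_kernelE (T : ell2 R -> ell2 R) K f m : has_kernel T K -> T f m = kop K f m.
Proof. by move=> TK; rewrite -sumZC_kop; case: (TK f m). Qed.

Lemma has_kernel_uniq (T T' : ell2 R -> ell2 R) K :
  has_kernel T K -> has_kernel T' K -> forall f, T f = T' f.
Proof. by move=> TK TK' f; apply: ell2_ext => z; rewrite !(has_kernelE _ _ TK, has_kernelE _ _ TK'). Qed.

Variables (K : int -> int -> R) (C : R).
Hypotheses (C0 : 0 < C) (Ksym : forall m n, K m n = K n m).
Hypothesis KC : form_bound K C.

Let aRe f m := absum_kernel C0 Ksym KC m (absum_Re2 f).
Let aIm f m := absum_kernel C0 Ksym KC m (absum_Im2 f).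

Lemma kop_subproof f : kop K f \in @ell2_pred R.
Proof.
apply/ell2_absum; apply: absumD; apply: (absum_kapp C0) => //.
  exact: absum_Re2.
exact: absum_Im2.
Qed.

Definition kopf f : ell2 R := Ell2 (kop_subproof f).

Lemma kopf_is_linear : linear kopf.
Proof.
move=> k f g; apply: ell2_ext => z.
change (kop K (fun n => k * f n + g n) z = k * kop K f z + kop K g z).
rewrite /kop /kapp.
rewrite (_ : (fun n => _) = fun n => complex.Re k * (K z n * complex.Re (f n)) +
  (- complex.Im k * (K z n * complex.Im (f n)) + K z n * complex.Re (g n))); last first.
  apply/funext => n.
  by case: k (f n) (g n) => [? ?] [? ?] [? ?] /=; ring.
rewrite [X in _ +i* sumZ X](_ : _ = fun n => complex.Re k * (K z n * complex.Im (f n)) +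
  (complex.Im k * (K z n * complex.Re (f n)) + K z n * complex.Im (g n))); last first.
  apply/funext => n.
  by case: k (f n) (g n) => [? ?] [? ?] [? ?] /=; ring.
have [rf jf rg jg] := And4 (aRe f z) (aIm f z) (aRe g z) (aIm g z).
rewrite (sumZD (absumZ _ rf) (absumD (absumZ _ jf) rg)) (sumZD (absumZ _ jf) rg).
rewrite (sumZD (absumZ _ jf) (absumD (absumZ _ rf) jg)) (sumZD (absumZ _ rf) jg).
rewrite !(sumZZ _ rf) !(sumZZ _ jf).
by case: k => a b; apply/eqP; rewrite eq_complex/=; apply/andP; split; apply/eqP; ring.
Qed.

HB.instance Definition _ :=
  GRing.isLinear.Build R[i] (ell2 R) (ell2 R) *:%R kopf kopf_is_linear.

Lemma summable_kernel f m : summableZC (fun n => (K m n)%:C * f n).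
Proof.
apply: absum_le (absumD (kernel_row C0 Ksym KC m) (ell2P f)) => n.
rewrite ger0_norm ?sqrtr_ge0// [leRHS]ger0_norm ?addr_ge0 ?sqr_ge0 ?sqmod_ge0//.
rewrite sqmodM sqrtrM ?sqmod_ge0// [sqmod _%:C](_ : _ = K m n ^+ 2); last first.
  by rewrite /sqmod/= expr0n/= addr0.
rewrite sqrtr_sqr -[X in _ <= _ + X]sqr_sqrtr ?sqmod_ge0// -(real_normK (num_real (K m n))).
set a := `|_|; set b := Num.sqrt _.
have := sqr_ge0 (a - b); have := sqr_ge0 a; have := sqr_ge0 b; nra.
Qed.

Lemma kopf_has_kernel : has_kernel kopf K.
Proof. by move=> f m; split; [exact: summable_kernel|rewrite sumZC_kop]. Qed.

Lemma has_kernel_bound (T : ell2 R -> ell2 R) : has_kernel T K ->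
  forall f, norm2 (T f) <= C * norm2 f.
Proof.
move=> TK f; rewrite norm2_le; last by rewrite mulr_ge0 ?norm2_ge0// ltW.
rewrite exprMn sqr_norm2 (has_kernel_uniq TK kopf_has_kernel).
rewrite sqnE sumZD; last 2 first.
- by apply: (absum_kapp C0) => //; exact: absum_Re2.
- by apply: (absum_kapp C0) => //; exact: absum_Im2.
rewrite sqn_ReIm mulrDr; apply: lerD; apply: (sumZ_kapp C0) => //.
  exact: absum_Re2.
exact: absum_Im2.
Qed.

Lemma kop_trunc N (f : ell2 R) m : kop K (trunc N f) m =
  (\sum_(n <- win N) K m n * complex.Re (f n)) +i*
  (\sum_(n <- win N) K m n * complex.Im (f n)).
Proof.
rewrite /kop /kapp; congr (_ +i* _); rewrite (@sumZ_fin _ _ N).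
- by apply: eq_big_seq => z zN; rewrite truncE zN.
- by move=> z /negbTE zN; rewrite truncE zN mulr0.
- by apply: eq_big_seq => z zN; rewrite truncE zN.
- by move=> z /negbTE zN; rewrite truncE zN mulr0.
Qed.

Lemma rin_kernel_trunc (T : {linear ell2 R -> ell2 R}) N f g : has_kernel T K ->
  rin (T (trunc N f)) (trunc N g) =
  \sum_(m <- win N) \sum_(n <- win N) K m n * pr2 (f n) (g m).
Proof.
move=> TK; rewrite rinC rin_truncl; apply: eq_bigr => m _.
rewrite (has_kernelE _ _ TK) kop_trunc /pr2/= !mulr_sumr -big_split/=.
by apply: eq_bigr => n _; ring.
Qed.

Lemma cvg_kernel_form (T : {linear ell2 R -> ell2 R}) f g : has_kernel T K ->
  (fun N => \sum_(m <- win N) \sum_(n <- win N) K m n * pr2 (f n) (g m)) @ \oo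
    --> rin (T f) g.
Proof.
move=> TK; have := @cvg_rin_trunc _ T C f g (ltW C0) (has_kernel_bound TK).
by under eq_fun do rewrite rin_kernel_trunc//; apply.
Qed.

Lemma has_kernel_sym (T : {linear ell2 R -> ell2 R}) f g : has_kernel T K ->
  rin (T f) g = rin f (T g).
Proof.
move=> TK; have h1 := @cvg_kernel_form T f g TK; have h2 := @cvg_kernel_form T g f TK.
move: h1; under eq_fun do rewrite exchange_big/=.
under eq_fun do under eq_bigr do under eq_bigr do rewrite Ksym pr2C.
by move=> h1; rewrite (rinC f) -(cvg_lim _ h1)// -(cvg_lim _ h2).
Qed.

End KernelOperator.

(** * Borel functional calculus of kernels *)

Section BorelInduction.
Variable R : realType.
Local Notation T := (measurableTypeR R).

(** Complements and intersections allow a countable union to be made disjoint by [seqDU], so only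
    disjoint unions, the ones additivity handles, have to be treated. The generator is a parameter
    because rays []-oo, a[] suit the calculus and rays []x, +oo[] the comparison of measures. *)
Lemma borel_ind (G : set (set R)) (Q : set T -> Prop) :
  (@ocitv R).-sigma.-measurable = G.-sigma.-measurable -> Q set0 ->
  (forall A, measurable A -> Q A -> Q (~` A)) ->
  (forall A B, measurable A -> measurable B -> Q A -> Q B -> Q (A `&` B)) ->
  (forall F : (set T)^nat, (forall k, measurable (F k)) -> (forall k, Q (F k)) ->
    trivIset setT F -> Q (\bigcup_k F k)) ->
  (forall A, G A -> Q A) ->
  forall B, measurable B -> Q B.
Proof.
move=> mG Q0 QC QI QU QG.
pose H := [set A : set T | measurable A /\ Q A].
have H0 : H set0 by [].
have HC A : H A -> H (~` A) by move=> [mA QA]; split; [exact: measurableC|exact: QC].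
have HI A B : H A -> H B -> H (A `&` B).
  by move=> [? ?] [? ?]; split; [exact: measurableI|exact: QI].
have HU A B : H A -> H B -> H (A `|` B).
  by move=> HA HB; rewrite -[_ `|` _]setCK setCU; apply/HC/HI; exact: HC.
have HUn (F : (set T)^nat) n : (forall k, H (F k)) -> H (\big[setU/set0]_(i < n) F i).
  by move=> HF; elim/big_ind : _ => //.
have HB (F : (set T)^nat) : (forall k, H (F k)) -> H (\bigcup_k F k).
  move=> HF; rewrite seqDU_bigcup_eq.
  have HS k : H (seqDU F k) by rewrite /seqDU setDE; apply: HI => //; exact/HC/HUn.
  split; first by apply: bigcup_measurable => k _; case: (HS k).
  by apply: QU; [move=> k; case: (HS k)..|exact: trivIset_seqDU].
move=> B mB; suff [] : H B by [].
have : (@ocitv R).-sigma.-measurable B by exact: mB.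
rewrite mG => {}mB; move: B mB; apply: smallest_sub; first split => //.
  by move=> A HA; rewrite setTD; exact: HC.
move=> A GA; split; last exact: QG.
suff : (@ocitv R).-sigma.-measurable A by [].
by rewrite mG; exact: sub_sigma_algebra.
Qed.

(** With r = s^2, n s^n is at most the sum of the s^i for i < n, hence at most 1 / (1 - s), and a
    second factor s^n remains. *)
Lemma cvg_natX_geo (r : R) : 0 <= r < 1 -> (fun n => n%:R * r ^+ n) @ \oo --> (0 : R).
Proof.
move=> /andP[r0 r1]; pose s := Num.sqrt r.
have s0 : 0 <= s by exact: sqrtr_ge0.
have s1 : s < 1 by rewrite -(@sqrtr1 R) ltr_sqrt.
have rs : r = s * s by rewrite -expr2 sqr_sqrtr.
have ns n : n%:R * s ^+ n <= (1 - s)^-1.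
  rewrite -[leRHS]mul1r ler_pdivlMr ?subr_gt0//.
  apply: (@le_trans _ _ (1 - s ^+ n)); last by rewrite gerBl exprn_ge0.
  rewrite -[leRHS]opprB subrX1 -mulNr opprB mulrC ler_wpM2l ?subr_ge0 ?(ltW s1)//.
  rewrite (_ : n%:R * _ = \sum_(i < n) s ^+ n); last first.
    by rewrite sumr_const card_ord mulr_natl.
  apply: ler_sum => i _; exact: ler_wiXn2l s0 (ltW s1) _ _ (ltnW (ltn_ord i)).
have g0 : (fun n => (1 - s)^-1 * s ^+ n) @ \oo --> (0 : R).
  have : (fun n => (1 - s)^-1 * s ^+ n) @ \oo --> (1 - s)^-1 * 0.
    by apply: cvgMl_tmp; apply: cvg_expr; rewrite ger0_norm.
  by rewrite mulr0; apply.
apply: (squeeze_cvgr _ (cvg_cst 0) g0); apply: nearW => n.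
rewrite mulr_ge0 ?exprn_ge0//= rs exprMn mulrA ler_wpM2r ?exprn_ge0//.
Qed.

(** Both sides are Bernoulli inequalities: the upper one combines (1 - y)^N (1 + y)^N <= 1 with the
    lower bound 1 + N y of (1 + y)^N. *)
Lemma onemX_bounds (y : R) N : 0 <= y <= 1 ->
  1 - N%:R * y <= (1 - y) ^+ N <= (1 + N%:R * y)^-1.
Proof.
move=> /andP[y0 y1].
have b n : 1 + n%:R * y <= (1 + y) ^+ n.
  elim: n => [|n IH]; first by rewrite mul0r addr0.
  rewrite exprS; apply: (@le_trans _ _ ((1 + y) * (1 + n%:R * y))).
    by rewrite -natr1; have := ler0n R n; nra.
  by rewrite ler_wpM2l// addr_ge0.
apply/andP; split.
  elim: N => [|n IH]; first by rewrite mul0r subr0.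
  rewrite exprS; apply: (@le_trans _ _ ((1 - y) * (1 - n%:R * y))).
    by rewrite -natr1; have := ler0n R n; nra.
  by rewrite ler_wpM2l// subr_ge0.
have p0 : 0 < 1 + N%:R * y by rewrite ltr_pwDl// mulr_ge0.
rewrite -[leRHS]mul1r ler_pdivlMr//.
apply: (@le_trans _ _ ((1 - y) ^+ N * (1 + y) ^+ N)).
  by rewrite ler_wpM2l// exprn_ge0// subr_ge0.
by rewrite -exprMn exprn_ile1//; nra.
Qed.

(* N ~ n / a^n makes N x^n tend to 0 if x < a and to infinity if x >= a, and
   (1 - x^n)^N lies between 1 - N x^n and 1 / (1 + N x^n). *)
Definition threshold_exp (a : R) n := (Num.truncn (n%:R / a ^+ n)).+1.

Lemma cvg_threshold (a x : R) : 0 < a <= 1 -> 0 <= x <= 1 ->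
  (fun n => (1 - x ^+ n) ^+ threshold_exp a n) @ \oo --> ((x < a)%R%:R : R).
Proof.
move=> /andP[a0 a1] /andP[x0 x1].
have xn n : 0 <= x ^+ n <= 1 by rewrite exprn_ge0//= exprn_ile1.
have an n : 0 < a ^+ n by rewrite exprn_gt0.
have nan n : 0 <= n%:R / a ^+ n by rewrite divr_ge0// ltW.
have [xa|ax] := ltP x a; last first.
  apply: (squeeze_cvgr _ (cvg_cst 0) (@cvg_harmonic R)).
  apply: nearW => n; have /andP[_ h] := onemX_bounds (threshold_exp a n) (xn n).
  rewrite exprn_ge0 ?subr_ge0 ?(andP (xn n)).2//=; apply: le_trans h _.
  have xn0 := (andP (xn n)).1.
  rewrite /harmonic /= lef_pV2 ?posrE ?ltr_pwDl ?mulr_ge0//.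
  rewrite -natr1 addrC lerD2l.
  apply: (@le_trans _ _ (n%:R / a ^+ n * x ^+ n)).
    by rewrite mulrAC ler_pdivlMr// ler_wpM2l// lerXn2r// nnegrE ltW.
  by rewrite ler_wpM2r// /threshold_exp; exact/ltW/truncnS_gt.
have xa0 : 0 <= x / a < 1 by rewrite divr_ge0 ?(ltW a0)//= ltr_pdivrMr// mul1r.
(* The summand x^n pays for the successor in [threshold_exp]. *)
have lo : (fun n => 1 - (n%:R * (x / a) ^+ n + x ^+ n)) @ \oo --> (1 : R).
  have : (fun n => 1 - (n%:R * (x / a) ^+ n + x ^+ n)) @ \oo --> 1 - ((0 : R) + 0).
    apply: cvgB; first exact: cvg_cst.
    apply: cvgD; first exact: cvg_natX_geo.
    by apply: cvg_expr; rewrite ger0_norm//; exact: lt_le_trans xa a1.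
  by rewrite addr0 subr0; apply.
rewrite mulr1n; apply: (squeeze_cvgr _ lo (cvg_cst (1 : R))); apply: nearW => n.
have /andP[h _] := onemX_bounds (threshold_exp a n) (xn n).
have /andP[xn0 xn1] := xn n.
apply/andP; split; last by rewrite exprn_ile1 ?subr_ge0// gerBl.
apply: le_trans h; rewrite lerD2l lerN2 /threshold_exp -natr1 mulrDl mul1r lerD2r.
apply: (@le_trans _ _ (n%:R / a ^+ n * x ^+ n)); first by rewrite ler_wpM2r// truncn_le.
by rewrite expr_div_n mulrA mulrAC.
Qed.

End BorelInduction.

Lemma cvgn_eq (R : realType) (u v : nat -> R) (a b : R) :
  u @ \oo --> a -> v @ \oo --> b -> (forall n, u n = v n) -> a = b.
Proof.
by move=> ua vb uv; rewrite -(cvg_lim _ ua)// -(cvg_lim _ vb)// (funext uv).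
Qed.

Section DisjointIndicators.
Variables (R : realType) (T : Type) (F : (set T)^nat) (x : T).
Hypothesis tF : trivIset setT F.

Lemma sum_indic_in n j : F j x -> \sum_(k < n) \1_(F k) x = (j < n)%N%:R :> R.
Proof.
move=> Fj; elim: n => [|n IH]; first by rewrite big_ord0.
rewrite big_ord_recr/= IH indicE; have [jn|jn] := eqVneq j n.
  by rewrite -jn mem_set// ltnn ltnSn add0r.
rewrite memNset; first by rewrite addr0 ltnS (leq_eqVlt j n) (negbTE jn).
move=> Fn; move: jn => /eqP; apply.
by apply: tF => //; exists x.
Qed.

Lemma sum_indic_notin n : ~ (\bigcup_k F k) x -> \sum_(k < n) \1_(F k) x = 0 :> R.
Proof.
move=> nF; rewrite big1// => k _; rewrite indicE memNset// => Fk.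
by apply: nF; exists k.
Qed.

Lemma normr_sum_indic n : `|\sum_(k < n) \1_(F k) x| <= 1 :> R.
Proof.
have [[j _ Fj]|nF] := pselect ((\bigcup_k F k) x).
  by rewrite (sum_indic_in _ Fj); case: (_ < _)%N; rewrite ?normr1 ?normr0.
by rewrite sum_indic_notin// normr0.
Qed.

Lemma cvg_sum_indic :
  (fun n => \sum_(k < n) \1_(F k) x) @ \oo --> (\1_(\bigcup_k F k) x : R).
Proof.
have [[j _ Fj]|nF] := pselect ((\bigcup_k F k) x).
  rewrite indicE mem_set; last by exists j.
  apply: cvg_near_cst; near=> n; rewrite (sum_indic_in _ Fj).
  by suff -> : (j < n)%N by []; near: n; exact: nbhs_infty_gt.
rewrite indicE memNset//; under eq_fun do rewrite sum_indic_notin//.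
exact: cvg_cst.
Unshelve. all: by end_near. Qed.

End DisjointIndicators.

Section Calculus.
Variable R : realType.

Implicit Types (p q : R -> R).

(** Boundedness is asked on [0, 2] only, so that the identity and the exponentials belong to the
    class. *)
Definition bmf (p : R -> R) : Prop := measurable_fun setT p /\
  exists C : R, forall x, 0 <= x <= 2 -> `|p x| <= C.

(* What the integral against the generalized eigenfunctions provides: M p is the
   matrix of p(L); only the values of p on [0, 2], which contains the spectrum, matter. *)
Record calculus (M : (R -> R) -> int -> int -> R) : Prop := Calculus {
  calcD : forall p q, bmf p -> bmf q -> forall m n,
    M (fun x => p x + q x) m n = M p m n + M q m n;
  calcZ : forall c p, bmf p -> forall m n, M (fun x => c * p x) m n = c * M p m n;
  calcC : forall p m n, M p m n = M p n m;
  calc_ge0 : forall p, bmf p -> (forall x, 0 <= x <= 2 -> 0 <= p x) ->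
    forall N g, 0 <= kform (M p) N g;
  calc1 : forall m n, M (cst 1) m n = (m == n)%:R;
  calcL : forall p, bmf p -> forall m n,
    Lpr_fun (fun k => (M p k n)%:C) m = (M (fun x => x * p x) m n)%:C;
  calc_cvg : forall (ps : (R -> R)^nat) (p : R -> R) (C : R), (forall k, measurable_fun setT (ps k)) ->
    measurable_fun setT p -> (forall k x, 0 <= x <= 2 -> `|ps k x| <= C) ->
    (forall x, 0 <= x <= 2 -> ps ^~ x @ \oo --> p x) ->
    forall m n, (fun k => M (ps k) m n) @ \oo --> M p m n }.

Lemma bmf_cst (c : R) : bmf (cst c).
Proof. by split; [exact: measurable_cst|exists `|c|]. Qed.

Lemma bmf_id : bmf (fun x => x).
Proof.
split; first exact: measurable_id.
by exists 2 => x /andP[x0 x2]; rewrite ger0_norm.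
Qed.

Lemma bmfD p q : bmf p -> bmf q -> bmf (fun x => p x + q x).
Proof.
move=> [mp [C pC]] [mq [D qD]]; split; first exact: measurable_funD.
by exists (C + D) => x x02; apply: le_trans (ler_normD _ _) _; rewrite lerD ?pC ?qD.
Qed.

Lemma bmfM p q : bmf p -> bmf q -> bmf (fun x => p x * q x).
Proof.
move=> [mp [C pC]] [mq [D qD]]; split; first exact: measurable_funM.
by exists (C * D) => x x02; rewrite normrM ler_pM ?pC ?qD.
Qed.

Lemma bmfZ c p : bmf p -> bmf (fun x => c * p x).
Proof. by move=> bp; apply: bmfM bp; exact: bmf_cst. Qed.

Lemma bmfX p n : bmf p -> bmf (fun x => p x ^+ n).
Proof.
move=> bp; elim: n => [|n IH].
  rewrite (_ : (fun x => _) = cst 1); first exact: bmf_cst.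
  by apply/funext => x; rewrite expr0.
rewrite (_ : (fun x => _) = (fun x => p x * p x ^+ n)); first exact: bmfM.
by apply/funext => x; rewrite exprS.
Qed.

Lemma bmf_expR (t : R) : 0 <= t -> bmf (fun x => expR (- t * x)).
Proof.
move=> t0; split.
  by apply: measurableT_comp => //; apply: measurable_funM => //; exact: measurable_cst.
exists 1 => x /andP[x0 x2]; rewrite ger0_norm ?expR_ge0// -expR0 ler_expR.
by rewrite mulNr oppr_le0 mulr_ge0.
Qed.

Lemma bmf_sum n (F : nat -> R -> R) : (forall k, bmf (F k)) ->
  bmf (fun x => \sum_(k < n) F k x).
Proof.
move=> bF; elim: n => [|n IH].
  rewrite (_ : (fun x => _) = cst 0); first exact: bmf_cst.
  by apply/funext => x; rewrite big_ord0.
rewrite (_ : (fun x => _) = (fun x => \sum_(k < n) F k x + F n x)); first exact: bmfD.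
by apply/funext => x; rewrite big_ord_recr.
Qed.

Lemma bmf_indic (B : set (measurableTypeR R)) : measurable B -> bmf (\1_B : R -> R).
Proof.
move=> mB; split; first exact: measurable_indic.
by exists 1 => x _; rewrite indicE; case: (_ \in _); rewrite ?normr1 ?normr0.
Qed.

(** The monotone class argument in abstract form. It serves twice: for multiplicativity, and for
    commutation with an operator that commutes with L. *)
Record calculus_closed (P : (R -> R) -> Prop) : Prop := CalculusClosed {
  clos_ext : forall q q', bmf q' -> (forall x, 0 <= x <= 2 -> q x = q' x) -> P q -> P q';
  clos_cst : forall c : R, P (cst c);
  clos_id : P (fun x => x);
  closD : forall q r, P q -> P r -> P (fun x => q x + r x);
  closM : forall q r, P q -> P r -> P (fun x => q x * r x);
  clos_lim : forall (qs : (R -> R)^nat) q (C : R), (forall k, P (qs k)) ->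
    measurable_fun setT q -> (forall k x, 0 <= x <= 2 -> `|qs k x| <= C) ->
    (forall x, 0 <= x <= 2 -> qs ^~ x @ \oo --> q x) -> P q }.

Section Closed.
Variables (P : (R -> R) -> Prop) (HP : calculus_closed P).

Lemma closX q n : P q -> P (fun x => q x ^+ n).
Proof.
move=> Pq; elim: n => [|n IH].
  rewrite (_ : (fun x => _) = cst 1); first exact: clos_cst.
  by apply/funext => x; rewrite expr0.
rewrite (_ : (fun x => _) = (fun x => q x * q x ^+ n)); first exact: closM.
by apply/funext => x; rewrite exprS.
Qed.

Lemma clos_sum n (F : nat -> R -> R) : (forall k, P (F k)) ->
  P (fun x => \sum_(k < n) F k x).
Proof.
move=> PF; elim: n => [|n IH].
  rewrite (_ : (fun x => _) = cst 0); first exact: clos_cst.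
  by apply/funext => x; rewrite big_ord0.
rewrite (_ : (fun x => _) = (fun x => \sum_(k < n) F k x + F n x)).
  exact: closD.
by apply/funext => x; rewrite big_ord_recr.
Qed.

Lemma closed_ray (a : R) : P (\1_(`]-oo, a[%classic)).
Proof.
have ba : bmf (\1_(`]-oo, a[%classic : set R) : R -> R) by exact: bmf_indic.
have ray x : (\1_(`]-oo, a[%classic) : R -> R) x = (x < a)%R%:R.
  by rewrite indicE; congr (_%:R); rewrite mem_setE in_itv.
(* An endpoint outside []0, 2]] makes the indicator constant on [0, 2], the only place where
   [clos_ext] compares functions; otherwise halving brings everything into [0, 1]. *)
have [a0|a0] := lerP a 0.
  apply: (clos_ext HP ba _ (clos_cst HP 0)) => x /andP[x0 x2].
  by rewrite ray ltNge (le_trans a0 x0).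
have [a2|a2] := ltP 2 a.
  apply: (clos_ext HP ba _ (clos_cst HP 1)) => x /andP[x0 x2].
  by rewrite ray (le_lt_trans x2 a2).
have h2 : P (fun x => 2^-1 * x) by apply: (closM HP _ (clos_id HP)); exact: clos_cst.
pose qs n := fun x : R => (1 + (-1) * (2^-1 * x) ^+ n) ^+ threshold_exp (2^-1 * a) n.
have x2 (x : R) : 0 <= x <= 2 -> 0 <= 2^-1 * x <= 1 by move=> /andP[? ?]; apply/andP; split; lra.
apply: (clos_lim HP (qs := qs) (C := 1)); last 1 first.
- move=> x x02; rewrite ray.
  have := @cvg_threshold R (2^-1 * a) (2^-1 * x) _ (x2 x x02).
  rewrite ltr_pM2l ?invr_gt0//; under eq_fun do rewrite -mulN1r.
  by apply; apply/andP; split; lra.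
- move=> n; apply: closX; apply: (closD HP (clos_cst HP 1)).
  exact: (closM HP (clos_cst HP (-1)) (closX n h2)).
- by case: ba.
- move=> n x /x2/andP[y0 y1]; rewrite /qs mulN1r.
  have e0 : 0 <= (2^-1 * x) ^+ n by rewrite exprn_ge0.
  have e1 : (2^-1 * x) ^+ n <= 1 by rewrite exprn_ile1.
  by rewrite normrX exprn_ile1// ger0_norm ?subr_ge0// gerBl.
Qed.

Lemma closed_indic (B : set (measurableTypeR R)) : measurable B -> P \1_B.
Proof.
move: B; apply: (borel_ind (RGenInftyO.measurableE R)).
- by rewrite indic0; exact: clos_cst.
- move=> A mA QA; rewrite (_ : \1_ _ = fun x => 1 + (-1) * \1_A x); last first.
    apply/funext => x; rewrite !indicE in_setC.
    by case: (x \in A) => /=; rewrite ?mulr1 ?mulr0 ?subrr ?addr0.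
  by apply: (closD HP (clos_cst HP 1)); apply: closM => //; exact: clos_cst.
- by move=> A B mA mB QA QB; rewrite indicI; exact: closM.
- move=> F mF QF tF.
  apply: (clos_lim HP (qs := fun n x => \sum_(k < n) \1_(F k) x) (C := 1)).
  + by move=> n; exact: (clos_sum n (F := fun k => \1_(F k))).
  + by apply: measurable_indic; exact: bigcupT_measurable.
  + by move=> n x _; exact: normr_sum_indic.
  + by move=> x _; exact: cvg_sum_indic.
- by move=> _ [x ->]; exact: closed_ray.
Qed.

End Closed.

Variable M : (R -> R) -> int -> int -> R.
Hypothesis HM : calculus M.

(** A constant sequence in [calc_cvg] suffices, since pointwise convergence is asked there on [0, 2]
    only. *)
Lemma calc_ext p q : measurable_fun setT p -> measurable_fun setT q ->
  (exists C : R, forall x, 0 <= x <= 2 -> `|p x| <= C) ->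
  (forall x, 0 <= x <= 2 -> p x = q x) -> forall m n, M p m n = M q m n.
Proof.
move=> mp mq [C pC] pq m n.
have h : (fun k : nat => M p m n) @ \oo --> M q m n.
  apply: (calc_cvg HM (C := C)) => // x x02.
  by rewrite -pq//; exact: cvg_cst.
by rewrite -(cvg_lim _ h)// lim_cst.
Qed.

Lemma kformD p q N g : bmf p -> bmf q ->
  kform (M (fun x => p x + q x)) N g = kform (M p) N g + kform (M q) N g.
Proof.
move=> bp bq; rewrite /kform -big_split/=; apply: eq_bigr => m _.
by rewrite -big_split/=; apply: eq_bigr => n _; rewrite (calcD HM)// mulrDl.
Qed.

Lemma kformZ c p N g : bmf p ->
  kform (M (fun x => c * p x)) N g = c * kform (M p) N g.
Proof.
move=> bp; rewrite /kform mulr_sumr; apply: eq_bigr => m _.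
by rewrite mulr_sumr; apply: eq_bigr => n _; rewrite (calcZ HM)// -mulrA.
Qed.

Lemma kform1 N g : kform (M (cst 1)) N g = \sum_(z <- win N) g z ^+ 2.
Proof.
rewrite /kform; apply: eq_big_seq => m mN.
rewrite (bigD1_seq m) ?win_uniq//= big1 ?addr0 ?(calc1 HM) ?eqxx ?mul1r//.
by move=> n nm; rewrite (calc1 HM) eq_sym (negbTE nm) mul0r.
Qed.

(** C - p and C + p are nonnegative on [0, 2], and [calc1] turns the form of the constant C into C
    times the sum of squares. *)
Lemma calc_form_bound p (C : R) : bmf p -> (forall x, 0 <= x <= 2 -> `|p x| <= C) ->
  form_bound (M p) C.
Proof.
move=> bp pC N g; rewrite -kform1 -kformZ; last exact: bmf_cst.
have bC : bmf (fun x => C * (cst 1 x)) by apply: bmfZ; exact: bmf_cst.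
rewrite ler_norml; apply/andP; split.
  rewrite -subr_ge0 opprK -kformD//; apply: (calc_ge0 HM); first exact: bmfD.
  by move=> x x02; have := pC x x02; rewrite ler_norml => /andP[]; rewrite /cst; lra.
have -> : kform (M p) N g = - kform (M (fun x => -1 * p x)) N g.
  by rewrite kformZ//; ring.
have bNp : bmf (fun x => -1 * p x) by exact: bmfZ.
rewrite -subr_ge0 opprK -kformD//; apply: (calc_ge0 HM); first exact: bmfD.
by move=> x x02; have := pC x x02; rewrite ler_norml => /andP[]; rewrite /cst; lra.
Qed.

Lemma bmf_bound p : bmf p -> exists2 C : R, 0 < C & forall x, 0 <= x <= 2 -> `|p x| <= C.
Proof.
move=> [_ [C pC]]; exists (`|C| + 1); first by rewrite ltr_wpDl.
by move=> x x02; apply: le_trans (pC x x02) _; rewrite ler_wpDr// ler_norm.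
Qed.

Lemma calc_operator p : exists T : {linear ell2 R -> ell2 R}, bmf p -> has_kernel T (M p).
Proof.
(* The identity is a default value that makes [opE] total in p. *)
have [bp|nbp] := pselect (bmf p); last by exists idfun.
have [C C0 pC] := bmf_bound bp.
by exists (kopf C0 (calcC HM p) (calc_form_bound bp pC)) => _; exact: kopf_has_kernel.
Qed.

Definition opE p : {linear ell2 R -> ell2 R} := projT1 (cid (calc_operator p)).

Lemma opE_kernel p : bmf p -> has_kernel (opE p) (M p).
Proof. by rewrite /opE; case: cid. Qed.

Lemma norm2_opE p (C : R) : 0 < C -> bmf p -> (forall x, 0 <= x <= 2 -> `|p x| <= C) ->
  forall f, norm2 (opE p f) <= C * norm2 f.
Proof.
move=> C0 bp pC.
exact: (@has_kernel_bound R (M p) C C0 (calcC HM p) (calc_form_bound bp pC) _ (opE_kernel bp)).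
Qed.

(** Linear identities between operators are checked on these finite sums and passed to the limit by
    [cvg_wform]. *)
Definition wform p N (f g : ell2 R) :=
  \sum_(m <- win N) \sum_(n <- win N) M p m n * pr2 (f n) (g m).

Lemma cvg_wform p f g : bmf p -> (fun N => wform p N f g) @ \oo --> rin (opE p f) g.
Proof.
move=> bp; have [C C0 pC] := bmf_bound bp.
exact: (@cvg_kernel_form R (M p) C C0 (calcC HM p) (calc_form_bound bp pC) _ f g (opE_kernel bp)).
Qed.

Lemma opE_sym p f g : bmf p -> rin (opE p f) g = rin f (opE p g).
Proof.
move=> bp; have [C C0 pC] := bmf_bound bp.
exact: (@has_kernel_sym R (M p) C C0 (calcC HM p) (calc_form_bound bp pC) _ f g (opE_kernel bp)).
Qed.

Lemma opE_ext p q f : bmf p -> bmf q -> (forall x, 0 <= x <= 2 -> p x = q x) ->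
  opE p f = opE q f.
Proof.
move=> bp bq pq; apply: (has_kernel_uniq (opE_kernel bp)).
have -> : M p = M q; last exact: opE_kernel.
apply/funext => m; apply/funext => n.
by case: (bp) (bq) => mp Cp [mq _]; exact: calc_ext.
Qed.

Lemma opED p q f : bmf p -> bmf q -> opE (fun x => p x + q x) f = opE p f + opE q f.
Proof.
move=> bp bq; apply: rin_eq => h; rewrite rinDl.
apply: (cvgn_eq (@cvg_wform _ f h (bmfD bp bq))
  (cvgD (@cvg_wform _ f h bp) (@cvg_wform _ f h bq))) => N.
rewrite /wform fctE -big_split; apply: eq_bigr => m _.
by rewrite -big_split; apply: eq_bigr => n _; rewrite (calcD HM)// mulrDl.
Qed.

Lemma opEZ (c : R) p f : bmf p -> opE (fun x => c * p x) f = c%:C *: opE p f.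
Proof.
move=> bp; apply: rin_eq => h; rewrite rinZl.
apply: (cvgn_eq (@cvg_wform _ f h (bmfZ c bp))
  (cvgMl_tmp (a := c) (@cvg_wform _ f h bp))) => N.
rewrite /wform mulr_sumr; apply: eq_bigr => m _.
by rewrite mulr_sumr; apply: eq_bigr => n _; rewrite (calcZ HM)// -mulrA.
Qed.

Lemma opE1 f : opE (cst 1) f = f.
Proof.
apply: rin_eq => h.
apply: (cvgn_eq (@cvg_wform _ f h (bmf_cst 1)) (cvg_sumZ (absum_pr2 f h))) => N.
apply: eq_big_seq => m mN.
rewrite (bigD1_seq m) ?win_uniq//= big1 ?addr0 ?(calc1 HM) ?eqxx ?mul1r//.
by move=> n nm; rewrite (calc1 HM) eq_sym (negbTE nm) mul0r.
Qed.

(** L combines three neighbouring rows of the kernel, so it passes through the sum over columns. *)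
Lemma Lpr_opE p f : bmf p -> Lpr (opE p f) = opE (fun x => x * p x) f.
Proof.
move=> bp; apply: ell2_ext => z.
rewrite (has_kernelE _ _ (opE_kernel (bmfM bmf_id bp))).
have [a [b [c [_ _ _ LE]]]] := @Lpr_fun_coef R.
have Mz m n : M (fun x => x * p x) m n = a m * M p m n + (b m * M p (m - 1) n + c m * M p (m + 1) n).
  have := calcL HM bp m n; rewrite LE => /(congr1 (@complex.Re R))/= <-.
  by ring.
have -> : Lpr (opE p f) z = Lpr_fun (opE p f) z by [].
rewrite LE !(has_kernelE _ _ (opE_kernel bp)) /kop /kapp.
have [C C0 pC] := bmf_bound bp.
have ab m g : absum (fun n => g n ^+ 2) -> absum (fun n => M p m n * g n).
  by move=> sg; apply: (absum_kernel C0 (calcC HM p) (calc_form_bound bp pC)).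
have key g : absum (fun n => g n ^+ 2) -> sumZ (fun n => M (fun x => x * p x) z n * g n) =
   a z * sumZ (fun n => M p z n * g n) + (b z * sumZ (fun n => M p (z - 1) n * g n) +
     c z * sumZ (fun n => M p (z + 1) n * g n)).
  move=> sg; have [s1 s2 s3] := And3 (ab z g sg) (ab (z - 1) g sg) (ab (z + 1) g sg).
  rewrite -(sumZZ (a z) s1) -(sumZZ (b z) s2) -(sumZZ (c z) s3).
  rewrite -(sumZD (absumZ (b z) s2) (absumZ (c z) s3)).
  rewrite -(sumZD (absumZ (a z) s1) (absumD (absumZ (b z) s2) (absumZ (c z) s3))).
  by congr sumZ; apply/funext => n; rewrite Mz; ring.
rewrite !key; [|exact: absum_Im2|exact: absum_Re2].
by apply/eqP; rewrite eq_complex/=; apply/andP; split; apply/eqP; ring.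
Qed.

Lemma opE_id f : opE (fun x => x) f = Lpr f.
Proof.
rewrite -[in RHS](opE1 f) Lpr_opE; last exact: bmf_cst.
apply: opE_ext; [exact: bmf_id|by apply: bmfM; [exact: bmf_id|exact: bmf_cst]|].
by move=> x _; rewrite mulr1.
Qed.

(** L is the operator of the identity function, and kernels of the calculus are symmetric; no
    summation by parts is involved. *)
Lemma Lpr_sym (f g : ell2 R) : rin (Lpr f) g = rin f (Lpr g).
Proof. by rewrite -!opE_id opE_sym//; exact: bmf_id. Qed.

(** On a fixed window finitely many matrix entries converge. The truncation errors are uniform in k
    because all the operators share the norm bound D. *)
Lemma cvg_rin_opE (ps : (R -> R)^nat) p (C : R) f g :
  (forall k, measurable_fun setT (ps k)) -> measurable_fun setT p ->
  (forall k x, 0 <= x <= 2 -> `|ps k x| <= C) ->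
  (forall x, 0 <= x <= 2 -> ps ^~ x @ \oo --> p x) ->
  (fun k => rin (opE (ps k) f) g) @ \oo --> rin (opE p f) g.
Proof.
move=> mps mp psC psp.
pose D := `|C| + 1; have D0 : 0 < D by rewrite ltr_wpDl.
have psD k x : 0 <= x <= 2 -> `|ps k x| <= D.
  by move=> x02; apply: le_trans (psC k x x02) _; rewrite ler_wpDr// ler_norm.
have pD x : 0 <= x <= 2 -> `|p x| <= D.
  move=> x02; apply: (cvgr_to_le (cvg_norm (psp x x02))).
  by apply: nearW => k; exact: psD.
have bps k : bmf (ps k) by split => //; exists D => x; exact: psD.
have bp : bmf p by split => //; exists D.
have wf q N : bmf q -> rin (opE q (trunc N f)) (trunc N g) = wform q N f g.
  by move=> bq; exact: rin_kernel_trunc (opE_kernel bq).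
apply/cvgrPdist_le => e e0.
have e3 : 0 < e / 3 by rewrite divr_gt0.
have [N _ /(_ N (leqnn N)) errN] : \forall N \near \oo, `|0 - trunc_err D f g N| <= e / 3.
  by have /cvgrPdist_le := @cvg_trunc_err R D f g; apply.
have cw : (fun k => wform (ps k) N f g) @ \oo --> wform p N f g.
  apply: cvg_sumr => m; apply: cvg_sumr => n; apply: cvgMr_tmp.
  exact: (calc_cvg HM mps mp psC psp).
move/cvgrPdist_le : cw => /(_ _ e3) cw; near=> k.
have err q : bmf q -> (forall x, 0 <= x <= 2 -> `|q x| <= D) ->
    `|wform q N f g - rin (opE q f) g| <= e / 3.
  move=> bq qD; rewrite -wf//; apply: le_trans (rin_trunc_err _ _ _ (ltW D0) (norm2_opE D0 bq qD)) _.
  by apply: le_trans errN; rewrite sub0r normrN ler_norm.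
have h : `|wform p N f g - wform (ps k) N f g| <= e / 3.
  by near: k; exact: cw.
have := err _ bp pD; have := err _ (bps k) (psD k); move: h; rewrite !ler_norml.
by move=> /andP[? ?] /andP[? ?] /andP[? ?]; apply/andP; split; lra.
Unshelve. all: by end_near. Qed.

(** Quantifying over all p is what makes the property stable under products: p (q r) is read as (p
    q) r. *)
Definition multiplicative q := bmf q /\ forall p, bmf p -> forall f,
  opE (fun x => p x * q x) f = opE p (opE q f).

Lemma mul_ext q q' : bmf q' -> (forall x, 0 <= x <= 2 -> q x = q' x) ->
  multiplicative q -> multiplicative q'.
Proof.
move=> bq' qq' [bq mq]; split => // p bp f.
rewrite -(opE_ext f bq bq' qq') -mq//; apply: opE_ext; [exact: bmfM..|].
by move=> x x02; rewrite qq'.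
Qed.

Lemma mul_cst (c : R) : multiplicative (cst c).
Proof.
split=> [|p bp f]; first exact: bmf_cst.
have -> : opE (cst c) f = c%:C *: f.
  rewrite -[in RHS](opE1 f) -opEZ; last exact: bmf_cst.
  apply: opE_ext; [exact: bmf_cst|apply: bmfZ; exact: bmf_cst|].
  by move=> x _; rewrite mulr1.
rewrite linearZ/= -opEZ//; apply: opE_ext; last by move=> x _; rewrite mulrC.
  by apply: bmfM => //; exact: bmf_cst.
exact: bmfZ.
Qed.

Lemma mulD q r : multiplicative q -> multiplicative r ->
  multiplicative (fun x => q x + r x).
Proof.
move=> [bq mq] [br mr]; split=> [|p bp f]; first exact: bmfD.
rewrite (_ : (fun x => _) = (fun x => p x * q x + p x * r x)); last first.
  by apply/funext => x; rewrite mulrDr.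
by rewrite !opED ?linearD/= ?mq ?mr//; exact: bmfM.
Qed.

Lemma mulM q r : multiplicative q -> multiplicative r ->
  multiplicative (fun x => q x * r x).
Proof.
move=> [bq mq] [br mr]; split=> [|p bp f]; first exact: bmfM.
rewrite (_ : (fun x => _) = (fun x => (p x * q x) * r x)); last first.
  by apply/funext => x; rewrite mulrA.
by rewrite mr ?mq ?mr//; exact: bmfM.
Qed.

(** [Lpr_opE] has L to the left of [opE p], while here it stands to the right; the two orders are
    adjoint to each other. *)
Lemma mul_id : multiplicative (fun x => x).
Proof.
split=> [|p bp f]; first exact: bmf_id.
rewrite (_ : (fun x => _) = (fun x => x * p x)); last first.
  by apply/funext => x; rewrite mulrC.
rewrite opE_id; apply: rin_eq => h.
rewrite opE_sym; last by apply: bmfM => //; exact: bmf_id.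
by rewrite -Lpr_opE// -Lpr_sym opE_sym.
Qed.

(** A product of weakly convergent operators need not converge to the product of the limits; here
    [opE p] is fixed and moves onto h, so that a single varying factor is left. *)
Lemma mul_lim (qs : (R -> R)^nat) q (C : R) : (forall k, multiplicative (qs k)) ->
  measurable_fun setT q -> (forall k x, 0 <= x <= 2 -> `|qs k x| <= C) ->
  (forall x, 0 <= x <= 2 -> qs ^~ x @ \oo --> q x) -> multiplicative q.
Proof.
move=> mqs mq qsC qsq.
have bq : bmf q.
  split=> //; exists C => x x02; apply: (cvgr_to_le (cvg_norm (qsq x x02))).
  by apply: nearW => k; exact: qsC.
split=> // p bp f; have [D D0 pD] := bmf_bound bp.
apply: rin_eq => h; rewrite [RHS]opE_sym//.
have mq_ k : measurable_fun setT (qs k) by case: (mqs k) => -[].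
apply: (@cvgn_eq _ (fun k => rin (opE (fun x => p x * qs k x) f) h)
   (fun k => rin (opE (qs k) f) (opE p h))).
- apply: (@cvg_rin_opE _ _ (D * C)).
  + by move=> k; apply: measurable_funM => //; case: bp.
  + by apply: measurable_funM => //; case: bp.
  + by move=> k x x02; rewrite normrM ler_pM ?pD ?qsC.
  + by move=> x x02; apply: cvgMl_tmp; exact: qsq.
- exact: (@cvg_rin_opE _ _ C).
- by move=> k; case: (mqs k) => _ ->//; rewrite opE_sym.
Qed.

Lemma mul_closed : calculus_closed multiplicative.
Proof.
split; [exact: mul_ext|exact: mul_cst|exact: mul_id|exact: mulD|exact: mulM|].
by move=> qs q C mqs mq qsC qsq; exact: mul_lim mqs mq qsC qsq.
Qed.

Lemma mul_indic (B : set (measurableTypeR R)) : measurable B -> multiplicative \1_B.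
Proof. exact: (closed_indic mul_closed). Qed.

End Calculus.

(** * Spectral measures *)

Section ProjectionValuedMeasure.
Variable R : realType.
Local Notation T := (measurableTypeR R).
Implicit Types (f g h : ell2 R).

Lemma cvg_norm2_rin (u : nat -> ell2 R) f g :
  (fun n => norm2 (u n - f)) @ \oo --> (0 : R) ->
  (fun n => rin (u n) g) @ \oo --> rin f g.
Proof.
move=> uf; apply: (@cvg_sub0 _ _ _ _ _ _ (cst (rin f g))); last exact: cvg_cst.
have ug : (fun n => norm2 (u n - f) * norm2 g) @ \oo --> (0 : R).
  rewrite -(mul0r (norm2 g)); exact: cvgMr_tmp.
apply/norm_cvg0P; apply: (squeeze_cvgr _ (cvg_cst 0) ug); apply: nearW => n.
by rewrite normr_ge0 !fctE -rinBl normr_rin.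
Qed.

Variable E : set T -> {linear ell2 R -> ell2 R}.
Hypothesis HE : projection_valued_measure E.

Lemma pvm_sym A f g : measurable A -> rin (E A f) g = rin f (E A g).
Proof. by move=> mA; case: HE => /(_ _ mA)[/selfadjointP h _] _ _ _; exact: h. Qed.

Lemma pvm_idem A f : measurable A -> E A (E A f) = E A f.
Proof. by move=> mA; case: HE => /(_ _ mA)[]. Qed.

Lemma pvmT f : E setT f = f.
Proof. by case: HE. Qed.

Lemma pvmI A B f : measurable A -> measurable B -> E (A `&` B) f = E A (E B f).
Proof. by case: HE => _ _ h _ mA mB; exact: h. Qed.

Lemma pvm_rin_sqn A f : measurable A -> rin (E A f) f = sqn (E A f).
Proof. by move=> mA; rewrite /sqn -pvm_sym// pvm_idem. Qed.

Lemma pvm_rin_ge0 A f : measurable A -> 0 <= rin (E A f) f.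
Proof. by move=> mA; rewrite pvm_rin_sqn// sqn_ge0. Qed.

Lemma pvm_cvg (F : (set T)^nat) g h : (forall k, measurable (F k)) ->
  trivIset setT F ->
  (fun n => \sum_(k < n) rin (E (F k) g) h) @ \oo --> rin (E (\bigcup_k F k) g) h.
Proof.
move=> mF tF; case: HE => _ _ _ /(_ F mF tF g) cv; have := @cvg_norm2_rin _ _ h cv.
have rin_sum n : rin (\sum_(k < n) E (F k) g) h = \sum_(k < n) rin (E (F k) g) h.
  elim: n => [|n IH]; first by rewrite !big_ord0 rin0l.
  by rewrite !big_ord_recr/= rinDl IH.
by under eq_fun do rewrite rin_sum; apply.
Qed.

Lemma pvm0 g : E set0 g = 0.
Proof.
apply: sqn_eq0; rewrite -pvm_rin_sqn//; set c := rin _ _.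
(* Countable additivity along the constant sequence [set0] makes n c converge to c, which forces 2 c
   <= c. *)
have : (fun n => \sum_(k < n) c) @ \oo --> c.
  have := @pvm_cvg (fun=> set0) g g (fun=> measurable0) (@trivIset_set0 _ _ _).
  by rewrite bigcup0.
have c0 : 0 <= c by exact: pvm_rin_ge0.
move=> cc; suff : c + c <= c by lra.
apply: (cvgr_to_ge cc); near=> n; rewrite sumr_const card_ord -mulr2n.
by apply: ler_wpMn2l => //; near: n; exact: nbhs_infty_ge.
Unshelve. all: by end_near. Qed.

Lemma pvmU A B g : measurable A -> measurable B -> A `&` B = set0 ->
  E (A `|` B) g = E A g + E B g.
Proof.
move=> mA mB AB; apply: rin_eq => h; rewrite rinDl.
have mF k : measurable (bigcup2 A B k) by rewrite /bigcup2; do ?[case: ifP => _].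

have tF : trivIset setT (bigcup2 A B) by rewrite -trivIset_bigcup2.
have := @pvm_cvg _ g h mF tF; rewrite bigcup2E => hc.
rewrite -(cvg_lim _ hc)//; apply: cvg_lim => //; apply: cvg_near_cst; near=> n.
have n2 : (2 <= n)%N by near: n; exact: nbhs_infty_ge.
rewrite -(subnKC n2) big_split_ord/= !big_ord_recl big_ord0/= addr0.
by rewrite big1 ?addr0// => k _; rewrite pvm0 rin0l.
Unshelve. all: by end_near. Qed.

Lemma pvmC A g : measurable A -> E (~` A) g = g - E A g.
Proof.
move=> mA; apply/eqP; rewrite eq_sym subr_eq addrC -pvmU ?setUv ?pvmT ?setICr//.
exact: measurableC.
Qed.

(** A measure must be nonnegative on every set, whereas E is arbitrary outside the Borel sets; hence
    the value 0 there. *)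
Definition pvm_mu g (B : set T) : \bar R :=
  if `[< measurable B >] then (rin (E B g) g)%:E else 0%E.

Lemma pvm_muE g B : measurable B -> pvm_mu g B = (rin (E B g) g)%:E.
Proof. by move=> mB; rewrite /pvm_mu asboolT. Qed.

Lemma pvm_mu0 g : pvm_mu g set0 = 0%E.
Proof. by rewrite pvm_muE// pvm0 rin0l. Qed.

Lemma pvm_mu_ge0 g B : (0 <= pvm_mu g B)%E.
Proof. by rewrite /pvm_mu; case: asboolP => // mB; rewrite lee_fin pvm_rin_ge0. Qed.

Lemma pvm_mu_sigma g : semi_sigma_additive (pvm_mu g).
Proof.
move=> F mF tF mU; rewrite pvm_muE//.
have -> : (fun n => (\sum_(0 <= i < n) pvm_mu g (F i))%E) =
    EFin \o (fun n => \sum_(k < n) rin (E (F k) g) g).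
  apply/funext => n; rewrite big_mkord /= -sumEFin.
  by apply: eq_bigr => k _; rewrite pvm_muE.
by apply/fine_cvgP; split; [exact: nearW|exact: pvm_cvg].
Qed.

HB.instance Definition _ g := isMeasure.Build _ T R (pvm_mu g)
  (pvm_mu0 g) (pvm_mu_ge0 g) (@pvm_mu_sigma g).

Definition pvm_measure g : {measure set T -> \bar R} := pvm_mu g.

End ProjectionValuedMeasure.

Lemma pvm_eq_rays (R : realType) (E E' : set (measurableTypeR R) -> {linear ell2 R -> ell2 R}) :
  projection_valued_measure E -> projection_valued_measure E' ->
  (forall l g, E `]-oo, l]%classic g = E' `]-oo, l]%classic g) -> pvm_eq E E'.
Proof.
move=> HE HE' ray.
pose Q B := forall g, E B g = E' B g.
suff : forall B, measurable B -> Q B by [].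
apply: (borel_ind (RGenOInfty.measurableE R)).
- by move=> g; rewrite !pvm0.
- by move=> A mA QA g; rewrite (pvmC HE)// (pvmC HE')// QA.
- by move=> A B mA mB QA QB g; rewrite (pvmI HE)// (pvmI HE')// QB QA.
- move=> F mF QF tF g; apply: rin_eq => h.
  apply: (cvgn_eq (@pvm_cvg _ _ HE F g h mF tF) (@pvm_cvg _ _ HE' F g h mF tF)) => n.
  by apply: eq_bigr => k _; rewrite QF.
- by move=> _ [x ->] g; rewrite -setCitvl (pvmC HE)// (pvmC HE')// ray.
Qed.

Section SpectralMeasure.
Variable R : realType.
Local Notation T := (measurableTypeR R).
Implicit Types (f g h : ell2 R) (p q : R -> R).

Lemma rin_i f g : rin ('i *: f) ('i *: g) = rin f g.
Proof.
congr sumZ; apply/funext => z; rewrite /pr2 !ell2_scaleE.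
by case: (f z) (g z) => [a b] [c d] /=; ring.
Qed.

Lemma inner_sym (L : {linear ell2 R -> ell2 R}) g :
  (forall f h, rin (L f) h = rin f (L h)) -> inner (L g) g = (rin (L g) g)%:C.
Proof.
move=> Lsym; apply/eqP; rewrite eq_complex Re_inner Im_inner eqxx/=.
rewrite Lsym linearZ/=; apply/eqP.
(* Multiplication by the imaginary unit is an isometry of square -1, so symmetry of L makes this
   number its own opposite. *)
suff : rin g ('i *: L g) = - rin g ('i *: L g) by lra.
rewrite -[LHS]rin_i scalerA -expr2 sqr_i scaleN1r rinNr; congr (- _).
by rewrite -Lsym linearZ/= rinC.
Qed.

Lemma cvg_sqn_norm2 (u : nat -> ell2 R) : (fun n => sqn (u n)) @ \oo --> (0 : R) ->
  (fun n => norm2 (u n)) @ \oo --> (0 : R).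
Proof.
move=> u0; under eq_fun do rewrite norm2E.
by have := continuous_cvg _ (@sqrt_continuous R 0) u0; rewrite sqrtr0; apply.
Qed.

Variable M : (R -> R) -> int -> int -> R.
Hypothesis HM : calculus M.
Local Notation E := (opE HM).

Lemma opE_sum n (F : nat -> R -> R) f : (forall k, bmf (F k)) ->
  E (fun x => \sum_(k < n) F k x) f = \sum_(k < n) E (F k) f.
Proof.
move=> bF; elim: n => [|n IH].
  rewrite big_ord0 (_ : (fun x => _) = (fun x => 0 * cst 1 x)).
    by rewrite opEZ ?scale0r//; exact: bmf_cst.
  by apply/funext => x; rewrite big_ord0 mul0r.
rewrite big_ord_recr/= -IH -opED//; last exact: bmf_sum.
by congr (E _ f); apply/funext => x; rewrite big_ord_recr.
Qed.

Definition specm (B : set T) : {linear ell2 R -> ell2 R} := E \1_B.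

Lemma specm_pvm : projection_valued_measure specm.
Proof.
split.
- move=> B mB; have bB := bmf_indic mB; split.
    by apply/selfadjointP => f g; exact: opE_sym.
  move=> g; rewrite /specm -(mul_indic HM mB).2//; apply: opE_ext => //; first exact: bmfM.
  by move=> x _; rewrite indicE; case: (_ \in _); rewrite ?mulr1 ?mulr0.
- by move=> g; rewrite /specm indicT opE1.
- by move=> A B mA mB g; rewrite /specm indicI (mul_indic HM mB).2//; exact: bmf_indic.
move=> F mF tF g; have mU : measurable (\bigcup_k F k) by exact: bigcupT_measurable.
have bU := bmf_indic mU; have bF k := bmf_indic (mF k).
(* Norm convergence is required, but the calculus gives weak convergence. Multiplicativity bridges
   the gap: the square norm of [E (d n) g] is the form of [d n] squared, a bounded sequence tending
   to 0 pointwise. *)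
pose d n (x : R) : R := \sum_(k < n) \1_(F k) x + (-1) * \1_(\bigcup_k F k) x.
have md n : multiplicative HM (d n).
  apply: (closD (mul_closed HM)).
    by apply: (clos_sum (mul_closed HM) n (F := fun k => \1_(F k))) => k; exact: mul_indic.
  by apply: (closM (mul_closed HM)); [exact: mul_cst|exact: mul_indic].
have bs n : bmf (fun x => \sum_(k < n) \1_(F k) x).
  exact: (bmf_sum n (F := fun k => \1_(F k))).
have dE n : \sum_(k < n) specm (F k) g - specm (\bigcup_k F k) g = E (d n) g.
  rewrite opED// ?opEZ//; last exact: bmfZ.
  rewrite (opE_sum n (F := fun k => \1_(F k)))//; congr (_ + _).
  by rewrite rmorphN1 scaleN1r.
under eq_fun do rewrite dE.
apply: cvg_sqn_norm2.
have dd n : sqn (E (d n) g) = rin (E (fun x => d n x * d n x) g) g.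
  by have [bd mdn] := md n; rewrite /sqn mdn// [RHS]opE_sym.
under eq_fun do rewrite dd.
have <- : rin (E (cst 0) g) g = 0.
  rewrite (_ : cst 0 = (fun x => 0 * cst 1 x)) ?opEZ ?scale0r ?rin0l//; first exact: bmf_cst.
  by apply/funext => x; rewrite mul0r.
have cd x : d ^~ x @ \oo --> (0 : R).
  rewrite /d; under eq_fun do rewrite mulN1r.
  by apply/subr_cvg0; exact: cvg_sum_indic.
have nd n x : `|d n x| <= 2.
  apply: le_trans (ler_normD _ _) _; apply: (@lerD _ _ 1 _ 1).
    exact: normr_sum_indic.
  by rewrite mulN1r normrN indicE; case: (_ \in _); rewrite ?normr1 ?normr0.
apply: (@cvg_rin_opE _ _ HM _ _ (2 * 2)).
- by move=> n; have [[mdn _] _] := md n; exact: measurable_funM.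
- exact: measurable_cst.
- by move=> n x _; rewrite normrM ler_pM.
- by move=> x _; have := cvgM (cd x) (cd x); rewrite mulr0; apply.
Qed.

End SpectralMeasure.

(** * Integrals against the scalar spectral measures and the exponential series *)

Section SpectralIntegral.
Variable R : realType.
Local Notation T := (measurableTypeR R).
Implicit Types (f g h : ell2 R) (p q : R -> R).

Variable M : (R -> R) -> int -> int -> R.
Hypothesis HM : calculus M.
Local Notation E := (opE HM).
Local Notation mu := (pvm_measure (specm_pvm HM)).
Import HBNNSimple.

Lemma specm_muE g B : measurable B -> mu g B = (rin (E \1_B g) g)%:E.
Proof. exact: pvm_muE. Qed.

Lemma opE_cst0 g : E (cst 0) g = 0.
Proof.
rewrite (_ : cst 0 = (fun x => 0 * cst 1 x)) ?opEZ ?scale0r//; first exact: bmf_cst.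
by apply/funext => x; rewrite mul0r.
Qed.

Lemma specm_mu_support g : mu g (~` `[0, 2]) = 0%E.
Proof.
have mC : measurable (~` `[0, 2]%classic : set T) by exact: measurableC.
rewrite specm_muE// (opE_ext HM g (bmf_indic mC) (bmf_cst 0)) ?opE_cst0 ?rin0l//.
by move=> x x02; rewrite indicE memNset// => /(_ _); apply; rewrite /= in_itv.
Qed.

Lemma integral_nnsfun_specm g (s : {nnsfun T >-> R}) :
  (\int[mu g]_x (s x)%:E = (rin (E s g) g)%:E)%E.
Proof.
rewrite integralT_nnsfun sintegralE fsbig_finite//=.
set r := finmap.enum_fset _.
have sE : (s : R -> R) = fun x => \sum_(i < size r) r`_i * \1_(s @^-1` [set r`_i]) x.
  by apply/funext => x; rewrite fimfunE fsbig_finite//= (big_nth 0) big_mkord.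
have bs y : bmf (\1_(s @^-1` [set y]) : R -> R) by exact: bmf_indic.
rewrite [in RHS]sE.
rewrite (opE_sum HM (size r) (F := fun i x => r`_i * \1_(s @^-1` [set r`_i]) x)) => [|k].
  2: exact: bmfZ.
rewrite (big_nth 0) big_mkord.
transitivity ((\sum_(i < size r) rin (E (fun x => r`_i * \1_(s @^-1` [set r`_i]) x) g) g)%:E).
  rewrite -sumEFin; apply: eq_bigr => i _.
  by rewrite opEZ// rinZl pvm_muE//; exact: specm_pvm.
congr EFin; elim: (size r) => [|n IH]; first by rewrite !big_ord0 rin0l.
by rewrite !big_ord_recr/= rinDl IH.
Qed.

Lemma ge0_integral_specm g p : bmf p -> (forall x, 0 <= p x) ->
  (forall x, ~ 0 <= x <= 2 -> p x = 0) ->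
  (\int[mu g]_x (p x)%:E = (rin (E p g) g)%:E)%E.
Proof.
move=> bp p0 pout; have [mp _] := bp.
have mEp : measurable_fun setT (EFin \o p : T -> \bar R) by exact/measurable_EFinP.
pose s := nnsfun_approx measurableT mEp.
have p0E x : setT x -> (0 <= (EFin \o p) x)%E by rewrite lee_fin.
have sp x : (fun n => (s n x)%:E) @ \oo --> (p x)%:E by exact: cvg_nnsfun_approx.
have nds x : nondecreasing_seq (fun n => s n x).
  by move=> m n mn; exact/lefP/nd_nnsfun_approx.
have spr x : (fun n => s n x) @ \oo --> p x by have /fine_cvgP[] := sp x.
have sle n x : s n x <= p x.
  have := nondecreasing_cvgn_le (nds x) (cvgP _ (spr x)) n.
  by rewrite (cvg_lim _ (spr x)).
have c1 : (fun n => \int[mu g]_x (s n x)%:E)%E @ \oo --> (\int[mu g]_x (p x)%:E)%E.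
  have -> : (\int[mu g]_x (p x)%:E = \int[mu g]_x (limn (fun n => (s n x)%:E)))%E.
    by apply: eq_integral => x _; rewrite (cvg_lim _ (sp x)).
  apply: cvg_monotone_convergence => //.
  - by move=> n; apply/measurable_EFinP.
  - by move=> n x _; rewrite lee_fin.
  - by move=> x _ m n mn; rewrite lee_fin; exact: nds.
have [C C0 pC] := bmf_bound bp.
have c2 : (fun n => (rin (E (s n) g) g)%:E) @ \oo --> (rin (E p g) g)%:E.
  apply/fine_cvgP; split; first exact: nearW.
  apply: (@cvg_rin_opE _ _ HM _ _ C) => //.
  - by move=> k; have mk : measurable_fun (setT : set T) (s k) by [].
  - move=> n x x02; rewrite ger0_norm//; apply: le_trans (sle n x) _.
    by apply: le_trans (pC x x02); exact: ler_norm.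
rewrite -(cvg_lim _ c1)//; under eq_fun do rewrite integral_nnsfun_specm.
exact: cvg_lim c2.
Qed.

Lemma spectral_integral_opE g p : bmf p -> (forall x, 0 <= x <= 2 -> 0 <= p x) ->
  (mu g).-integrable setT (EFin \o p) /\ \int[mu g]_x p x = rin (E p g) g.
Proof.
move=> bp p0; have [mp _] := bp.
have mI : measurable (`[0, 2]%classic : set T) by [].
(* Monotone approximation by simple functions needs a function that is nonnegative everywhere. Since
   [mu g] does not charge the complement of [0, 2], p may be cut off there. *)
pose q x := p x * \1_(`[0, 2]%classic : set T) x.
have I1 x : 0 <= x <= 2 -> \1_(`[0, 2]%classic : set T) x = 1 :> R.
  by move=> x02; rewrite indicE mem_set//= in_itv.
have I0 x : ~ 0 <= x <= 2 -> \1_(`[0, 2]%classic : set T) x = 0 :> R.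
  by move=> x02; rewrite indicE memNset//= in_itv.
have qp x : 0 <= x <= 2 -> q x = p x by move=> x02; rewrite /q I1// mulr1.
have bq : bmf q by apply: bmfM => //; exact: bmf_indic.
have q0 x : 0 <= q x.
  have [x02|x02] := pselect (0 <= x <= 2); first by rewrite qp// p0.
  by rewrite /q I0// mulr0.
have qout x : ~ 0 <= x <= 2 -> q x = 0 by move=> x02; rewrite /q I0// mulr0.
have iq := ge0_integral_specm g bq q0 qout.
have [mq _] := bq.
have mN : measurable (~` `[0, 2] : set T) by exact: measurableC.
have TN : setT `\` ~` (`[0, 2]%classic : set T) = `[0, 2]%classic by rewrite setTD setCK.
have pq : {in (`[0, 2]%classic : set T), EFin \o q =1 EFin \o p}.
  by move=> x; rewrite inE /= in_itv/= => x02; rewrite qp.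
have intq : (mu g).-integrable setT (EFin \o q).
  apply/integrableP; split; first exact/measurable_EFinP.
  under eq_integral do rewrite /= ger0_norm//.
  by rewrite iq ltry.
have intp : (mu g).-integrable setT (EFin \o p).
  apply/(negligible_integrable mN) => //; first exact/measurable_EFinP.
    exact: specm_mu_support.
  rewrite TN; apply: (eq_integrable _ _ _ pq) => //.
  by apply: integrableS intq.
split => //; rewrite /Rintegral.
have -> : (\int[mu g]_x (p x)%:E = \int[mu g]_x (q x)%:E)%E.
  rewrite (negligible_integral mN measurableT intp (specm_mu_support g)).
  rewrite (negligible_integral mN measurableT intq (specm_mu_support g)) TN.
  by apply: eq_integral => x xI; rewrite -pq.
rewrite iq /=.
by rewrite (opE_ext HM g bq bp qp).
Qed.

Lemma specm_spectral_integral p (L : {linear ell2 R -> ell2 R}) : bmf p ->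
  (forall x, 0 <= x <= 2 -> 0 <= p x) -> (forall g, L g = E p g) ->
  is_spectral_integral (specm HM) p L.
Proof.
move=> bp p0 LE g; exists (mu g); have [ip ep] := spectral_integral_opE g bp p0.
split => // [B mB|]; first by rewrite Re_inner specm_muE.
rewrite inner_sym => [|f h]; last by rewrite !LE opE_sym.
by rewrite LE -ep.
Qed.

Lemma specm_is_spectral_measure : is_spectral_measure (specm HM) (@Lpr R).
Proof.
split; first exact: specm_pvm.
apply: specm_spectral_integral; [exact: bmf_id|by move=> x /andP[]|].
by move=> g; rewrite opE_id.
Qed.

Lemma iter_Lpr (t : R) k g :
  iter k (fun f => (- t)%:C *: Lpr f) g = E (fun x => (- t * x) ^+ k) g.
Proof.
have bt : bmf (fun x : R => - t * x) by apply: bmfZ; exact: bmf_id.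
elim: k => [|k IH].
  by rewrite (_ : (fun x : R => _) = cst 1) ?opE1//; apply/funext => x; rewrite expr0.
have btk : bmf (fun x : R => (- t * x) ^+ k) by exact: bmfX.
rewrite iterS IH Lpr_opE// -opEZ//; last by apply: bmfM => //; exact: bmf_id.
by congr (E _ g); apply/funext => x; rewrite exprS mulrA.
Qed.

Lemma cvg_expR_sum (x : R) :
  (fun n => \sum_(k < n) (k`!%:R)^-1 * x ^+ k) @ \oo --> expR x.
Proof.
rewrite (_ : (fun n => _) = series (exp_coeff x)); first exact: is_cvg_series_exp_coeff.
apply/funext => m; rewrite /series/= big_mkord; apply: eq_bigr => k _.
by rewrite /exp_coeff/= mulrC.
Qed.

(** The tail at x is dominated term by term by the tail at Y. With Y = 2 t this is uniform for
    spectral values in [0, 2], hence gives convergence in operator norm. *)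
Lemma expR_series_bound (x Y : R) n : `|x| <= Y ->
  `|\sum_(k < n) (k`!%:R)^-1 * x ^+ k - expR x|
    <= expR Y - \sum_(k < n) (k`!%:R)^-1 * Y ^+ k.
Proof.
move=> xY; pose S (z : R) m := \sum_(k < m) (k`!%:R)^-1 * z ^+ k.
have cS z : S z @ \oo --> expR z by exact: cvg_expR_sum.
have c1 : (fun m => `|S x n - S x m|) @ \oo --> `|S x n - expR x|.
  by apply: cvg_norm; apply: cvgB; [exact: cvg_cst|exact: cS].
have c2 : (fun m => S Y m - S Y n) @ \oo --> expR Y - S Y n.
  by apply: cvgB; [exact: cS|exact: cvg_cst].
apply: (ler_cvg_to c1 c2); near=> m.
have nm : (n <= m)%N by near: m; exact: nbhs_infty_ge.
rewrite distrC /S -(subnKC nm) !big_split_ord/= ![_ + _ - _]addrAC !subrr !add0r.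
apply: le_trans (ler_norm_sum _ _ _) _; apply: ler_sum => k _.
rewrite normrM normrX ger0_norm ?invr_ge0// ler_wpM2l ?invr_ge0//.
by rewrite lerXn2r ?nnegrE// (le_trans _ xY).
Unshelve. all: by end_near. Qed.

Lemma opE_exponential (t : R) : 0 <= t ->
  is_exponential (fun g => (- t)%:C *: Lpr g) (E (fun x => expR (- t * x))).
Proof.
move=> t0 e e0.
have bt := bmf_expR t0.
have bX k : bmf (fun x : R => (- t * x) ^+ k).
  by apply: bmfX; apply: bmfZ; exact: bmf_id.
have btk k : bmf (fun x : R => (k`!%:R)^-1 * (- t * x) ^+ k) by exact: bmfZ.
pose s n (x : R) : R := \sum_(k < n) (k`!%:R)^-1 * (- t * x) ^+ k.
have bs n : bmf (s n) by exact: (bmf_sum n btk).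
have sE n g : \sum_(k < n) ((k`!%:R)^-1 : R[i]) *: iter k (fun g => (- t)%:C *: Lpr g) g
    = E (s n) g.
  rewrite (opE_sum HM n (F := fun k x => (k`!%:R)^-1 * (- t * x) ^+ k))//.
  apply: eq_bigr => k _; rewrite iter_Lpr opEZ//; congr (_ *: _).
  by rewrite fmorphV/= rmorph_nat.
have /cvgrPdist_le/(_ _ e0) := @cvg_expR_sum (t * 2); apply: filterS => n eY g.
rewrite sE.
have -> : E (s n) g - E (fun x => expR (- t * x)) g =
    E (fun x => s n x + -1 * expR (- t * x)) g.
  rewrite opED ?opEZ//; last exact: bmfZ.
  by rewrite rmorphN1 scaleN1r.
apply: norm2_opE => //; first by apply: bmfD => //; exact: bmfZ.
move=> x /andP[x0 x2]; rewrite mulN1r.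
apply: le_trans (@expR_series_bound _ (t * 2) n _) _.
  by rewrite normrM normrN !ger0_norm// ler_wpM2l.
by apply: le_trans eY; exact: ler_norm.
Qed.

End SpectralIntegral.

(** * Uniqueness of the spectral measure *)

Section SpectralUniqueness.
Variable R : realType.
Local Notation T := (measurableTypeR R).
Implicit Types (f g h : ell2 R).

Section OneMeasure.
Variables (E : set T -> {linear ell2 R -> ell2 R}) (L : {linear ell2 R -> ell2 R}).
Hypothesis EL : is_spectral_measure E L.
Let HE : projection_valued_measure E. Proof. by case: EL. Qed.

Lemma spectral_integralP g : exists mu : {measure set T -> \bar R},
  [/\ forall B, measurable B -> mu B = (rin (E B g) g)%:E,
      mu.-integrable setT (EFin \o (fun l : R => l))
    & rin (L g) g = \int[mu]_(l in setT) l].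
Proof.
have [_ /(_ g)[mu [muE mui muL]]] := EL; exists mu; split => //.
  by move=> B mB; rewrite muE// Re_inner.
by rewrite -Re_inner muL.
Qed.

Lemma spectral_upper (l : R) g : E `]l, +oo[%classic g = 0 -> rin (L g) g <= l * sqn g.
Proof.
move=> g0; have [mu [muE mui ->]] := spectral_integralP g.
have mN : measurable (`]l, +oo[%classic : set T) by [].
have muN : mu `]l, +oo[%classic = 0%E by rewrite muE// g0 rin0l.
have TN : setT `\` (`]l, +oo[%classic : set T) = `]-oo, l]%classic.
  by rewrite setTD setCitvr.
have muD : mu `]-oo, l]%classic = (sqn g)%:E.
  by rewrite -setCitvr muE ?(pvmC HE)// ?g0 ?subr0//; exact: measurableC.
rewrite /Rintegral (negligible_integral mN measurableT mui muN) TN.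
have ci : mu.-integrable `]-oo, l]%classic (EFin \o cst l).
  apply/integrableP; split; first exact/measurable_EFinP.
  under eq_integral do rewrite /=.
  by rewrite integral_cst// muD -EFinM ltry.
have mi : mu.-integrable `]-oo, l]%classic (EFin \o (fun l : R => l)).
  by apply: integrableS mui.
have -> : l * sqn g = \int[mu]_(x in `]-oo, l]%classic) (cst l x).
  by rewrite Rintegral_cst// muD.
by apply: le_Rintegral => // x; rewrite /= in_itv.
Qed.

(** The scalar measure of g lives on []l, +oo[], where the function x - l is strictly positive; if
    its integral is at most 0, that measure vanishes, and its mass is [sqn g]. *)
Lemma spectral_lower (l : R) g : E `]-oo, l]%classic g = 0 ->
  rin (L g) g <= l * sqn g -> g = 0.
Proof.
move=> g0; have [mu [muE mui ->]] := spectral_integralP g.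
have mN : measurable (`]-oo, l]%classic : set T) by [].
have mD : measurable (`]l, +oo[%classic : set T) by [].
have muN : mu `]-oo, l]%classic = 0%E by rewrite muE// g0 rin0l.
have TN : setT `\` (`]-oo, l]%classic : set T) = `]l, +oo[%classic.
  by rewrite setTD setCitvl.
have muD : mu `]l, +oo[%classic = (sqn g)%:E.
  by rewrite -setCitvl muE ?(pvmC HE)// ?g0 ?subr0//; exact: measurableC.
rewrite /Rintegral (negligible_integral mN measurableT mui muN) TN => le_int.
have ci : mu.-integrable `]l, +oo[%classic (EFin \o cst l).
  apply/integrableP; split; first exact/measurable_EFinP.
  under eq_integral do rewrite /=.
  by rewrite integral_cst// muD -EFinM ltry.
have mi : mu.-integrable `]l, +oo[%classic (EFin \o (fun l : R => l)).
  by apply: integrableS mui.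
have di := integrableB mD mi ci.
have d0 x : `]l, +oo[%classic x -> 0 <= x - l :> R.
  by rewrite /= in_itv/= andbT => lx; rewrite subr_ge0 ltW.
pose F : T -> \bar R := fun x => (x - l)%:E.
have int0 : (\int[mu]_(x in `]l, +oo[%classic) `|F x| = 0)%E.
  apply/eqP; rewrite eq_le; apply/andP; split; last exact: integral_ge0.
  rewrite (eq_integral F); last first.
    by move=> x; rewrite inE => /d0 x0; rewrite /F/= ger0_norm.
  have e := RintegralB mD mi ci; rewrite Rintegral_cst// muD/= in e.
  rewrite -[leLHS]fineK; last first.
    by apply: integrable_fin_num => //; exact: di.
  by rewrite lee_fin; move: e; rewrite /Rintegral/= => ->; rewrite subr_le0.
have mF : measurable_fun `]l, +oo[%classic F.
  apply/measurable_EFinP; apply: measurable_funB; first exact: measurable_id.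
  exact: measurable_cst.
have [/(_ int0) ae0 _] := ae_eq_integral_abs mu mD mF.
have : mu.-negligible `]l, +oo[%classic.
  apply: negligibleS ae0 => x lx /= /(_ lx) [] /eqP; rewrite subr_eq0 => /eqP xl.
  by move: lx; rewrite /= in_itv/= xl ltxx.
move=> /(negligibleP mu mD) mu0.
have [s0] : (sqn g)%:E = 0%E by rewrite -muD; exact: mu0.
by apply: sqn_eq0; rewrite s0.
Qed.

(* The scalar measure of the sum of E A f and h - E A h is the sum of their scalar
   measures, so the cross terms of the quadratic form of L vanish. *)
Lemma spectral_cross A f h : measurable A -> (forall f h, rin (L f) h = rin f (L h)) ->
  rin (L (E A f)) (h - E A h) = 0.
Proof.
move=> mA Lsym; set f' := E A f; set h' := h - E A h.
have Ef : E A f' = f' by exact: pvm_idem.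
have Eh : E A h' = 0 by rewrite /h' linearB/= pvm_idem// subrr.
clearbody f' h'.
have [m1 [m1E i1 e1]] := spectral_integralP f'.
have [m2 [m2E i2 e2]] := spectral_integralP h'.
have [m3 [m3E i3 e3]] := spectral_integralP (f' + h').
have cross B : measurable B -> rin (E B f') h' = 0.
  move=> mB; rewrite -Ef -(pvmI HE)// setIC (pvmI HE)// (pvm_sym HE)// Eh.
  by rewrite rinC rin0l.
have m3D B : measurable B -> B `<=` setT -> m3 B = measure_add m1 m2 B.
  move=> mB _; rewrite measure_addE m1E// m2E// m3E// -EFinD; congr EFin.
  rewrite linearD/= !(rinDl, rinDr) cross// (pvm_sym HE h')// (rinC h') cross//.
  by rewrite addr0 add0r.
have e : rin (L (f' + h')) (f' + h') = rin (L f') f' + rin (L h') h'.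
  rewrite e1 e2 e3 /Rintegral (eq_measure_integral _ m3D).
  rewrite integral_measure_add// fineD//; exact: integrable_fin_num.
move: e; rewrite linearD/= !(rinDl, rinDr) (Lsym h') (rinC h'); lra.
Qed.

(** By [spectral_cross], L E(A) = E(A) L E(A). The right-hand side is symmetric, so L E(A) equals
    its adjoint E(A) L. *)
Lemma spectral_comm A f : measurable A -> (forall f h, rin (L f) h = rin f (L h)) ->
  L (E A f) = E A (L f).
Proof.
move=> mA Lsym.
have red g h : rin (L (E A g)) h = rin (L (E A g)) (E A h).
  by have := spectral_cross g h mA Lsym; rewrite rinBr => /subr0_eq.
apply: rin_eq => h; rewrite red [RHS](pvm_sym HE)// [RHS]Lsym [RHS]rinC [RHS]red.
by rewrite [RHS]rinC -[RHS]Lsym.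
Qed.

End OneMeasure.

Variables (E E' : set T -> {linear ell2 R -> ell2 R}) (L : {linear ell2 R -> ell2 R}).
Hypotheses (EL : is_spectral_measure E L) (EL' : is_spectral_measure E' L).
Hypothesis comm : forall A B f, measurable A -> measurable B ->
  E A (E' B f) = E' B (E A f).

(** Both mixed products of a ray projection with the opposite complementary one vanish, so each ray
    projection P, P' absorbs the other: P = P P' and P' = P' P. Commutation then gives P = P'. *)
Lemma spectral_measure_eq : pvm_eq E' E.
Proof.
have [HE _] := EL; have [HE' _] := EL'.
apply: pvm_eq_rays => // l f.
have mA : measurable (`]-oo, l]%classic : set T) by [].
have mB : measurable (`]l, +oo[%classic : set T) by [].
have cap : `]-oo, l]%classic `&` `]l, +oo[%classic = set0 :> set T.
  by rewrite -setCitvl setICr.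
have z1 g : E `]-oo, l]%classic (E' `]l, +oo[%classic g) = 0.
  apply: (spectral_lower EL' (l := l)).
    by rewrite -comm// -(pvmI HE')// cap (pvm0 HE') linear0.
  apply: (spectral_upper EL).
  by rewrite -(pvmI HE)// setIC cap (pvm0 HE).
have z2 g : E' `]-oo, l]%classic (E `]l, +oo[%classic g) = 0.
  apply: (spectral_lower EL (l := l)).
    by rewrite comm// -(pvmI HE)// cap (pvm0 HE) linear0.
  apply: (spectral_upper EL').
  by rewrite -(pvmI HE')// setIC cap (pvm0 HE').
have e1 : E `]-oo, l]%classic f = E `]-oo, l]%classic (E' `]-oo, l]%classic f).
  apply/eqP; rewrite -subr_eq0 -linearB/=; apply/eqP.
  by rewrite -(z1 f) -setCitvl (pvmC HE').
have e2 : E' `]-oo, l]%classic f = E' `]-oo, l]%classic (E `]-oo, l]%classic f).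
  apply/eqP; rewrite -subr_eq0 -linearB/=; apply/eqP.
  by rewrite -(z2 f) -setCitvl (pvmC HE).
by rewrite e2 -comm// -e1.
Qed.

End SpectralUniqueness.

Section CommutingCalculus.
Variable R : realType.
Local Notation T := (measurableTypeR R).
Variable M : (R -> R) -> int -> int -> R.
Hypothesis HM : calculus M.
Local Notation E := (opE HM).
Variable P : {linear ell2 R -> ell2 R}.
Hypothesis Psym : forall f h, rin (P f) h = rin f (P h).
Hypothesis PL : forall f, Lpr (P f) = P (Lpr f).

(** Multiplicativity is bundled in because the product case has to split the operator of a
    product. *)
Definition commuting q := multiplicative HM q /\ forall f, E q (P f) = P (E q f).

Lemma comm_closed : calculus_closed commuting.
Proof.
have mc := mul_closed HM.
split.
- move=> q q' bq' qq' [mq cq]; split; first exact: (clos_ext mc bq' qq').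
  by move=> f; have [bq _] := mq; rewrite -!(opE_ext HM _ bq bq' qq').
- move=> c; split=> [|f]; first exact: mul_cst.
  have cE h : E (cst c) h = c%:C *: h.
    rewrite -[in RHS](opE1 HM h) -opEZ; last exact: bmf_cst.
    apply: opE_ext; [exact: bmf_cst|apply: bmfZ; exact: bmf_cst|].
    by move=> x _; rewrite mulr1.
  by rewrite !cE linearZ.
- by split=> [|f]; [exact: mul_id|rewrite !opE_id].
- move=> q r [mq cq] [mr cr]; split=> [|f]; first exact: (closD mc).
  by have [[bq _] [br _]] := (mq, mr); rewrite !opED// cq cr linearD.
- move=> q r [mq cq] [mr cr]; split=> [|f]; first exact: (closM mc).
  by have [[bq _] [br hr]] := (mq, mr); rewrite !hr// cr cq.
- move=> qs q C cqs mq qsC qsq; split=> [|f].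
    by apply: (clos_lim mc _ mq qsC qsq) => k; case: (cqs k).
  have mqs k : measurable_fun setT (qs k) by case: (cqs k) => -[[]].
  apply: rin_eq => h; rewrite Psym.
  apply: (cvgn_eq (@cvg_rin_opE _ _ HM qs q C (P f) h mqs mq qsC qsq)
    (@cvg_rin_opE _ _ HM qs q C f (P h) mqs mq qsC qsq)) => k.
  by case: (cqs k) => _ ->; rewrite Psym.
Qed.

Lemma comm_indic (B : set T) f : measurable B -> E \1_B (P f) = P (E \1_B f).
Proof. by move=> mB; case: (closed_indic comm_closed mB). Qed.

End CommutingCalculus.

Lemma specm_uniq (R : realType) (M : (R -> R) -> int -> int -> R) (HM : calculus M) nu :
  is_spectral_measure nu (@Lpr R) -> pvm_eq nu (specm HM).
Proof.
move=> nuL; have [Hnu _] := nuL.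
apply: (spectral_measure_eq (specm_is_spectral_measure HM) nuL) => A B f mA mB.
apply: comm_indic => //; first by move=> g h; exact: pvm_sym.
by move=> g; apply: spectral_comm => // ? ?; exact: (Lpr_sym HM).
Qed.

(** * Kernels built from eigenfunctions *)

Section IntegralKernel.
Variable R : realType.
Local Notation leb := (@lebesgue_measure R).
Local Notation D := (`[0, pi]%classic : set R).
Implicit Types (f g : R -> R).

Definition bmd f : Prop := measurable_fun setT f /\
  exists C : R, forall x, 0 <= x <= pi -> `|f x| <= C.

Lemma bmdM f g : bmd f -> bmd g -> bmd (fun x => f x * g x).
Proof.
move=> [mf [C fC]] [mg [C' gC]]; split; first exact: measurable_funM.
by exists (C * C') => x x0; rewrite normrM ler_pM ?fC ?gC.
Qed.

Lemma bmdD f g : bmd f -> bmd g -> bmd (fun x => f x + g x).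
Proof.
move=> [mf [C fC]] [mg [C' gC]]; split; first exact: measurable_funD.
by exists (C + C') => x x0; apply: le_trans (ler_normD _ _) _; rewrite lerD ?fC ?gC.
Qed.

Lemma bmd_cst (c : R) : bmd (cst c).
Proof. by split; [exact: measurable_cst|exists `|c|]. Qed.

Lemma bmd_sum (I : Type) (r : seq I) (F : I -> R -> R) : (forall i, bmd (F i)) ->
  bmd (fun x => \sum_(i <- r) F i x).
Proof.
move=> bF; elim: r => [|i r IH].
  rewrite (_ : (fun x => _) = cst 0); first exact: bmd_cst.
  by apply/funext => x; rewrite big_nil.
rewrite (_ : (fun x => _) = (fun x => F i x + \sum_(i <- r) F i x)); first exact: bmdD.
by apply/funext => x; rewrite big_cons.
Qed.

Lemma continuous_bmd f : continuous f -> bmd f.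
Proof.
move=> cf; split; first exact: continuous_measurable_fun.
have /compact_bounded[C [_ fC]] : compact (f @` D).
  by apply: continuous_compact; [exact: continuous_subspaceT|exact: segment_compact].
exists (`|C| + 1) => x x0; apply: fC; first by rewrite ltr_pwDr// ler_norm.
by exists x => //; rewrite /= in_itv.
Qed.

Lemma lebesgue_D : leb D = pi%:E.
Proof. by rewrite lebesgue_measure_itv/= lte_fin pi_gt0 oppr0 adde0. Qed.

Lemma bmd_integrable f : bmd f -> leb.-integrable D (EFin \o f).
Proof.
move=> [mf [C fC]].
have Dfin : (leb D < +oo)%E by rewrite lebesgue_D ltry.
apply: measurable_bounded_integrable => //.
- exact: measurable_funTS.
- exists C; split; first exact: num_real.
  move=> M CM x; rewrite /= in_itv/= => x0; exact: le_trans (fC x x0) (ltW CM).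
Qed.

Lemma integralD_bmd f g : bmd f -> bmd g ->
  \int[leb]_(x in D) (f x + g x) = \int[leb]_(x in D) f x + \int[leb]_(x in D) g x.
Proof. by move=> bf bg; rewrite RintegralD//; exact: bmd_integrable. Qed.

Lemma integralZ_bmd (c : R) f : bmd f ->
  \int[leb]_(x in D) (c * f x) = c * \int[leb]_(x in D) f x.
Proof. by move=> bf; rewrite RintegralZl//; exact: bmd_integrable. Qed.

Lemma integral_cst_bmd (c : R) : \int[leb]_(x in D) c = c * pi.
Proof.
transitivity (c * fine (leb D)); last by rewrite lebesgue_D.
exact: Rintegral_cst.
Qed.

Lemma integral_sum_bmd (I : Type) (r : seq I) (F : I -> R -> R) :
  (forall i, bmd (F i)) ->
  \int[leb]_(x in D) (\sum_(i <- r) F i x) = \sum_(i <- r) \int[leb]_(x in D) F i x.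
Proof.
move=> bF; elim: r => [|i r IH].
  rewrite big_nil (@eq_Rintegral _ _ _ _ _ (cst 0)) => [|x _]; last by rewrite big_nil.
  by rewrite integral_cst_bmd mul0r.
rewrite big_cons -IH -integralD_bmd//; last exact: bmd_sum.
by apply: eq_Rintegral => x _; rewrite big_cons.
Qed.

Lemma bounded_integral_cvg (fs : (R -> R)^nat) f (C : R) :
  (forall k, measurable_fun setT (fs k)) -> bmd f ->
  (forall k x, 0 <= x <= pi -> `|fs k x| <= C) ->
  (forall x, 0 <= x <= pi -> fs ^~ x @ \oo --> f x) ->
  (fun k => \int[leb]_(x in D) fs k x) @ \oo --> \int[leb]_(x in D) f x.
Proof.
move=> mfs bf fsC fsf.
have D0 x : D x -> 0 <= x <= pi by rewrite /= in_itv.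
have bC : leb.-integrable D (cst C%:E) by exact: (bmd_integrable (bmd_cst C)).
have h : ((fun k => \int[leb]_(x in D) (fs k x)%:E) @ \oo -->
    \int[leb]_(x in D) (f x)%:E)%E.
  apply: (@dominated_cvg _ _ _ leb D _ (fun k => EFin \o fs k) (EFin \o f) (cst C%:E)) => //.
  - by move=> k; apply/measurable_EFinP; exact: measurable_funTS (mfs k).
  - by move=> x /D0 x0; apply/fine_cvgP; split; [exact: nearW|exact: fsf].
have fE : (\int[leb]_(x in D) (f x)%:E = (\int[leb]_(x in D) f x)%:E)%E.
  by rewrite /Rintegral fineK//; apply: integrable_fin_num => //; exact: bmd_integrable.
by move: h; rewrite fE => /fine_cvgP[].
Qed.

Variables (I : finType) (lam : I -> R -> R) (F : I -> int -> R -> R) (w : I -> R -> R).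
Hypotheses (mlam : forall i, measurable_fun setT (lam i))
  (lam02 : forall i x, 0 <= lam i x <= 2)
  (bF : forall i m, bmd (F i m)) (bw : forall i, bmd (w i)) (w0 : forall i x, 0 <= w i x).

Definition spec_kernel (p : R -> R) (m n : int) : R :=
  \int[leb]_(x in D) (\sum_(i : I) p (lam i x) * (F i m x * F i n x * w i x)).

Lemma bmd_comp_lam p i : bmf p -> bmd (fun x => p (lam i x)).
Proof.
move=> [mp [C pC]]; split; first exact: measurableT_comp.
by exists C => x _; exact: pC.
Qed.

Lemma bmd_FFw i m n : bmd (fun x => F i m x * F i n x * w i x).
Proof. by apply: bmdM => //; exact: bmdM. Qed.

Lemma bmd_spec p m n i : bmf p -> bmd (fun x => p (lam i x) * (F i m x * F i n x * w i x)).
Proof. by move=> bp; apply: bmdM; [exact: bmd_comp_lam|exact: bmd_FFw]. Qed.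

Lemma spec_kernelD p q m n : bmf p -> bmf q ->
  spec_kernel (fun x => p x + q x) m n = spec_kernel p m n + spec_kernel q m n.
Proof.
move=> bp bq; rewrite /spec_kernel -integralD_bmd; [|by apply: bmd_sum => i; exact: bmd_spec..].
by apply: eq_Rintegral => x _; rewrite -big_split; apply: eq_bigr => i _; rewrite mulrDl.
Qed.

Lemma spec_kernelZ (c : R) p m n : bmf p ->
  spec_kernel (fun x => c * p x) m n = c * spec_kernel p m n.
Proof.
move=> bp; rewrite /spec_kernel -integralZ_bmd; last by apply: bmd_sum => i; exact: bmd_spec.
by apply: eq_Rintegral => x _; rewrite mulr_sumr; apply: eq_bigr => i _; rewrite -mulrA.
Qed.

Lemma spec_kernelC p m n : spec_kernel p m n = spec_kernel p n m.
Proof.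
by apply: eq_Rintegral => x _; apply: eq_bigr => i _; rewrite (mulrC (F i m x)).
Qed.

(** Under the integral sign the form is a combination of squares of the sums of [g m * F i m x],
    with nonnegative coefficients p (lam) w. *)
Lemma spec_kernel_ge0 p : bmf p -> (forall x, 0 <= x <= 2 -> 0 <= p x) ->
  forall N (g : int -> R), 0 <= kform (spec_kernel p) N g.
Proof.
move=> bp p0 N g.
pose G i m n x := (g m * g n) * (p (lam i x) * (F i m x * F i n x * w i x)).
have bG i m n : bmd (G i m n) by apply: bmdM; [exact: bmd_cst|exact: bmd_spec].
have -> : kform (spec_kernel p) N g = \int[leb]_(x in D)
    (\sum_(m <- win N) \sum_(n <- win N) \sum_(i : I) G i m n x).
  rewrite integral_sum_bmd => [|m]; last by do 2!apply: bmd_sum => ?; exact: bG.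
  apply: eq_bigr => m _; rewrite integral_sum_bmd => [|n]; last by apply: bmd_sum => ?; exact: bG.
  apply: eq_bigr => n _; rewrite mulrC /spec_kernel -integralZ_bmd; last first.
    by apply: bmd_sum => i; exact: bmd_spec.
  by apply: eq_Rintegral => x _; rewrite mulr_sumr.
apply: Rintegral_ge0 => x _.
have -> : \sum_(m <- win N) \sum_(n <- win N) \sum_(i : I) G i m n x =
    \sum_(i : I) p (lam i x) * w i x * (\sum_(m <- win N) g m * F i m x) ^+ 2.
  under eq_bigr do rewrite exchange_big/=.
  rewrite exchange_big/=; apply: eq_bigr => i _.
  rewrite expr2 mulr_suml mulr_sumr; apply: eq_bigr => m _.
  by rewrite !mulr_sumr; apply: eq_bigr => n _; rewrite /G; ring.
by apply: sumr_ge0 => i _; rewrite mulr_ge0 ?sqr_ge0// mulr_ge0// p0.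
Qed.

Lemma spec_kernel_cvg (ps : (R -> R)^nat) (p : R -> R) (C : R) :
  (forall k, measurable_fun setT (ps k)) ->
  measurable_fun setT p -> (forall k x, 0 <= x <= 2 -> `|ps k x| <= C) ->
  (forall x, 0 <= x <= 2 -> ps ^~ x @ \oo --> p x) ->
  forall m n, (fun k => spec_kernel (ps k) m n) @ \oo --> spec_kernel p m n.
Proof.
move=> mps mp psC psp m n.
have [A AC] : exists A : R, forall i x, 0 <= x <= pi -> `|F i m x * F i n x * w i x| <= A.
  have h i := cid (bmd_FFw i m n).2.
  exists (\sum_i `|projT1 (h i)|) => i x x0.
  rewrite (bigD1 i)//=; apply: ler_wpDr; first by apply: sumr_ge0.
  by apply: le_trans (ler_norm _); exact: (projT2 (h i)).
have bps k : bmf (ps k) by split => //; exists C => x; exact: psC.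
apply: (@bounded_integral_cvg _ _ (\sum_(i : I) C * A)).
- by move=> k; have [] : bmd (fun x => \sum_(i : I) ps k (lam i x) * (F i m x * F i n x * w i x))
    by apply: bmd_sum => i; exact: bmd_spec.
- apply: bmd_sum => i; apply: bmd_spec; split=> //; exists C => x x02.
  by apply: (cvgr_to_le (cvg_norm (psp x x02))); apply: nearW => k; exact: psC.
- move=> k x x0; apply: le_trans (ler_norm_sum _ _ _) _; apply: ler_sum => i _.
  by rewrite normrM ler_pM// ?psC// AC.
- move=> x x0; apply: cvg_sumr => i; apply: cvgMr_tmp; exact: psp.
Qed.

Hypothesis FL : forall i x m,
  Lpr_fun (fun k => (F i k x)%:C) m = (lam i x * F i m x)%:C.

Lemma spec_kernelL p m n : bmf p ->
  Lpr_fun (fun k => (spec_kernel p k n)%:C) m = (spec_kernel (fun x => x * p x) m n)%:C.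
Proof.
move=> bp; have [a [b [c [_ _ _ LE]]]] := @Lpr_fun_coef R.
have FE i x : lam i x * F i m x = a m * F i m x + b m * F i (m - 1) x + c m * F i (m + 1) x.
  by have := FL i x m; rewrite LE => /(congr1 (@complex.Re R))/= <-; ring.
rewrite LE -!rmorphM -!rmorphD/=; congr (_%:C).
pose S k x := \sum_(i : I) p (lam i x) * (F i k x * F i n x * w i x).
have bS k : bmd (S k) by apply: bmd_sum => i; exact: bmd_spec.
have bZ (d : R) k : bmd (fun x => d * S k x) by apply: bmdM => //; exact: bmd_cst.
transitivity (\int[leb]_(x in D) (a m * S m x + b m * S (m - 1) x + c m * S (m + 1) x)).
  rewrite integralD_bmd//; last exact: bmdD.
  by rewrite integralD_bmd// !integralZ_bmd.
apply: eq_Rintegral => x _; rewrite /S !mulr_sumr -!big_split; apply: eq_bigr => i _ /=.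
rewrite (_ : lam i x * p (lam i x) * _ = p (lam i x) * (lam i x * F i m x * F i n x * w i x)).
  by rewrite FE; ring.
by ring.
Qed.

Lemma spec_calculus : (forall m n, spec_kernel (cst 1) m n = (m == n)%:R) ->
  calculus spec_kernel.
Proof.
move=> K1; split=> //.
- by move=> p q bp bq m n; exact: spec_kernelD.
- by move=> c p bp m n; exact: spec_kernelZ.
- by move=> p m n; exact: spec_kernelC.
- by move=> p bp p0 N g; exact: spec_kernel_ge0.
- by move=> p bp m n; exact: spec_kernelL.
- by move=> ps p C mps mp psC psp m n; exact: spec_kernel_cvg mps mp psC psp m n.
Qed.

End IntegralKernel.

(** * Eigenfunction equations on the half-line *)

Section Eigenfunctions.
Variable R : realType.
Implicit Types (x e mu : R) (b : bool).
Local Notation s2 := (Num.sqrt 2 : R).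

Lemma sqr_s2 : s2 ^+ 2 = 2. Proof. by rewrite sqr_sqrtr. Qed.
Lemma s2_gt0 : 0 < s2. Proof. by rewrite sqrtr_gt0. Qed.
(** The upper bound 3/2 puts the square of [Rx x] between 1/16 and 49/16, both perfect squares. So
    [Rx x] lies in [1/4, 7/4] and the values 7/8 - R/2, 7/8 + R/2 in [0, 7/4], inside the interval
    [0, 2] of the calculus. *)
Lemma s2_bounds : 7 / 5 <= s2 <= 3 / 2.
Proof.
have := sqr_s2; have := s2_gt0; set s := s2 => s0 ss.
apply/andP; split; rewrite -(@ler_pXn2r _ 2) ?nnegrE//; lra.
Qed.

Lemma inv_s2 : s2^-1 = s2 / 2.
Proof.
have n0 : s2 != 0 by rewrite gt_eqF// s2_gt0.
by apply: (mulfI n0); rewrite divff// mulrA -expr2 sqr_s2 divff.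
Qed.

Lemma cos_bounds x : -1 <= cos x <= 1.
Proof. by rewrite cos_geN1 cos_le1. Qed.

Lemma sqr_Rx_ge x : 1 / 16 <= 25 / 16 + s2 * cos x <= 49 / 16.
Proof.
have /andP[a b] := s2_bounds; have /andP[c d] := cos_bounds x.
by apply/andP; split; nra.
Qed.

Lemma sqr_Rx x : Rx x ^+ 2 = 25 / 16 + s2 * cos x.
Proof. by rewrite sqr_sqrtr//; have /andP[h _] := sqr_Rx_ge x; apply: le_trans h; lra. Qed.

Lemma Rx_bounds x : 1 / 4 <= Rx x <= 7 / 4.
Proof.
have /andP[h1 h2] := sqr_Rx_ge x.
rewrite -[1 / 4]ger0_norm ?divr_ge0// -[7 / 4]ger0_norm ?divr_ge0//.
rewrite -!sqrtr_sqr /Rx; apply/andP; split; apply: ler_wsqrtr; lra.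
Qed.

Lemma Rx_gt0 x : 0 < Rx x.
Proof. by have /andP[h _] := Rx_bounds x; apply: lt_le_trans h; lra. Qed.

(** Multiplying by the conjugate factor removes the square root and the dependence on nu; [invHx]
    uses this to bring 1 / H over a denominator common to both signs. *)
Lemma Hx_aux nu x : nu ^+ 2 = 1 ->
  (2 * Rx x - nu * (2 + s2 * cos x)) * (2 * Rx x + nu * (2 + s2 * cos x)) =
  9 / 4 - 2 * cos x ^+ 2.
Proof.
move=> nu2; transitivity (4 * Rx x ^+ 2 -
  nu ^+ 2 * (4 + 4 * s2 * cos x + s2 ^+ 2 * cos x ^+ 2)); first by ring.
by rewrite sqr_Rx nu2 sqr_s2; field.
Qed.

(** The two conjugate factors have positive sum 4 R and, by [Hx_aux], positive product. *)
Lemma nuD_lt nu x : nu ^+ 2 = 1 -> 0 < 2 * Rx x - nu * (2 + s2 * cos x).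
Proof.
move=> nu2; have q0 : 0 < 9 / 4 - 2 * cos x ^+ 2.
  by have /andP[? ?] := cos_bounds x; nra.
have R0 := Rx_gt0 x; have D0 : 0 < 2 + s2 * cos x.
  by have /andP[? ?] := cos_bounds x; have /andP[? ?] := s2_bounds; nra.
rewrite -(Hx_aux x nu2) in q0.
have [//|neg] := ltP 0 (2 * Rx x - nu * (2 + s2 * cos x)).
have pos2 : 0 < 2 * Rx x + nu * (2 + s2 * cos x) by lra.
by move: q0; rewrite pmulr_lgt0// ltNge neg.
Qed.

Lemma Hx_gt0 nu x : nu ^+ 2 = 1 -> 0 < Hx nu x.
Proof.
by move=> nu2; rewrite /Hx !mulr_gt0 ?nuD_lt ?Rx_gt0 ?pi_gt0.
Qed.

Lemma invHx nu x : nu ^+ 2 = 1 -> (Hx nu x)^-1 =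
  (2 * Rx x + nu * (2 + s2 * cos x)) / (2 * pi * Rx x * (9 / 4 - 2 * cos x ^+ 2)).
Proof.
move=> nu2; have h1 := nuD_lt x nu2; have R0 := Rx_gt0 x; have p0 := pi_gt0 R.
have h2 : 0 < 2 * Rx x + nu * (2 + s2 * cos x).
  have : (- nu) ^+ 2 = 1 by rewrite sqrrN.
  by move/(nuD_lt x); rewrite mulNr opprK.
rewrite -(Hx_aux x nu2) /Hx; move: p0; move: (pi : R) => p p0; field.
by rewrite !gt_eqF.
Qed.

Definition half_eig e (m : nat) : R := feig e (Posz m).
Definition half_gen x mu e (m : nat) : R := fgen x mu e (Posz m).

Lemma feigE e z : feig e z = extendZ e (half_eig e) z. Proof. by case: z. Qed.
Lemma fgenE x mu e z : fgen x mu e z = extendZ e (half_gen x mu e) z. Proof. by case: z. Qed.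

Lemma half_eig_even e k : half_eig e k.*2 = - 1 / Num.sqrt 6 * (- e * s2) ^- k.
Proof. by rewrite /half_eig /feig /= odd_double doubleK. Qed.
Lemma half_eig_odd e k : half_eig e k.*2.+1 = 1 / (2 * Num.sqrt 3) * (- e * s2) ^- k.
Proof. by rewrite /half_eig /feig /= odd_double uphalf_double. Qed.
Lemma half_gen_even x mu e k : half_gen x mu e k.*2 =
  (1 + e / 4 - e * mu * Rx x) * sin (k%:R * x) + 1 / s2 * sin (k.+1%:R * x).
Proof. by rewrite /half_gen /fgen /= odd_double doubleK. Qed.
Lemma half_gen_odd x mu e k : half_gen x mu e k.*2.+1 =
  (mu * Rx x + 1 / 4 - e) * sin (k.+1%:R * x) - e / s2 * sin (k%:R * x).
Proof. by rewrite /half_gen /fgen /= odd_double uphalf_double. Qed.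

Definition off (m : nat) : R := if odd m then 1 / 2 else 1 / (2 * s2).
(** On functions of parity e the boundary value u (-1) = e u 0 is absorbed into the first diagonal
    entry. *)
Definition diag e (m : nat) : R :=
  if m is 0%N then 1 - e / 2 else if odd m then 3 / 4 else 1.
Definition jacobi e (u : nat -> R) (m : nat) : R :=
  diag e m * u m - (if m is k.+1 then off k * u k else 0) - off m * u m.+1.

Lemma Lpr_extendZ e (u : nat -> R) z : e ^+ 2 = 1 ->
  Lpr_fun (fun k => (extendZ e u k)%:C) z = (extendZ e (jacobi e u) z)%:C.
Proof.
move=> e2; have c1 : 1 / 2 = 2^-1 :> R by rewrite div1r.
have addP (m : nat) : m%:Z + 1 = m.+1 by rewrite -addn1.
have subP (m : nat) : m.+1%:Z - 1 = m by rewrite -addn1 PoszD addrK.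
have neg1 (m : nat) : - m%:Z - 1 = Negz m by rewrite NegzE -addn1 PoszD opprD.
have neg2 (m : nat) : - m%:Z - 2 = Negz m.+1.
  by rewrite NegzE; lia.
have negS (m : nat) : - m.+1%:Z = Negz m by rewrite NegzE.
have sub0P : 0%:Z - 1 = Negz 0 by [].
have neg0 : - 0%:Z = 0%:Z by [].
have eqC (a b : R) : a = b -> a%:C = b%:C by move->.
rewrite /jacobi /off /diag; case: z => [[|m]|[|m]].
- by rewrite /Lpr_fun sub0P addP /= -!rmorphM -!rmorphB /=; apply: eqC; ring.
- by rewrite /Lpr_fun addP subP /=; case: (odd m) => /=;
    rewrite -!rmorphM -!rmorphB /=; apply: eqC; ring.
- rewrite /Lpr_fun neg1 neg2 neg0 /= -!rmorphM -!rmorphB /=; apply: eqC.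
  transitivity (e * u 0%N - e ^+ 2 * (u 0%N / 2) - 1 / (2 * s2) * (e * u 1%N)).
    by rewrite e2; ring.
  by ring.
- by rewrite /Lpr_fun neg1 neg2 negS /=; case: (odd m) => /=;
    rewrite -!rmorphM -!rmorphB /=; apply: eqC; ring.
Qed.

Lemma nat_parity (P : nat -> Prop) : P 0%N -> (forall k, P k.*2.+1) ->
  (forall k, P k.+1.*2) -> forall m, P m.
Proof.
move=> P0 Po Pe m; rewrite -(odd_double_half m); case: (odd m) => /=.
  by rewrite add1n.
by rewrite add0n; case: (m./2).
Qed.

Lemma jacobi0 e u : jacobi e u 0 = (1 - e / 2) * u 0%N - 1 / (2 * s2) * u 1%N.
Proof. by rewrite /jacobi /off /diag /= subr0. Qed.

Lemma jacobi_odd e u k : jacobi e u k.*2.+1 =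
  3 / 4 * u k.*2.+1 - 1 / (2 * s2) * u k.*2 - 1 / 2 * u k.+1.*2.
Proof. by rewrite /jacobi /off /diag /= odd_double doubleS. Qed.

Lemma jacobi_even e u k : jacobi e u k.+1.*2 =
  u k.+1.*2 - 1 / 2 * u k.*2.+1 - 1 / (2 * s2) * u k.+1.*2.+1.
Proof. by rewrite /jacobi /off /diag doubleS /= odd_double /= !mul1r. Qed.

Lemma sqrt6E : Num.sqrt 6 = s2 * Num.sqrt 3 :> R.
Proof. by rewrite -sqrtrM//; congr Num.sqrt; ring. Qed.

Lemma jacobi_eig e m : e ^+ 2 = 1 -> jacobi e (half_eig e) m = (5 / 4 - e / 2) * half_eig e m.
Proof.
move=> e2; have s2s := sqr_s2; have s0 := s2_gt0.
have t0 : 0 < (Num.sqrt 3 : R) by rewrite sqrtr_gt0.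
have e0 : e != 0 by apply: contraTneq (@ltr01 R) => e0; rewrite -e2 e0 expr0n ltxx.
have pw k : (- e * s2) ^- k.+1 = - e * s2 / 2 * (- e * s2) ^- k.
  rewrite exprS invfM; congr (_ * _).
  rewrite invfM inv_s2 invrN mulrA; congr (_ * s2 / 2); congr (- _).
  by apply: (mulfI e0); rewrite divff// -expr2 e2.
(* [lra] treats monomials as atoms; these are the consequences of s^2 = 2 and e^2 = 1 that it
   needs. *)
have lin (s T q : R) : s ^+ 2 = 2 -> [/\ s * s * T * q = 2 * T * q,
    e * s * s * T * q = 2 * e * T * q & e * e * s * s * T * q = 2 * T * q].
  move=> ss; have -> : s * s * T * q = s ^+ 2 * T * q by ring.
  have -> : e * s * s * T * q = e * s ^+ 2 * T * q by ring.
  have -> : e * e * s * s * T * q = e ^+ 2 * s ^+ 2 * T * q by ring.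
  by rewrite e2 ss; split; ring.
move: m; apply: nat_parity => [|k|k].
- rewrite jacobi0 (half_eig_even e 0) (half_eig_odd e 0) /= expr0 invr1 !mulr1 sqrt6E.
  rewrite !invfM !inv_s2; have [] := lin s2 (Num.sqrt 3)^-1 1 s2s; lra.
- rewrite jacobi_odd !half_eig_even half_eig_odd pw sqrt6E !invfM !inv_s2.
  have [] := lin s2 (Num.sqrt 3)^-1 ((- e * s2) ^- k) s2s; lra.
- rewrite jacobi_even !half_eig_even !half_eig_odd !pw sqrt6E !invfM !inv_s2.
  have [] := lin s2 (Num.sqrt 3)^-1 ((- e * s2) ^- k) s2s; lra.
Qed.

Lemma sin_step x k : sin (k.+2%:R * x) = 2 * cos x * sin (k.+1%:R * x) - sin (k%:R * x).
Proof.
have -> : k.+2%:R * x = k.+1%:R * x + x by rewrite -[k.+2]addn1 natrD mulrDl mul1r.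
have -> : k%:R * x = k.+1%:R * x - x by rewrite -[k.+1]addn1 natrD mulrDl mul1r addrK.
by rewrite sinD sinB; ring.
Qed.

(* The dispersion relation [sqr_Rx] turns [cos x] into a quadratic polynomial in [Rx x]. *)
Lemma cos_Rx x : cos x = s2 / 2 * (Rx x ^+ 2 - 25 / 16).
Proof.
rewrite sqr_Rx; transitivity (s2 ^+ 2 / 2 * cos x); last by ring.
by rewrite sqr_s2; field.
Qed.

Lemma jacobi_gen x mu e m : e ^+ 2 = 1 -> mu ^+ 2 = 1 ->
  jacobi e (half_gen x mu e) m = (7 / 8 - mu * Rx x / 2) * half_gen x mu e m.
Proof.
move=> e2 mu2.
have lin (s r T : R) : s ^+ 2 = 2 -> [/\ s * s * T = 2 * T, s * s * (r * T) = 2 * (r * T),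
    s * s * (r ^+ 2 * T) = 2 * (r ^+ 2 * T) & s * s * (r ^+ 3 * T) = 2 * (r ^+ 3 * T)].
  by rewrite expr2 => ->.
have {lin} lin T := lin s2 (Rx x) T sqr_s2.
have se : e = 1 \/ e = -1 by move: e2 => /eqP; rewrite sqrf_eq1 => /orP[]/eqP; [left|right].
have smu : mu = 1 \/ mu = -1 by move: mu2 => /eqP; rewrite sqrf_eq1 => /orP[]/eqP; [left|right].
move: m; apply: nat_parity => [|k|k].
- rewrite jacobi0 (half_gen_even _ _ _ 0) (half_gen_odd _ _ _ 0) mul0r sin0 ?invfM ?inv_s2.
  have [] := lin (sin (1 * x)).
  by case: se => ->; case: smu => ->; lra.
- rewrite jacobi_odd !half_gen_even half_gen_odd sin_step cos_Rx !invfM !inv_s2.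
  have [] := lin (sin (k.+1%:R * x)).
  by case: se => ->; case: smu => ->; lra.
- rewrite jacobi_even !half_gen_even !half_gen_odd sin_step cos_Rx !invfM !inv_s2.
  have [] := lin (sin (k.+1%:R * x)).
  by case: se => ->; case: smu => ->; lra.
Qed.

End Eigenfunctions.

Section HalfLine.
Variable R : realType.

(* The three-term recurrence gives row m + 1 of K from rows m and m - 1. *)
Lemma jacobi_delta (e c : R) (K Kl : nat -> nat -> R) :
  (forall m n, K m n = K n m) -> (forall m n, Kl m n = Kl n m) ->
  (forall m n, jacobi e (fun k => K k n) m = Kl m n) ->
  (forall n, K 0%N n = c * (n == 0%N)%:R) -> forall m n, K m n = c * (m == n)%:R.
Proof.
move=> Ksym Klsym JK K0 m; elim/ltn_ind: m => -[|m] IH n; first by rewrite K0 eq_sym.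
have offn0 k : off R k != 0.
  by rewrite /off; case: ifP => _; rewrite ?mulf_neq0// ?invr_eq0 ?mulf_neq0 ?gt_eqF ?s2_gt0.
have Km j : K m j = c * (m == j)%:R by exact: IH.
have Kj j : K j m = c * (m == j)%:R by rewrite Ksym.
(* Symmetry of [Kl], the product of the Jacobi matrix J with K, means that J and K commute.
   Comparing its entries (m, n) and (n, m), every term except [off m * K m.+1 n] is known by
   induction. *)
apply: (mulfI (offn0 m)); have := JK m n; rewrite Klsym -JK /jacobi !Kj Km.
have -> : (if m is k.+1 then off R k * K k n else 0) = off R n * (c * (m == n.+1)%:R).
  case: m {Km Kj} IH => [|k] IH; first by rewrite !mulr0.
  rewrite IH ?ltnS// eqSS; have [->//|_] := eqVneq k n.
  by rewrite !mulr0.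
have -> : (if n is k.+1 then off R k * K k m else 0) = off R m * (c * (m.+1 == n)%:R).
  case: n => [|k]; first by rewrite !mulr0.
  rewrite Kj eqSS; have [->//|_] := eqVneq m k.
  by rewrite !mulr0.
have -> : diag e m * (c * (m == n)%:R) = diag e n * (c * (m == n)%:R).
  by have [->//|_] := eqVneq m n; rewrite !mulr0.
lra.
Qed.

(* The characteristic roots are 2 and 1/2; boundedness excludes 2. *)
Lemma geometric_decay (u : nat -> R) (C : R) : (forall k, `|u k| <= C) ->
  (forall k, u k.+2 = 5 / 2 * u k.+1 - u k) -> forall k, u k.+1 = u k / 2.
Proof.
(* b removes the component along the root 1/2, so the recurrence doubles b at each step. *)
move=> uC rec; pose b k := u k.+1 - u k / 2.
have bE k : b k = 2 ^+ k * b 0%N.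
  elim: k => [|k IH]; first by rewrite expr0 mul1r.
  by rewrite exprS -mulrA -IH /b rec; field.
suff b0 : b 0%N = 0 by move=> k; apply/eqP; rewrite -subr_eq0 -/(b k) bE b0 mulr0.
have bC k : 2 ^+ k * `|b 0%N| <= 2 * C.
  rewrite -[2 ^+ k]ger0_norm ?exprn_ge0// -normrM -bE /b.
  have := ler_normB (u k.+1) (u k / 2); have := uC k.+1; have := uC k.
  by rewrite normrM (ger0_norm (_ : 0 <= 2^-1)) ?invr_ge0//; have := normr_ge0 (u k); lra.
apply/eqP; rewrite -normr_eq0 eq_le normr_ge0 andbT leNgt; apply/negP => b0.
pose n := Num.bound (2 * C / `|b 0%N|).
have C0 : 0 <= C by apply: le_trans (uC 0%N).
have h1 : 2 * C / `|b 0%N| < n%:R by apply: archi_boundP; rewrite divr_ge0 ?mulr_ge0.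
have h2 : n%:R <= 2 ^+ n :> R by rewrite -natrX ler_nat ltnW// ltn_expl.
move: h1; rewrite ltr_pdivrMr// ltNge => /negP; apply.
by apply: le_trans (bC n); rewrite ler_wpM2r.
Qed.

Definition ctsR (f : R -> R) := continuous f.

Lemma ctsM f g : ctsR f -> ctsR g -> ctsR (fun x => f x * g x).
Proof. by move=> cf cg x; apply: cvgM; [exact: cf|exact: cg]. Qed.

Lemma ctsD f g : ctsR f -> ctsR g -> ctsR (fun x => f x + g x).
Proof. by move=> cf cg x; apply: cvgD; [exact: cf|exact: cg]. Qed.

Lemma ctsN f : ctsR f -> ctsR (fun x => - f x).
Proof. by move=> cf x; apply: cvgN; exact: cf. Qed.

Lemma ctsV f : ctsR f -> (forall x, f x != 0) -> ctsR (fun x => (f x)^-1).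
Proof. by move=> cf f0 x; apply: cvgV => //; exact: cf. Qed.

Lemma cts_cst (c : R) : ctsR (fun=> c).
Proof. by move=> x; exact: cvg_cst. Qed.

Lemma cts_lin (c : R) : ctsR (fun x => c * x).
Proof. by apply: ctsM => x; [exact: cvg_cst|exact: cvg_id]. Qed.

Lemma cts_sin (c : R) : ctsR (fun x => sin (c * x)).
Proof. by move=> x; apply: continuous_comp; [exact: cts_lin|exact: continuous_sin]. Qed.

Lemma cts_cos (c : R) : ctsR (fun x => cos (c * x)).
Proof. by move=> x; apply: continuous_comp; [exact: cts_lin|exact: continuous_cos]. Qed.

Lemma cts_cos1 : ctsR (@cos R). Proof. exact: continuous_cos. Qed.
Lemma cts_Rx : ctsR (@Rx R).
Proof.
have h : ctsR (fun x => 25 / 16 + Num.sqrt 2 * cos x).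
  by apply: ctsD; [exact: cts_cst|apply: ctsM; [exact: cts_cst|exact: cts_cos1]].
by move=> x; apply: continuous_comp; [exact: h|exact: sqrt_continuous].
Qed.

Lemma cts_Hx nu : ctsR (Hx nu).
Proof.
apply: ctsM; first by apply: ctsM; [exact: cts_cst|exact: cts_Rx].
apply: ctsD; first by apply: ctsM; [exact: cts_cst|exact: cts_Rx].
apply: ctsN; apply: ctsM; first exact: cts_cst.
by apply: ctsD; [exact: cts_cst|apply: ctsM; [exact: cts_cst|exact: cts_cos1]].
Qed.

Lemma cts_fgen mu e z : ctsR (fun x => fgen x mu e z).
Proof.
have h (m : nat) : ctsR (fun x => fgen x mu e (Posz m)).
  rewrite /fgen /=; case: (odd m) => /=; apply: ctsD.
  - apply: ctsM; last exact: cts_sin.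
    apply: ctsD; last exact: cts_cst.
    apply: ctsD; last exact: cts_cst.
    by apply: ctsM; [exact: cts_cst|exact: cts_Rx].
  - by apply: ctsN; apply: ctsM; [exact: cts_cst|exact: cts_sin].
  - apply: ctsM; last exact: cts_sin.
    apply: ctsD; first exact: cts_cst.
    by apply: ctsN; apply: ctsM; [exact: cts_cst|exact: cts_Rx].
  - by apply: ctsM; [exact: cts_cst|exact: cts_sin].
by case: z => m; [exact: h|apply: ctsM; [exact: cts_cst|exact: h]].
Qed.

End HalfLine.

(** * Fourier coefficients of the Poisson kernel *)

Section PoissonIntegrals.
Variable R : realType.
Local Notation leb := (@lebesgue_measure R).
Local Notation D := (`[0, pi]%classic : set R).
Local Notation s2 := (Num.sqrt 2 : R).

Lemma sin_natpi n : sin (n%:R * pi) = 0 :> R.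
Proof.
elim: n => [|n IH]; first by rewrite mul0r sin0.
by rewrite -natr1 mulrDl mul1r sinDpi IH oppr0.
Qed.

Lemma integral_cos n : \int[leb]_(x in D) cos (n.+1%:R * x) = 0.
Proof.
pose c : R := n.+1%:R; have c0 : c != 0 by rewrite pnatr_eq0.
have dF (x : R) : is_derive x (1 : R) (fun x => c^-1 * sin (c * x)) (cos (c * x)).
  have hc : is_derive x (1 : R) (fun x => c * x) c.
    have := is_deriveZ c (is_derive_id x (1 : R)).
    by rewrite /GRing.scale/= mulr1; apply.
  have := is_deriveZ c^-1 (is_derive1_comp (is_derive_sin (c * x)) hc).
  by rewrite [X in is_derive _ _ _ X -> _](_ : _ = cos (c * x)) //; rewrite /GRing.scale/= mulrC mulfK.
have cF : ctsR (fun x => c^-1 * sin (c * x)).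
  by apply: ctsM; [exact: cts_cst|exact: cts_sin].
have ftc := @continuous_FTC2 R (fun x => cos (c * x)) (fun x => c^-1 * sin (c * x)) 0 pi (pi_gt0 R).
rewrite /Rintegral ftc.
- by rewrite -EFinB /= sin_natpi mulr0 mulr0 sin0 mulr0 subr0.
- by apply: continuous_subspaceT; exact: cts_cos.
- split.
  + by move=> x _; have [] := dF x.
  + by apply: cvg_at_right_filter; exact: cF.
  + by apply: cvg_at_left_filter; exact: cF.
- by move=> x _; rewrite derive1E; have [_ ->] := dF x.
Qed.

(** The product of the conjugate factors in [Hx_aux]. It equals 5/4 - cos (2 x), so 1 / qx is 4/3
    times the Poisson kernel of radius 1/2 at the angle 2 x. *)
Definition qx (x : R) : R := 9 / 4 - 2 * cos x ^+ 2.

Lemma qx_ge x : 1 / 4 <= qx x.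
Proof. by have /andP[? ?] := cos_bounds x; rewrite /qx; nra. Qed.

Lemma qx_gt0 x : 0 < qx x.
Proof. by apply: lt_le_trans (qx_ge x); lra. Qed.

Lemma cts_qxV : ctsR (fun x => (qx x)^-1).
Proof.
apply: ctsV => [|x]; last by rewrite gt_eqF// qx_gt0.
apply: ctsD; first exact: cts_cst.
apply: ctsN; apply: ctsM; first exact: cts_cst.
rewrite (_ : (fun x => _) = (fun x => cos x * cos x)); last by apply/funext => x; rewrite expr2.
by apply: ctsM; exact: cts_cos1.
Qed.

Definition poisson n := \int[leb]_(x in D) (cos (n%:R * x) / qx x).

Lemma bmd_poisson n : bmd (fun x => cos (n%:R * x) / qx x).
Proof. by apply: continuous_bmd; apply: ctsM; [exact: cts_cos|exact: cts_qxV]. Qed.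

Lemma bmd_cos n : bmd (fun x : R => cos (n%:R * x)).
Proof. by apply: continuous_bmd; exact: cts_cos. Qed.

Lemma poisson_bound n : `|poisson n| <= 4 * pi.
Proof.
have bp := bmd_integrable (bmd_poisson n).
rewrite /poisson; apply: le_trans (le_normr_Rintegral _ _) _ => //.
rewrite -integral_cst_bmd; apply: le_Rintegral => //.
- exact: integrable_norm.
- exact: bmd_integrable (bmd_cst 4).
move=> x _; rewrite normrM -[4]mul1r ler_pM ?cos_max//.
have q0 := qx_gt0 x; rewrite gtr0_norm ?invr_gt0//.
rewrite -[leRHS]invrK lef_pV2 ?posrE ?invr_gt0//.
by have := qx_ge x; rewrite div1r.
Qed.

(* cos(a + 2x) + cos(a - 2x) = 2 cos a cos 2x, and cos 2x = 5/4 - qx x. *)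
Lemma cos_qx (a x : R) : (cos (a + 2 * x) + cos (a - 2 * x)) / qx x =
  5 / 2 * (cos a / qx x) + - 2 * cos a.
Proof.
have q0 : qx x != 0 by rewrite gt_eqF// qx_gt0.
have c2 : cos (2 * x) = 5 / 4 - qx x.
  by rewrite mulr_natl cos_mulr2n /qx -mulr_natl; field.
rewrite cosD cosB c2; field; exact: q0.
Qed.

(** The frequency relation is stated on cosines, so that for n = 0 and n = 1 the negative frequency
    n - 2 folds back by parity. *)
Lemma poisson_rec (m n p : nat) (c : R) : \int[leb]_(x in D) cos (n%:R * x) = c ->
  (forall x, cos (m%:R * x) + cos (p%:R * x) = cos (n%:R * x + 2 * x) + cos (n%:R * x - 2 * x) :> R) ->
  poisson m + poisson p = 5 / 2 * poisson n - 2 * c.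
Proof.
move=> <- h; rewrite /poisson -mulNr -!integralZ_bmd; [|exact: bmd_cos|exact: bmd_poisson].
rewrite -!integralD_bmd; try exact: bmd_poisson.
- by apply: eq_Rintegral => x _; rewrite -mulrDl h cos_qx.
- by apply: bmdM; [exact: bmd_cst|exact: bmd_poisson].
- by apply: bmdM; [exact: bmd_cst|exact: bmd_cos].
Qed.

Lemma poisson_values k : poisson k.*2 = 4 * pi / 3 * 2^-1 ^+ k /\ poisson k.*2.+1 = 0.
Proof.
have i0 : \int[leb]_(x in D) cos (0%:R * x) = pi.
  transitivity (\int[leb]_(x in D) (1 : R)).
    by apply: eq_Rintegral => x _; rewrite mul0r cos0.
  by rewrite integral_cst_bmd mul1r.
have rec n : poisson n.+4 + poisson n = 5 / 2 * poisson n.+2 - 2 * 0.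
  apply: poisson_rec => [|x]; first exact: integral_cos.
  have e4 : n.+4%:R = n%:R + 4 :> R by rewrite -addn4 natrD.
  have e2 : n.+2%:R = n%:R + 2 :> R by rewrite -addn2 natrD.
  by rewrite e4 e2; congr (cos _ + cos _); ring.
have r0 : poisson 2 + poisson 2 = 5 / 2 * poisson 0 - 2 * pi.
  apply: (poisson_rec i0) => x; rewrite -[X in _ + X]cosN; congr (cos _ + cos _); ring.
have r1 : poisson 3 + poisson 1 = 5 / 2 * poisson 1 - 2 * 0.
  apply: poisson_rec => [|x]; first exact: integral_cos.
  rewrite -[X in _ + X]cosN; congr (cos _ + cos _); ring.
have de j : poisson j.+1.*2 = poisson j.*2 / 2.
  apply: (@geometric_decay _ (fun k => poisson k.*2) (4 * pi)) => i; first exact: poisson_bound.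
  by have := rec i.*2; rewrite !doubleS; lra.
have do_ j : poisson j.+1.*2.+1 = poisson j.*2.+1 / 2.
  apply: (@geometric_decay _ (fun k => poisson k.*2.+1) (4 * pi)) => i; first exact: poisson_bound.
  by have := rec i.*2.+1; rewrite !doubleS; lra.
(* Halving over two frequencies, inserted into the folded recurrences [r0] and [r1], determines the
   two initial values. *)
have p0 : poisson 0 = 4 * pi / 3 by have := de 0%N; rewrite /=; lra.
have p1 : poisson 1 = 0 by have := do_ 0%N; rewrite /=; lra.
elim: k => [|k [IHe IHo]]; first by rewrite expr0 mulr1 /= p0 p1.
by rewrite de do_ IHe IHo mul0r exprSr mulrA.
Qed.

End PoissonIntegrals.

(** * Completeness of the eigenfunctions *)

Section Completeness.
Variable R : realType.
Local Notation leb := (@lebesgue_measure R).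
Local Notation D := (`[0, pi]%classic : set R).
Local Notation s2 := (Num.sqrt 2 : R).
Implicit Types (e x : R) (m n k : nat) (u : bool).

Definition sg u : R := if u then 1 else -1.

Lemma sqr_sg u : sg u ^+ 2 = 1.
Proof. by case: u; rewrite /sg ?sqrrN expr1n. Qed.

Lemma sqr_sgM e u : e ^+ 2 = 1 -> (e * sg u) ^+ 2 = 1.
Proof. by move=> e2; rewrite exprMn e2 sqr_sg mulr1. Qed.

Definition gen_pair x e m n : R :=
  \sum_(u : bool) half_gen x (sg u) e m * half_gen x (sg u) e n / Hx (e * sg u) x.

(** What remains of the entry (0, 2 k) of [gen_pair] after the cancellation of [Rx]; the odd columns
    give the same density with k shifted by one and a factor e. *)
Definition row_density e k x : R :=
  (e * s2 / 4 * (sin x * sin (k%:R * x)) + sin x ^+ 2 * cos (k%:R * x)) / (pi * qx x).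

Lemma sum_sg (e : R) (f : R -> R) : e ^+ 2 = 1 ->
  \sum_(u : bool) f (e * sg u) = f 1 + f (-1).
Proof.
move=> /eqP; rewrite sqrf_eq1 big_bool /sg mulr1 mulrN1 => /orP[]/eqP -> //.
by rewrite opprK addrC.
Qed.

(* The square roots [Rx] cancel between the two branches of the spectrum. *)
Lemma branch_sum e (a b c x : R) : e ^+ 2 = 1 ->
  \sum_(u : bool) (a * (b + e * sg u * Rx x * c)) / Hx (e * sg u) x =
  a * (2 * b + c * (2 + s2 * cos x)) / (pi * qx x).
Proof.
move=> e2; rewrite (sum_sg (fun v => (a * (b + v * Rx x * c)) / Hx v x) e2).
rewrite !invHx ?sqrrN ?expr1n// -/(qx x).
have := qx_gt0 x; have := Rx_gt0 x; have := pi_gt0 R.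
move: (pi : R) (Rx x) (qx x) => p r q p0 r0 q0; field.
by rewrite !gt_eqF.
Qed.

Lemma half_gen0 x mu e : half_gen x mu e 0 = s2 / 2 * sin x.
Proof. by rewrite (half_gen_even x mu e 0) mul0r sin0 mulr0 add0r div1r inv_s2 mul1r. Qed.

Lemma sin_stepc k x : sin (k.+1%:R * x) = sin (k%:R * x) * cos x + cos (k%:R * x) * sin x.
Proof. by rewrite -natr1 mulrDl mul1r sinD. Qed.

Lemma sin_stepb k x : sin (k%:R * x) = sin (k.+1%:R * x) * cos x - cos (k.+1%:R * x) * sin x.
Proof.
have -> : k%:R * x = k.+1%:R * x - x by rewrite -natr1 mulrDl mul1r addrK.
by rewrite sinB.
Qed.

Lemma gen_pair_even x e k : e ^+ 2 = 1 -> gen_pair x e 0 k.*2 = row_density e k x.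
Proof.
move=> e2; rewrite /gen_pair.
under eq_bigr do rewrite half_gen0 half_gen_even.
rewrite (eq_bigr (fun u => (s2 / 2 * sin x * ((1 + e / 4) * sin (k%:R * x) +
   s2 / 2 * sin (k.+1%:R * x) + e * sg u * Rx x * - sin (k%:R * x))) / Hx (e * sg u) x)); last first.
  by move=> u _; congr (_ / _); rewrite div1r inv_s2; ring.
rewrite branch_sum// /row_density; congr (_ / _); rewrite sin_stepc.
have ss := sqr_s2 R.
transitivity (e * s2 / 4 * (sin x * sin (k%:R * x)) + s2 ^+ 2 / 2 * (sin x ^+ 2 * cos (k%:R * x))).
  by field.
by rewrite ss; field.
Qed.

Lemma gen_pair_odd x e k : e ^+ 2 = 1 -> gen_pair x e 0 k.*2.+1 = e * row_density e k.+1 x.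
Proof.
move=> e2; rewrite /gen_pair.
under eq_bigr do rewrite half_gen0 half_gen_odd.
rewrite (eq_bigr (fun u => (s2 / 2 * sin x * ((1 / 4 - e) * sin (k.+1%:R * x) -
   e * (s2 / 2) * sin (k%:R * x) + e * sg u * Rx x * (e * sin (k.+1%:R * x)))) / Hx (e * sg u) x)); last first.
  move=> u _; congr (_ / _); rewrite inv_s2.
  transitivity (s2 / 2 * sin x * ((sg u * Rx x * e ^+ 2 + 1 / 4 - e) * sin (k.+1%:R * x) - e * (s2 / 2) * sin (k%:R * x))).
    by rewrite e2 mulr1.
  by ring.
rewrite branch_sum// /row_density [RHS]mulrA; congr (_ / _); rewrite (sin_stepb k).
have ss := sqr_s2 R.
transitivity (e ^+ 2 * s2 / 4 * (sin x * sin (k.+1%:R * x)) +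
   e * (s2 ^+ 2 / 2) * (sin x ^+ 2 * cos (k.+1%:R * x))); last by rewrite ss; field.
by rewrite e2; field.
Qed.

Lemma sin2_qx x : sin x ^+ 2 = qx x / 2 - 1 / 8.
Proof. by rewrite sin2cos2 /qx; field. Qed.

(** Here and in [row_densityS] the sine products become cosines, over qx or alone, whose integrals
    are known. The case k = 0 stands apart: it would involve the frequency -1, and its constant term
    has integral pi instead of 0. *)
Lemma row_density0 e x : row_density e 0 x = pi^-1 * (2^-1 + (- (1 / 8)) * (cos (0%:R * x) / qx x)).
Proof.
rewrite /row_density mul0r sin0 cos0 sin2_qx.
have := qx_gt0 x; have := pi_gt0 R; move: (pi : R) (qx x) => p q p0 q0; field.
by rewrite !gt_eqF.
Qed.

Lemma row_densityS e k x : row_density e k.+1 x =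
  pi^-1 * (e * s2 / 8 * (cos (k%:R * x) / qx x) + ((- (e * s2 / 8)) * (cos (k.+2%:R * x) / qx x) +
    (1 / 2 * cos (k.+1%:R * x) + (- (1 / 8)) * (cos (k.+1%:R * x) / qx x)))).
Proof.
have -> : cos (k.+2%:R * x) = cos (k.+1%:R * x) * cos x - sin (k.+1%:R * x) * sin x.
  by rewrite -[k.+2]addn1 natrD mulrDl mul1r cosD.
have -> : cos (k%:R * x) = cos (k.+1%:R * x) * cos x + sin (k.+1%:R * x) * sin x.
  have -> : k%:R * x = k.+1%:R * x - x by rewrite -natr1 mulrDl mul1r addrK.
  by rewrite cosB.
rewrite /row_density sin2_qx.
have := qx_gt0 x; have := pi_gt0 R; move: (pi : R) (qx x) => p q p0 q0; field.
by rewrite !gt_eqF.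
Qed.

Lemma bmdZ (c : R) f : bmd f -> bmd (fun x => c * f x).
Proof. by move=> bf; apply: bmdM => //; exact: bmd_cst. Qed.

(** The integral is 1/2 at k = 0 and 0 elsewhere, minus a geometric term (-e sqrt 2)^(-k) / 6. The
    eigenvector supplies exactly that term. *)
Lemma integral_row_density e k : e ^+ 2 = 1 ->
  half_eig e 0 * half_eig e k.*2 + \int[leb]_(x in D) row_density e k x = 2^-1 * (k == 0%N)%:R.
Proof.
move=> e2; have p0 : (pi : R) != 0 by rewrite gt_eqF// pi_gt0.
have s60 : (Num.sqrt 6 : R) ^+ 2 = 6 by rewrite sqr_sqrtr.
have heig : half_eig e 0 * half_eig e k.*2 = 1 / 6 * (- e * s2) ^- k.
  rewrite (half_eig_even e 0) half_eig_even /= expr0 invr1 mulr1 mulrA; congr (_ * _).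
  by rewrite -[in RHS]s60 expr2 invfM; ring.
have pZ c n : \int[leb]_(x in D) (c * (cos (n%:R * x) / qx x)) = c * poisson R n.
  by rewrite integralZ_bmd//; exact: bmd_poisson.
rewrite heig; case: k {heig} => [|k].
  have b1 : bmd (fun=> 2^-1 : R) by exact: bmd_cst.
  have b2 : bmd (fun x => - (1 / 8) * (cos (0%:R * x) / qx x) : R) by apply: bmdZ; exact: bmd_poisson.
  rewrite expr0 invr1 mulr1 mulr1.
  under eq_Rintegral do rewrite row_density0.
  rewrite integralZ_bmd; last exact: bmdD.
  rewrite integralD_bmd// pZ integral_cst_bmd.
  by have [+ _] := poisson_values R 0; rewrite double0 expr0 => ->; move: (pi : R) p0 => p p0; field.
have b1 c n : bmd (fun x => c * (cos (n%:R * x) / qx x) : R) by apply: bmdZ; exact: bmd_poisson.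
have b2 c n : bmd (fun x => c * cos (n%:R * x) : R) by apply: bmdZ; exact: bmd_cos.
have b3 c n c' n' : bmd (fun x => c * cos (n%:R * x) + c' * (cos (n'%:R * x) / qx x) : R).
  by apply: bmdD.
have b4 c'' n'' c n c' n' : bmd (fun x => c'' * (cos (n''%:R * x) / qx x) +
    (c * cos (n%:R * x) + c' * (cos (n'%:R * x) / qx x)) : R).
  by apply: bmdD.
under eq_Rintegral do rewrite row_densityS.
rewrite integralZ_bmd; last by apply: bmdD.
rewrite !integralD_bmd// !pZ integralZ_bmd; last exact: bmd_cos.
rewrite integral_cos mulr0 add0r mulr0.
have es2 : (- e * s2) ^+ 2 = 2 by rewrite exprMn sqrrN e2 sqr_s2 mul1r.
have inv2 j : (- e * s2) ^- j.*2 = 2^-1 ^+ j.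
  by rewrite -exprVn -muln2 mulnC exprM exprVn es2.
have inv1 : (- e * s2)^-1 = - e * s2 / 2.
  have n0 : - e * s2 != 0 by rewrite -sqrf_eq0 es2.
  by apply: (mulfI n0); rewrite divff// mulrA -expr2 es2 divff.
(* Odd Poisson coefficients vanish, so the parity of k decides whether the middle frequency or its
   two neighbours contribute. *)
rewrite -(odd_double_half k); case: (odd k) => /=; move: k./2 => j; rewrite ?add1n ?add0n.
  have [_ ->] := poisson_values R j; have [-> _] := poisson_values R j.+1.
  have [_ ->] := poisson_values R j.+1.
  by rewrite -doubleS inv2 exprS; move: (pi : R) p0 => p p0; field.
have [-> ->] := poisson_values R j; have [+ _] := poisson_values R j.+1.
rewrite doubleS => ->.
have -> : (- e * s2) ^- j.*2.+1 = - e * s2 / 2 * 2^-1 ^+ j by rewrite exprS invfM inv1 inv2.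
by rewrite exprS; move: (pi : R) p0 => p p0; field.
Qed.

Lemma bmd_half_pair u e m n : e ^+ 2 = 1 ->
  bmd (fun x => half_gen x (sg u) e m * half_gen x (sg u) e n / Hx (e * sg u) x).
Proof.
move=> e2; apply: continuous_bmd; apply: ctsM; last first.
  by apply: ctsV => [|x]; [exact: cts_Hx|rewrite gt_eqF// Hx_gt0// sqr_sgM].
by apply: ctsM; exact: cts_fgen.
Qed.

Lemma integral_jacobi e (S : nat -> R -> R) m : (forall k, bmd (S k)) ->
  jacobi e (fun k => \int[leb]_(x in D) S k x) m = \int[leb]_(x in D) jacobi e (S^~ x) m.
Proof.
move=> bS; rewrite /jacobi.
have bZ c k : bmd (fun x => c * S k x) by exact: bmdZ.
have bN (f : R -> R) : bmd f -> bmd (fun x => - f x).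
  move=> bf; rewrite (_ : (fun x => _) = (fun x => -1 * f x)); first exact: bmdZ.
  by apply/funext => x; rewrite mulN1r.
have iN (f : R -> R) : bmd f -> \int[leb]_(x in D) (- f x) = - \int[leb]_(x in D) f x.
  move=> bf; rewrite -mulN1r -integralZ_bmd//.
  by apply: eq_Rintegral => x _; rewrite mulN1r.
have b0 : bmd (fun x => - (if m is k.+1 then off R k * S k x else 0)).
  by apply: bN; case: m => [|k]; [exact: bmd_cst|exact: bZ].
rewrite integralD_bmd; [|exact: bmdD|exact: bN].
rewrite integralD_bmd// !iN//; last by case: (m) => [|k]; [exact: bmd_cst|exact: bZ].
rewrite !integralZ_bmd//; congr (_ - _ - _); case: m {b0} => [|k].
  by rewrite integral_cst_bmd mul0r.
by rewrite integralZ_bmd.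
Qed.

Lemma jacobiZ e c (v : nat -> R) m : jacobi e (fun k => c * v k) m = c * jacobi e v m.
Proof. by rewrite /jacobi; case: m => [|m]; ring. Qed.

Lemma jacobiD e (v w : nat -> R) m :
  jacobi e (fun k => v k + w k) m = jacobi e v m + jacobi e w m.
Proof. by rewrite /jacobi; case: m => [|m]; ring. Qed.

(** The factor 1/2 appears because the projection onto functions of parity e on the whole line has
    half the identity as its block on the half-line. *)
Lemma half_completeness e m n : e ^+ 2 = 1 ->
  half_eig e m * half_eig e n + \int[leb]_(x in D) gen_pair x e m n = 2^-1 * (m == n)%:R.
Proof.
move=> e2.
pose K m n := half_eig e m * half_eig e n + \int[leb]_(x in D) gen_pair x e m n.
(* The product of the Jacobi matrix with K, as given by the eigenvalue equations; in this form it is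
   visibly symmetric. *)
pose Kl m n := (5 / 4 - e / 2) * (half_eig e m * half_eig e n) +
  \int[leb]_(x in D) \sum_(u : bool) (7 / 8 - sg u * Rx x / 2) *
     (half_gen x (sg u) e m * half_gen x (sg u) e n / Hx (e * sg u) x).
have bg i j : bmd (fun x => gen_pair x e i j).
  by apply: bmd_sum => u; exact: bmd_half_pair.
apply: (@jacobi_delta _ e 2^-1 K Kl) => [i j|i j|i j|].
- rewrite /K [in LHS]mulrC; congr (_ + _); apply: eq_Rintegral => x _.
  by apply: eq_bigr => u _; rewrite [half_gen x _ e i * _]mulrC.
- rewrite /Kl [half_eig e i * _]mulrC; congr (_ + _); apply: eq_Rintegral => x _.
  by apply: eq_bigr => u _; rewrite [half_gen x _ e i * _]mulrC.
- rewrite /K jacobiD integral_jacobi//; congr (_ + _).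
    rewrite (_ : (fun k => _) = (fun k => half_eig e j * half_eig e k)); last first.
      by apply/funext => k; rewrite mulrC.
    by rewrite jacobiZ jacobi_eig//; ring.
  apply: eq_Rintegral => x _; rewrite /gen_pair big_bool /=.
  rewrite (_ : (fun k => _) = (fun k =>
     half_gen x (sg true) e j / Hx (e * sg true) x * half_gen x (sg true) e k +
     half_gen x (sg false) e j / Hx (e * sg false) x * half_gen x (sg false) e k)); last first.
    by apply/funext => k; rewrite big_bool /=; ring.
  by rewrite jacobiD !jacobiZ !jacobi_gen ?sqr_sg// /sg; ring.
have Ke k : K 0%N k.*2 = 2^-1 * (k == 0%N)%:R.
  rewrite /K -(integral_row_density k e2); congr (_ + _).
  by apply: eq_Rintegral => x _; rewrite gen_pair_even.
(* Eigenvector and integral both satisfy this relation, so the odd entries of the first row vanish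
   with the even ones of positive index. *)
have Ko k : K 0%N k.*2.+1 = e * K 0%N k.+1.*2.
  rewrite /K mulrDr -integralZ_bmd//; congr (_ + _); last first.
    by apply: eq_Rintegral => x _; rewrite gen_pair_odd// gen_pair_even.
  have e0 : e != 0 by rewrite -sqrf_eq0 e2.
  have t0 : Num.sqrt 3 != 0 :> R by rewrite gt_eqF// sqrtr_gt0.
  have s0 : s2 != 0 by rewrite gt_eqF// s2_gt0.
  rewrite half_eig_odd half_eig_even exprS sqrt6E.
  set r := (- e * s2) ^+ k.
  have r0 : r != 0 by rewrite expf_neq0// mulf_neq0// oppr_eq0.
  transitivity (half_eig e 0 * (1 / (s2 ^+ 2 * Num.sqrt 3) / r)); last by field; rewrite e0 t0 s0 r0.
  by rewrite sqr_s2.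
apply: nat_parity => [|k|k].
- exact: (Ke 0%N).
- by rewrite Ko Ke !mulr0.
- by rewrite Ke doubleS !mulr0.
Qed.

End Completeness.

(** * The explicit kernel on the integers *)

Section SpectralKernel.
Variable R : realType.
Local Notation leb := (@lebesgue_measure R).
Local Notation D := (`[0, pi]%classic : set R).
Local Notation I := (bool + bool * bool)%type.
Implicit Types (x : R) (b u : bool) (m n z : int).

(* [inl b] is the eigenvector of parity [sg b]; [inr (b, u)] is the family of
   generalized eigenfunctions of parity [sg b] on the branch [sg u]. *)
Definition spec_val (i : I) x : R :=
  match i with
  | inl b => 5 / 4 - sg R b / 2
  | inr (b, u) => 7 / 8 - sg R u * Rx x / 2
  end.

Definition spec_fun (i : I) z x : R :=
  match i with
  | inl b => feig (sg R b) z
  | inr (b, u) => fgen x (sg R u) (sg R b) z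
  end.

(** An eigenvector counts as a family constant in x; the weight 1/pi normalizes the integral over
    [0, pi], so that point and continuous spectrum share one formula. *)
Definition spec_wt (i : I) x : R :=
  match i with inl _ => pi^-1 | inr (b, u) => (Hx (sg R b * sg R u) x)^-1 end.

Lemma cts_spec_val i : ctsR (spec_val i).
Proof.
case: i => [b|[b u]]; first exact: cts_cst.
apply: ctsD; first exact: cts_cst.
apply: ctsN; apply: ctsM; last exact: cts_cst.
by apply: ctsM; [exact: cts_cst|exact: cts_Rx].
Qed.

Lemma spec_val_bounds i x : 0 <= spec_val i x <= 2.
Proof.
have /andP[? ?] := Rx_bounds x.
by case: i => [[]|[b []]]; rewrite /= /sg; apply/andP; split; lra.
Qed.

Lemma bmd_spec_fun i z : bmd (spec_fun i z).
Proof.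
case: i => [b|[b u]]; first exact: bmd_cst.
by apply: continuous_bmd; exact: cts_fgen.
Qed.

Lemma spec_Hx_gt0 b u x : 0 < Hx (sg R b * sg R u) x.
Proof. by rewrite Hx_gt0// sqr_sgM// sqr_sg. Qed.

Lemma bmd_spec_wt i : bmd (spec_wt i).
Proof.
case: i => [b|[b u]]; first exact: bmd_cst.
apply: continuous_bmd; apply: ctsV => [|x]; first exact: cts_Hx.
by rewrite gt_eqF// spec_Hx_gt0.
Qed.

Lemma spec_wt_ge0 i x : 0 <= spec_wt i x.
Proof.
by case: i => [b|[b u]] /=; rewrite invr_ge0 ?pi_ge0// ltW// spec_Hx_gt0.
Qed.

Lemma Lpr_spec_fun i x z :
  Lpr_fun (fun k => (spec_fun i k x)%:C) z = (spec_val i x * spec_fun i z x)%:C.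
Proof.
have extZ e c v y : c * extendZ e v y = extendZ e (fun k => c * v k) y :> R.
  by case: y => k //=; rewrite mulrCA.
have ext e v v' y : v =1 v' -> extendZ e v y = extendZ e v' y :> R.
  by move=> vv'; case: y => k /=; rewrite vv'.
case: i => [b|[b u]] /=.
  rewrite (_ : (fun k => _) = (fun k => (extendZ (sg R b) (half_eig (sg R b)) k)%:C)); last first.
    by apply/funext => k; rewrite feigE.
  rewrite Lpr_extendZ ?sqr_sg// feigE extZ; congr (_%:C); apply: ext => k.
  by rewrite jacobi_eig// sqr_sg.
rewrite (_ : (fun k => _) = (fun k => (extendZ (sg R b) (half_gen x (sg R u) (sg R b)) k)%:C)); last first.
  by apply/funext => k; rewrite fgenE.
rewrite Lpr_extendZ ?sqr_sg// fgenE extZ; congr (_%:C); apply: ext => k.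
by rewrite jacobi_gen// sqr_sg.
Qed.

Local Notation kernel := (spec_kernel spec_val spec_fun spec_wt).

Lemma measurable_spec_val i : measurable_fun setT (spec_val i).
Proof. by apply: continuous_measurable_fun; exact: cts_spec_val. Qed.

Lemma bmd_spec_term (p : R -> R) m n i : bmf p ->
  bmd (fun x => p (spec_val i x) * (spec_fun i m x * spec_fun i n x * spec_wt i x)).
Proof.
apply: bmd_spec; [exact: measurable_spec_val|exact: spec_val_bounds|
  exact: bmd_spec_fun|exact: bmd_spec_wt].
Qed.

Lemma kernelE (p : R -> R) m n : bmf p -> kernel p m n =
  \sum_b p (5 / 4 - sg R b / 2) * (feig (sg R b) m * feig (sg R b) n) +
  \sum_b \sum_u \int[leb]_(x in D) (p (7 / 8 - sg R u * Rx x / 2) *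
    (fgen x (sg R u) (sg R b) m * fgen x (sg R u) (sg R b) n / Hx (sg R b * sg R u) x)).
Proof.
move=> bp; have bt i := bmd_spec_term m n i bp.
rewrite /spec_kernel integral_sum_bmd// big_sumType/=; congr (_ + _).
  apply: eq_bigr => b _; rewrite integral_cst_bmd !mulrA mulfVK//.
  by rewrite gt_eqF// pi_gt0.
by rewrite pair_bigA; apply: eq_bigr => -[b u] _.
Qed.

Definition half_index z : nat := match z with Posz k | Negz k => k end.
Definition side_sign (e : R) z : R := if z is Negz _ then e else 1.

Lemma extendZE e (v : nat -> R) z : extendZ e v z = side_sign e z * v (half_index z).
Proof. by case: z => k //=; rewrite mul1r. Qed.

Lemma kernel1 m n : kernel (cst 1) m n = (m == n)%:R.
Proof.
rewrite kernelE; last exact: bmf_cst.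
(* Each parity contributes half an identity on the half-indices; the two halves add up for indices
   on the same side and cancel for indices on opposite sides. *)
rewrite -big_split/= (eq_bigr (fun b => side_sign (sg R b) m * side_sign (sg R b) n *
    (2^-1 * (half_index m == half_index n)%:R))) => [|b _].
  rewrite big_bool /= /sg; case: m n => m [] n /=; rewrite ?eqz_nat ?mul1r ?mulr1 ?mulrNN ?mul1r.
  - by rewrite -mulrDl -[2^-1]div1r -splitr mul1r.
  - by rewrite mulN1r subrr.
  - by rewrite mulN1r subrr.
  - by rewrite -mulrDl -[2^-1]div1r -splitr mul1r.
rewrite -(half_completeness _ _ (sqr_sg R b)) mulrDr !feigE !extendZE mul1r.
congr (_ + _); first by ring.
rewrite -integralZ_bmd; last by apply: bmd_sum => u; apply: bmd_half_pair; exact: sqr_sg.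
rewrite -integral_sum_bmd; last first.
  by move=> u; exact: (bmd_spec_term m n (inr (b, u)) (bmf_cst 1)).
apply: eq_Rintegral => x _; rewrite /gen_pair mulr_sumr; apply: eq_bigr => u _.
rewrite !fgenE !extendZE; ring.
Qed.

Lemma kernel_calculus : calculus kernel.
Proof.
apply: spec_calculus.
- exact: measurable_spec_val.
- exact: spec_val_bounds.
- exact: bmd_spec_fun.
- exact: bmd_spec_wt.
- exact: spec_wt_ge0.
- exact: Lpr_spec_fun.
- exact: kernel1.
Qed.

(** The extremes correspond to cos x = -1 and cos x = 1, where the band edges in [lambda1] and
    [lambda0] come from. *)
Lemma Rx_range x : Num.sqrt (25 / 16 - Num.sqrt 2) <= Rx x <= Num.sqrt (25 / 16 + Num.sqrt 2).
Proof.
have /andP[c1 c2] := cos_bounds x; have s0 := s2_gt0 R.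
by apply/andP; split; apply: ler_wsqrtr; nra.
Qed.

Lemma Rx_I0 x : I0 (7 / 8 - Rx x / 2).
Proof.
have := Rx_range x; rewrite /I0 /lambda0 /lambda1 /= in_itv /= => /andP[? ?].
by apply/andP; split; lra.
Qed.

Lemma Rx_I1 x : I1 (7 / 8 + Rx x / 2).
Proof.
have := Rx_range x; rewrite /I1 /lambda0 /lambda1 /= in_itv /= => /andP[? ?].
by apply/andP; split; lra.
Qed.

Lemma indic_setI_mem (A B : set R) y : B y -> \1_(A `&` B) y = \1_A y :> R.
Proof. by move=> By; rewrite !indicE in_setI (mem_set By) andbT. Qed.

Lemma kernel_ray (l : R) m n : kernel \1_`]-oo, l] m n = nu_coef l m n.
Proof.
have bI : bmf (\1_`]-oo, l] : R -> R) by apply: bmf_indic; exact: measurable_itv.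
have bt b u := bmd_spec_term m n (inr (b, u)) bI.
have branch u (S : R -> R) :
    (forall x, S x = \sum_b \1_`]-oo, l] (7 / 8 - sg R u * Rx x / 2) *
      (fgen x (sg R u) (sg R b) m * fgen x (sg R u) (sg R b) n / Hx (sg R b * sg R u) x)) ->
    \sum_b \int[leb]_(x in D) (\1_`]-oo, l] (7 / 8 - sg R u * Rx x / 2) *
      (fgen x (sg R u) (sg R b) m * fgen x (sg R u) (sg R b) n / Hx (sg R b * sg R u) x)) =
    \int[leb]_(x in D) S x.
  move=> SE; rewrite -integral_sum_bmd; last by move=> b; exact: (bt b u).
  by apply: eq_Rintegral => x _; rewrite SE.
(* Summing first over the branch u separates the two bands; on the branch u = false the sign mu = -1
   turns the weight of parity e into 1 / H at -e. *)
rewrite kernelE// exchange_big big_bool [X in _ + X]big_bool /= /nu_coef addrA.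
congr (_ + _ + _).
- have -> : 5 / 4 - 1 / 2 = 3 / 4 :> R by lra.
  have -> : 5 / 4 - -1 / 2 = 7 / 4 :> R by lra.
  by rewrite [feig 1 n * _]mulrC [feig (-1) n * _]mulrC.
- apply: (branch true) => x; rewrite !big_cons big_nil big_bool /= indic_setI_mem; last exact: Rx_I0.
  rewrite /sg mul1r addr0 !mulr1 -mulrDr.
  by congr (_ * (_ / _ + _ / _)); rewrite mulrC.
- apply: (branch false) => x; rewrite !big_cons big_nil big_bool /= indic_setI_mem; last exact: Rx_I1.
  rewrite /sg !mulN1r mulNr !opprK addr0 mul1r -mulrDr.
  by congr (_ * (_ / _ + _ / _)); rewrite mulrC.
Qed.

End SpectralKernel.

Theorem proposition5p5 (R : realType) :
  exists nu : set (measurableTypeR R) -> {linear ell2 R -> ell2 R},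
    [/\ is_spectral_measure nu (@Lpr R) /\
        (forall nu', is_spectral_measure nu' (@Lpr R) -> pvm_eq nu' nu),
        forall t : R, 0 <= t ->
          exists2 h : {linear ell2 R -> ell2 R},
            is_exponential (fun g => (- t)%:C *: Lpr g) h
            & is_spectral_integral nu (fun l => expR (- t * l)) h,
        forall l : R, has_kernel (nu `]-oo, l]%classic) (@nu_coef R l)
      & forall nu', projection_valued_measure nu' ->
          (forall l : R, has_kernel (nu' `]-oo, l]%classic) (@nu_coef R l)) ->
          pvm_eq nu' nu].
Proof.
(* Existence, uniqueness and the exponential hold for any [calculus]; the explicit eigenfunctions
   enter only here and in [kernel_ray]. *)
pose HM := kernel_calculus R.
have kernel_nu (l : R) : has_kernel (specm HM `]-oo, l]%classic) (@nu_coef R l).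
  have bI : bmf (\1_`]-oo, l] : R -> R) by apply: bmf_indic; exact: measurable_itv.
  have := opE_kernel HM bI; congr has_kernel.
  by apply/funext => m; apply/funext => n; exact: kernel_ray.
exists (specm HM); split=> //.
- split; first exact: specm_is_spectral_measure.
  by move=> nu' Hnu'; exact: specm_uniq.
- move=> t t0; exists (opE HM (fun x => expR (- t * x))); first exact: opE_exponential.
  by apply: specm_spectral_integral => //; exact: bmf_expR.
(* A kernel determines its operator, and the rays generate the Borel sets. *)
- move=> nu' Hnu' knu'; apply: pvm_eq_rays => //; first exact: specm_pvm.
  by move=> l g; exact: has_kernel_uniq (knu' l) (kernel_nu l) g.
Qed.
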